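(* The algebra $\hat{\mathcal{S}}(\mathbb{R}^n)$ of rapidly decreasing (Schwartz) functions on $\mathbb{R}^n$, with pointwise multiplication and with comultiplication $\Delta(f)(s,t)=f(s+t)$, is a bornological quantum group.
   Context: Conventions. Vector spaces are complex. A bornological vector space is a vector space with a convex bornology, whose members are called small sets; it is always assumed complete (every small set lies in a small disk $T$ whose linear span $\langle T\rangle$ is a Banach space for the Minkowski gauge of $T$). $\mathrm{Hom}(V,W)$ is the space of bounded linear maps (those mapping small sets to small sets) with the equibounded bornology; all linear maps considered are bounded and isomorphisms are bounded with bounded inverse. $\hat\otimes$ is the completed bornological tensor product (universal for bounded bilinear maps). $V$ has the approximation property if for each compact disk $S\subset V$ (i.e. compact in some Banach space $\langle T\rangle$, $T$ a small disk) there is a sequence of bounded finite rank operators $f_n:V\to V$ with $f_n\to\mathrm{id}$ in $\mathrm{Hom}(\langle S\rangle,V)$. A bornological algebra is a bornological vector space $H$ with a bounded associative multiplication $\mu:H\hat\otimes H\to H$ (no unit required). For a right $H$-module $M$ and a left $H$-module $V$, $M\hat\otimes_H V$ is the quotient of $M\hat\otimes V$ by the closure of the span of all $mh\otimes v-m\otimes hv$. A left $H$-module $V$ is essential if the action induces an isomorphism $H\hat\otimes_H V\cong V$ (similarly for right modules); $H$ is essential if it is nonzero and $\mu$ induces an isomorphism $H\hat\otimes_H H\cong H$. The multiplier algebra $M(H)$ consists of pairs $(L,R)$ of bounded linear maps $H\to H$ with $L(fg)=L(f)g$, $R(fg)=fR(g)$, $fL(g)=R(f)g$, with the bornology and multiplication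 inherited from left and right multipliers. A homomorphism $f:H\to M(K)$ is essential if it turns $K$ into an essential left and right $H$-module; for essential $K$ it extends uniquely to a unital homomorphism $M(H)\to M(K)$, denoted by the same letter. A bounded functional $\omega$ on $H$ is faithful if ($\omega(fg)=0$ for all $g$) implies $f=0$ and ($\omega(fg)=0$ for all $f$) implies $g=0$. Bornological quantum groups. Let $H$ be an essential bornological algebra with the approximation property and a faithful bounded functional; then $H\subset M(H)$, and similarly for tensor powers. A comultiplication is an essential homomorphism $\Delta:H\to M(H\hat\otimes H)$ with $(\Delta\hat\otimes\mathrm{id})\Delta=(\mathrm{id}\hat\otimes\Delta)\Delta$. Its Galois maps $H\hat\otimes H\to M(H\hat\otimes H)$ are $\gamma_l(f\otimes g)=\Delta(f)(g\otimes 1)$, $\gamma_r(f\otimes g)=\Delta(f)(1\otimes g)$, $\rho_l(f\otimes g)=(f\otimes 1)\Delta(g)$, $\rho_r(f\otimes g)=(1\otimes f)\Delta(g)$. If these are bounded maps into $H\hat\otimes H$, then for a bounded functional $\omega$ the multiplier $(\mathrm{id}\hat\otimes\omega)\Delta(f)\in M(H)$ is defined by $(\mathrm{id}\hat\otimes\omega)\Delta(f)\cdot g=(\mathrm{id}\hat\otimes\omega)\gamma_l(f\otimes g)$, $g\cdot(\mathrm{id}\hat\otimes\omega)\Delta(f)=(\mathrm{id}\hat\otimes\omega)\rho_l(g\otimes f)$. A bounded functional $\phi$ is left invariant if $(\mathrm{id}\hat\otimes\phi)\Delta(f)=\phi(f)1$ for all $f$. A bornological quantum group is an essential bornological algebra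 with the approximation property together with a comultiplication all of whose four Galois maps are isomorphisms of $H\hat\otimes H$ onto itself, and a faithful left invariant functional. The example. $\mathcal{S}(\mathbb{R}^n)$ is the nuclear Fréchet space of smooth functions with finite seminorms $p^k_\alpha(f)=\sup_x|\partial^\alpha f(x)(1+|x|)^k|$ for all multiindices $\alpha$ and integers $k\ge 0$, with the bornology of bounded (equivalently precompact) subsets; $\hat{\mathcal{S}}(\mathbb{R}^n)$ denotes it with pointwise multiplication. $\hat{\mathcal S}(\mathbb{R}^n)\hat\otimes\hat{\mathcal S}(\mathbb{R}^n)\cong\hat{\mathcal S}(\mathbb{R}^{2n})$, and multipliers of $\hat{\mathcal{S}}(\mathbb{R}^n)$ are the slowly increasing smooth functions (for each $\alpha$ there is $k$ with $\sup_x|(1+|x|)^{-k}\partial^\alpha f(x)|<\infty$), so $\Delta(f)(s,t)=f(s+t)$ is a map into $M(\hat{\mathcal S}(\mathbb{R}^n)\hat\otimes\hat{\mathcal S}(\mathbb{R}^n))$. The left invariant functional is the Lebesgue integral. *)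

(* Defs.v *)
From HB Require Import structures.
From mathcomp Require Import all_boot all_order all_algebra.
From mathcomp Require Import complex ring_quotient ring.
From mathcomp Require Import all_classical all_reals all_analysis.

Set Implicit Arguments.
Unset Strict Implicit.
Unset Printing Implicit Defensive.

Import Order.TTheory GRing.Theory Num.Theory.
Import ComplexField.Normc.
Import numFieldNormedType.Exports.

Local Open Scope classical_set_scope.
Local Open Scope ring_scope.
Local Open Scope complex_scope.

Section Disks.
Context {R : realType} {V : lmodType R[i]}.
Implicit Types (S T : set V) (x : V).

Definition circled T := forall (c : R[i]) x, normc c <= 1 -> T x -> T (c *: x).

Definition convex T := forall (t : R) x y, 0 <= t <= 1 -> T x -> T y ->
  T (t%:C *: x + (1 - t)%:C *: y).

Definition disk T := [/\ T 0, circled T & convex T].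

Definition disked_hull S : set V := \bigcap_(T in [set T | disk T /\ S `<=` T]) T.

Definition lspan S : set V := [set x | exists (m : nat) (c : 'I_m -> R[i]) (v : 'I_m -> V),
  (forall i, S (v i)) /\ x = \sum_i c i *: v i].

Definition gauge T x : R :=
  inf [set r : R | 0 < r /\ exists2 y, T y & x = r%:C *: y].

Definition banach_disk T := [/\ disk T,
  forall x, lspan T x -> gauge T x = 0 -> x = 0 &
  forall u : nat -> V, (forall n, lspan T (u n)) ->
    (forall e : R, 0 < e ->
       exists N, forall m n, (N <= m)%N -> (N <= n)%N -> gauge T (u m - u n) < e) ->
    exists2 x, lspan T x & gauge T (u n - x) @[n --> \oo] --> (0 : R)].

Definition gauge_open T (U : set V) := forall x, lspan T x -> U x ->
  exists2 e : R, 0 < e & forall y, lspan T y -> gauge T (y - x) < e -> U y.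

Definition gauge_compact T S := S `<=` lspan T /\
  forall F : set (set V), (forall U, F U -> gauge_open T U) ->
    S `<=` \bigcup_(U in F) U ->
    exists G : set (set V), [/\ finite_set G, G `<=` F & S `<=` \bigcup_(U in G) U].

Lemma disked_hullP S : disk (disked_hull S).
Proof.
split; first by move=> T [[]].
- by move=> c x c1 Sx T dT; have [[_ cT _] _] := dT; apply/cT => //; exact: Sx.
- move=> t x y t1 Sx Sy T dT; have [[_ _ cT] _] := dT.
  by apply: cT => //; [exact: Sx|exact: Sy].
Qed.

Lemma sub_disked_hull S : S `<=` disked_hull S.
Proof. by move=> x Sx T [_]; exact. Qed.

Lemma disked_hull_min S T : disk T -> S `<=` T -> disked_hull S `<=` T.
Proof. by move=> dT ST x; apply. Qed.

Lemma diskZ T (r s : R) x : disk T -> 0 <= r -> r <= s -> T x ->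
  exists2 y, T y & r%:C *: x = s%:C *: y.
Proof.
move=> [T0 cT _] r0 rs Tx.
have [s0|s0] := eqVneq s 0.
  have {}rs : r = 0 by apply/eqP; rewrite eq_le r0 -s0 rs.
  by exists 0 => //; rewrite rs scale0r scaler0.
have sp : 0 < s by rewrite lt_neqAle eq_sym s0 (le_trans r0).
exists ((r / s)%:C *: x).
  apply: cT => //; rewrite /normc /= expr0n addr0 sqrtr_sqr ger0_norm ?divr_ge0//.
    by rewrite ler_pdivrMr ?mul1r.
  exact: ltW.
by rewrite scalerA -rmorphM mulrCA divff ?mulr1.
Qed.

Lemma diskD T (r s : R) x y : disk T -> 0 <= r -> 0 <= s -> T x -> T y ->
  exists2 z, T z & r%:C *: x + s%:C *: y = (r + s)%:C *: z.
Proof.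
move=> dT r0 s0 Tx Ty; have [T0 cT xT] := dT.
have [rs0|rs0] := eqVneq (r + s) 0.
  have /andP[/eqP -> /eqP ->] : (r == 0) && (s == 0) by rewrite -paddr_eq0 ?rs0.
  by exists 0 => //; rewrite !scale0r addr0 scaler0.
exists ((r / (r + s))%:C *: x + (1 - r / (r + s))%:C *: y).
  apply: xT => //; rewrite divr_ge0 ?addr_ge0//= ler_pdivrMr ?mul1r ?lerDl//.
  by rewrite lt_neqAle eq_sym rs0 addr_ge0.
have -> : 1 - r / (r + s) = s / (r + s).
  by rewrite -[X in X - _](divff rs0) -mulrBl addrAC subrr add0r.
by rewrite scalerDr !scalerA -!rmorphM ![(r + s) * _]mulrC !mulfVK.
Qed.

Lemma lspan_submod S : subsemimod_closed (fun x => `[< lspan S x >]).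
Proof.
split; first split.
- apply/asboolP; exists 0%N, (fun=> 0), (fun=> 0); split; first by case.
  by rewrite big_ord0.
- move=> x y /asboolP [m [c [v [vS ->]]]] /asboolP [m' [c' [v' [vS' ->]]]].
  apply/asboolP; exists (m + m')%N,
    (fun i => match fintype.split i with inl i => c i | inr i => c' i end),
    (fun i => match fintype.split i with inl i => v i | inr i => v' i end).
  split=> [i|]; first by case: fintype.split.
  rewrite big_split_ord /=; congr (_ + _); apply: eq_bigr => i _.
    by rewrite -[lshift _ _]/(unsplit (inl i)) unsplitK.
  by rewrite -[rshift _ _]/(unsplit (inr i)) unsplitK.
- move=> a x /asboolP [m [c [v [vS ->]]]]; apply/asboolP.
  exists m, (fun i => a * c i), v; split=> //.
  by rewrite scaler_sumr; apply: eq_bigr => i _; rewrite scalerA.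
Qed.

Lemma lspan_hull S x : lspan S x ->
  exists2 r : R, 0 <= r & exists2 y, disked_hull S y & x = r%:C *: y.
Proof.
have dH := disked_hullP S; have [H0 cH xH] := dH.
move=> [m [c [v [vS ->]]]].
apply: (big_ind (fun x => exists2 r : R, 0 <= r &
  exists2 y, disked_hull S y & x = r%:C *: y)) => [|a b|i _].
- exists 0 => //; exists 0; [exact: H0|by rewrite scaler0].
- move=> [r r0 [y Hy ->]] [s s0 [z Hz ->]]; exists (r + s); first exact: addr_ge0.
  by have [w Hw ->] := diskD dH r0 s0 Hy Hz; exists w.
have [->|ci0] := eqVneq (c i) 0.
  by exists 0 => //; exists 0; rewrite ?scale0r ?scaler0.
have nc0 : normc (c i) != 0 by apply: contra ci0 => /eqP/eq0_normc ->.
have nc : 0 <= normc (c i) by case: (c i) => ? ? /=; rewrite sqrtr_ge0.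
exists (normc (c i)) => //; exists (((normc (c i))^-1)%:C *: (c i *: v i)).
  rewrite scalerA; apply: cH; last by apply: sub_disked_hull; exact: vS.
  rewrite normcM [X in X * _](_ : _ = (normc (c i))^-1) ?mulVf//.
  by rewrite {1}/normc /= expr0n addr0 sqrtr_sqr ger0_norm ?invr_ge0.
by rewrite scalerA -rmorphM divff// scale1r.
Qed.

End Disks.

HB.mixin Record Lmodule_isBornological (R : realType) V of GRing.Lmodule R[i] V := {
  small : set (set V);
  small1 : forall x : V, small [set x];
  smallS : forall A B : set V, A `<=` B -> small B -> small A;
  smallU : forall A B : set V, small A -> small B -> small (A `|` B);
  smallD : forall A B : set V, small A -> small B -> small [set x + y | x in A & y in B];
  smallZ : forall (c : R[i]) (A : set V), small A -> small [set c *: x | x in A];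
  small_hull : forall A : set V, small A -> small (disked_hull A)
}.

#[short(type="bornType")]
HB.structure Definition Bornological (R : realType) :=
  {V of Lmodule_isBornological R V & GRing.Lmodule R[i] V}.

Arguments small {R s}.
Arguments smallS {R s} [A B].
Arguments smallU {R s} [A B].
Arguments smallD {R s} [A B].
Arguments smallZ {R s} c [A].
Arguments small_hull {R s} [A].

Section Bornology.
Context {R : realType}.

Definition complete (V : bornType R) := forall S : set V, small S ->
  exists T : set V, [/\ small T, S `<=` T & banach_disk T].

(* bornological (Mackey) convergence: u tends to x in <T> for some small disk T *)
Definition bcvg (V : bornType R) (u : nat -> V) (x : V) :=
  exists (T : set V) (e : nat -> R), [/\ small T, e n @[n --> \oo] --> (0 : R) &
    forall n, exists2 y, T y & u n - x = (e n)%:C *: y].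

Definition bclosed (V : bornType R) (A : set V) :=
  forall (u : nat -> V) x, (forall n, A (u n)) -> bcvg u x -> A x.

(* the smallest bornologically closed set containing A *)
Definition bclosure (V : bornType R) (A : set V) : set V :=
  \bigcap_(B in [set B | bclosed B /\ A `<=` B]) B.

Definition bounded_map (V W : bornType R) (f : V -> W) :=
  forall A, small A -> small (f @` A).

Definition bounded_bilinear (U V W : bornType R) (b : U -> V -> W) :=
  [/\ forall u, linear (b u), forall v, linear (b^~ v) &
      forall A B, small A -> small B -> small [set b x y | x in A & y in B]].

End Bornology.

Section Hom.
Context {R : realType}.
Variables V W : bornType R.

Definition is_bhom (f : V -> W) : bool := `[< linear f /\ bounded_map f >].

Record bhom := BHom { bhom_fun :> V -> W; _ : is_bhom bhom_fun }.
HB.instance Definition _ := [isSub for bhom_fun].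
HB.instance Definition _ := [Choice of bhom by <:].

Fact is_bhom_submod : subsemimod_closed is_bhom.
Proof.
split; first split.
- apply/asboolP; split=> [a x y|A sA]; first by rewrite /= scaler0 addr0.
  by apply: smallS (small1 (0 : W)) => _ [x _ <-].
- move=> f g /asboolP[lf bf] /asboolP[lg bg]; apply/asboolP; split.
    by move=> a x y; rewrite /GRing.add/= lf lg scalerDr addrACA.
  move=> A sA; apply: smallS (smallD (bf _ sA) (bg _ sA)).
  by move=> _ [x Ax <-]; exists (f x); [exists x|exists (g x) => //; exists x].
- move=> c f /asboolP[lf bf]; apply/asboolP; split.
    move=> a x y; rewrite -[LHS]/(c *: f (a *: x + y)) lf.
    by rewrite -[RHS]/(a *: (c *: f x) + c *: f y) scalerDr !scalerA mulrC.
  move=> A sA; apply: smallS (smallZ c (bf _ sA)).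
  by move=> _ [x Ax <-]; exists (f x); [exists x|].
Qed.

HB.instance Definition _ := GRing.isSubmodClosed.Build R[i] (V -> W) is_bhom is_bhom_submod.
HB.instance Definition _ := [SubChoice_isSubLmodule of bhom by <:].

Lemma bhom_linear (f : bhom) : linear f.
Proof. by case: f => f /= /asboolP[]. Qed.

Lemma bhom_bounded (f : bhom) : bounded_map f.
Proof. by case: f => f /= /asboolP[]. Qed.

HB.instance Definition _ (f : bhom) := GRing.isLinear.Build R[i] V W *:%R f (bhom_linear f).

Definition equibounded (E : set bhom) :=
  forall A, small A -> small [set f x | f in E & x in A].

Fact equibounded1 (f : bhom) : equibounded [set f].
Proof.
by move=> A /(bhom_bounded f); apply: smallS => _ [_ -> [x Ax <-]]; exists x.
Qed.

Fact equiboundedS (E F : set bhom) : E `<=` F -> equibounded F -> equibounded E.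
Proof.
move=> EF bF A /bF; apply: smallS => _ [f Ef [x Ax <-]].
by exists f; [exact: EF|exists x].
Qed.

Fact equiboundedU (E F : set bhom) :
  equibounded E -> equibounded F -> equibounded (E `|` F).
Proof.
move=> bE bF A sA; apply: smallS (smallU (bE _ sA) (bF _ sA)).
by move=> _ [f [Ef|Ef] [x Ax <-]]; [left|right]; exists f => //; exists x.
Qed.

Fact equiboundedD (E F : set bhom) :
  equibounded E -> equibounded F -> equibounded [set f + g | f in E & g in F].
Proof.
move=> bE bF A sA; apply: smallS (smallD (bE _ sA) (bF _ sA)).
move=> _ [_ [f Ef [g Fg <-]] [x Ax <-]].
by exists (f x); [exists f => //; exists x|exists (g x) => //; exists g => //; exists x].
Qed.

Fact equiboundedZ (c : R[i]) (E : set bhom) :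
  equibounded E -> equibounded [set c *: f | f in E].
Proof.
move=> bE A sA; apply: smallS (smallZ c (bE _ sA)).
by move=> _ [_ [f Ef <-] [x Ax <-]]; exists (f x) => //; exists f => //; exists x.
Qed.

Fact equibounded_hull (E : set bhom) : equibounded E -> equibounded (disked_hull E).
Proof.
move=> bE A sA; apply: smallS (small_hull (bE _ sA)) => _ [f Ef [x Ax <-]].
have [H0 cH xH] := disked_hullP [set f x | f in E & x in A].
suff : [set f : bhom | disked_hull [set f x | f in E & x in A] (f x)] f by [].
apply: Ef; split; last first.
  by move=> g Eg /=; apply: sub_disked_hull; exists g => //; exists x.
split => //=.
- by move=> c g c1 Hg; apply: cH.
- by move=> t g h t1 Hg Hh; apply: xH.
Qed.

HB.instance Definition _ := Lmodule_isBornological.Build R bhom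
  equibounded1 equiboundedS equiboundedU equiboundedD equiboundedZ equibounded_hull.

End Hom.

Section Induced.
Context {R : realType}.
Variables (V : lmodType R[i]) (W : bornType R) (f : V -> W).
Hypothesis lf : linear f.
HB.instance Definition _ := GRing.isLinear.Build R[i] V W *:%R f lf.
Definition induced_small (A : set V) := small (f @` A).

Fact induced1 x : induced_small [set x].
Proof. by apply: smallS (small1 (f x)) => _ [_ -> <-]. Qed.
Fact inducedS (A B : set V) : A `<=` B -> induced_small B -> induced_small A.
Proof. by move=> AB; apply: smallS; exact: image_subset. Qed.
Fact inducedU (A B : set V) :
  induced_small A -> induced_small B -> induced_small (A `|` B).
Proof. by rewrite /induced_small image_setU; exact: smallU. Qed.
Fact inducedD (A B : set V) :
  induced_small A -> induced_small B -> induced_small [set x + y | x in A & y in B].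
Proof.
move=> sA sB; apply: smallS (smallD sA sB) => _ [_ [x Ax [y By <-]] <-].
by exists (f x); [exists x|exists (f y); [exists y|rewrite linearD]].
Qed.
Fact inducedZ (c : R[i]) (A : set V) :
  induced_small A -> induced_small [set c *: x | x in A].
Proof.
move=> sA; apply: smallS (smallZ c sA) => _ [_ [x Ax <-] <-].
by exists (f x); [exists x|rewrite linearZ].
Qed.
Fact induced_hull (A : set V) : induced_small A -> induced_small (disked_hull A).
Proof.
move=> sA; apply: smallS (small_hull sA) => _ [x Ax <-].
have [H0 cH xH] := disked_hullP (f @` A).
suff : (f @^-1` disked_hull (f @` A)) x by [].
apply: Ax; split; last by move=> y Ay; apply: sub_disked_hull; exists y.
split; rewrite /preimage/=; first by rewrite linear0.
- by move=> c y c1 Hy; rewrite /= linearZ; apply: cH.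
- by move=> t y z t1 Hy Hz; rewrite /= linearD !linearZ; apply: xH.
Qed.

Definition induced_bornology := Lmodule_isBornological.Build R V
  induced1 inducedS inducedU inducedD inducedZ induced_hull.
End Induced.

Section Product.
Context {R : realType}.
Variables V W : bornType R.

Definition prod_small (A : set (V * W)) := small (fst @` A) /\ small (snd @` A).

Let flin : linear (fst : V * W -> V). Proof. by []. Qed.
Let slin : linear (snd : V * W -> W). Proof. by []. Qed.

Fact prod1 x : prod_small [set x].
Proof. split; [exact: (induced1 fst)|exact: (induced1 snd)]. Qed.
Fact prodS A B : A `<=` B -> prod_small B -> prod_small A.
Proof.
by move=> AB [sB tB]; split; [exact: (@inducedS _ _ _ fst _ _ AB)
  | exact: (@inducedS _ _ _ snd _ _ AB)].
Qed.
Fact prodU A B : prod_small A -> prod_small B -> prod_small (A `|` B).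
Proof. by move=> [? ?] [? ?]; split; apply: inducedU. Qed.
Fact prodD A B : prod_small A -> prod_small B -> prod_small [set x + y | x in A & y in B].
Proof. by move=> [? ?] [? ?]; split; apply: inducedD. Qed.
Fact prodZ (c : R[i]) A : prod_small A -> prod_small [set c *: x | x in A].
Proof. by move=> [? ?]; split; apply: inducedZ. Qed.
Fact prod_hull A : prod_small A -> prod_small (disked_hull A).
Proof. by move=> [? ?]; split; apply: induced_hull. Qed.

HB.instance Definition _ := Lmodule_isBornological.Build R (V * W)%type
  prod1 prodS prodU prodD prodZ prod_hull.
End Product.

Section Scalars.
Context {R : realType}.

Definition scalar_small (A : set R[i]^o) := exists M : R, forall z, A z -> normc z <= M.

Fact scalar1 z : scalar_small [set z].
Proof. by exists (normc z) => _ ->. Qed.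
Fact scalarS A B : A `<=` B -> scalar_small B -> scalar_small A.
Proof. by move=> AB [M BM]; exists M => z /AB /BM. Qed.
Fact scalarU A B : scalar_small A -> scalar_small B -> scalar_small (A `|` B).
Proof.
move=> [M AM] [N BN]; exists (Num.max M N) => z [/AM|/BN] zM; rewrite le_max zM //.
by rewrite orbT.
Qed.
Fact scalarD A B : scalar_small A -> scalar_small B ->
  scalar_small [set x + y | x in A & y in B].
Proof.
move=> [M AM] [N BN]; exists (M + N) => _ [x /AM xM [y /BN yN <-]].
by rewrite (le_trans (le_normcD _ _))// lerD.
Qed.
Fact scalarZ (c : R[i]) A : scalar_small A -> scalar_small [set c *: x | x in A].
Proof.
move=> [M AM]; exists (normc c * M) => _ [x /AM xM <-].
by rewrite normcM ler_wpM2l//; case: c => ? ? /=; rewrite sqrtr_ge0.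
Qed.
Fact scalar_hull A : scalar_small A -> scalar_small (disked_hull A).
Proof.
have nc0 (c : R[i]) : 0 <= normc c by case: c => ? ? /=; rewrite sqrtr_ge0.
have ncR (t : R) : 0 <= t -> normc t%:C = t.
  by move=> t0; rewrite /normc /= expr0n addr0 sqrtr_sqr ger0_norm.
move=> [M AM]; exists (Num.max 0 M); apply: disked_hull_min; last first.
  by move=> z /AM zM; rewrite le_max zM orbT.
split=> [|c x c1 xM|t x y /andP[t0 t1] xM yM].
- by rewrite normc0 le_max lexx.
- by rewrite normcM (le_trans _ xM)// ler_piMl.
- rewrite (le_trans (le_normcD _ _))// !normcM !ncR ?subr_ge0//.
  have -> : Num.max 0 M = t * Num.max 0 M + (1 - t) * Num.max 0 M.
    by rewrite -mulrDl addrCA subrr addr0 mul1r.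
  by rewrite lerD// ler_wpM2l// subr_ge0.
Qed.

HB.instance Definition _ := Lmodule_isBornological.Build R R[i]^o
  scalar1 scalarS scalarU scalarD scalarZ scalar_hull.

End Scalars.

Section Span.
Context {R : realType} {V : lmodType R[i]}.
Variable S : set V.

Definition in_span (x : V) : bool := `[< lspan S x >].

(* The space <S>. For a disk S its small sets are those bounded for the gauge of S. *)
Record dspan := DSpan { dspan_val :> V; _ : in_span dspan_val }.
HB.instance Definition _ := [isSub for dspan_val].
HB.instance Definition _ := [Choice of dspan by <:].
HB.instance Definition _ :=
  GRing.isSubmodClosed.Build R[i] V in_span (lspan_submod S).
HB.instance Definition _ := [SubChoice_isSubLmodule of dspan by <:].

Definition span_small (A : set dspan) := exists2 r : R, 0 <= r &
  forall x, A x -> exists2 y, disked_hull S y & dspan_val x = r%:C *: y.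

Let dH : disk (disked_hull S) := disked_hullP S.

Fact span_small1 x : span_small [set x].
Proof.
by case: x => x Sx; have /asboolP/lspan_hull [r r0 yP] := Sx; exists r => // _ ->.
Qed.
Fact span_smallS A B : A `<=` B -> span_small B -> span_small A.
Proof. by move=> AB [r r0 Br]; exists r => // x /AB /Br. Qed.
Fact span_smallU A B : span_small A -> span_small B -> span_small (A `|` B).
Proof.
move=> [r r0 Ar] [s s0 Bs]; exists (Num.max r s); first by rewrite le_max r0.
move=> x [/Ar|/Bs] [y Sy ->]; apply: diskZ => //; rewrite le_max lexx ?orbT//.
Qed.
Fact span_smallD A B : span_small A -> span_small B ->
  span_small [set x + y | x in A & y in B].
Proof.
move=> [r r0 Ar] [s s0 Bs]; exists (r + s); first exact: addr_ge0.
move=> _ [x /Ar [x' Sx' xE] [y /Bs [y' Sy' yE] <-]].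
by rewrite -[dspan_val _]/(dspan_val x + dspan_val y) xE yE; apply: diskD.
Qed.
Fact span_smallZ (c : R[i]) A : span_small A -> span_small [set c *: x | x in A].
Proof.
have nc0 : 0 <= normc c by case: c => ? ? /=; rewrite sqrtr_ge0.
move=> [r r0 Ar]; exists (normc c * r); first exact: mulr_ge0.
move=> _ [x /Ar [y Sy xE] <-]; rewrite -[dspan_val _]/(c *: dspan_val x) xE scalerA.
have [_ cT _] := dH.
have [->|c0] := eqVneq c 0.
  by exists y => //; rewrite normc0 !mul0r.
have n0 : normc c != 0 by apply: contra c0 => /eqP/eq0_normc ->.
exists ((c / (normc c)%:C) *: y).
  apply: cT => //; rewrite normcM normcV [X in X^-1](_ : _ = normc c) ?divff//.
  by rewrite {1}/normc /= expr0n addr0 sqrtr_sqr ger0_norm.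
have n1 : (normc c)%:C != 0 by rewrite fmorph_eq0.
by rewrite scalerA rmorphM /= [X in _ = X *: y]mulrC mulrA divfK.
Qed.
Fact span_small_hull A : span_small A -> span_small (disked_hull A).
Proof.
move=> [r r0 Ar]; exists r => //; apply: disked_hull_min => //.
have [T0 cT xT] := dH.
split=> [|c x c1 [y Sy xE]|t x y t1 [x' Sx' xE] [y' Sy' yE]].
- by exists 0; rewrite ?scaler0.
- exists (c *: y); first exact: cT.
  by rewrite -[LHS]/(c *: dspan_val x) xE !scalerA mulrC.
- exists (t%:C *: x' + (1 - t)%:C *: y'); first exact: xT.
  rewrite -[LHS]/(t%:C *: dspan_val x + (1 - t)%:C *: dspan_val y) xE yE.
  by rewrite scalerDr !scalerA [t%:C * _]mulrC [(1 - t)%:C * _]mulrC.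
Qed.

HB.instance Definition _ := Lmodule_isBornological.Build R dspan
  span_small1 span_smallS span_smallU span_smallD span_smallZ span_small_hull.

End Span.

Section Approximation.
Context {R : realType}.
Variable V : bornType R.

Definition compact_disk (S : set V) := disk S /\
  exists T : set V, [/\ small T, banach_disk T & gauge_compact T S].

Definition finite_rank (f : V -> V) :=
  exists2 F : set V, finite_set F & range f `<=` lspan F.

(* g n and j are f n and the identity, as elements of Hom(<S>, V) *)
Definition approximation_property := forall S : set V, compact_disk S ->
  exists (f : nat -> bhom V V) (g : nat -> bhom (dspan S) V) (j : bhom (dspan S) V),
    [/\ forall n, finite_rank (f n), forall n x, g n x = f n (dspan_val x),
        forall x, j x = dspan_val x & bcvg g j].

End Approximation.

Section Quotient.
Context {R : realType} {V : bornType R}.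
Variable N : set V.

Definition closed_span (x : V) : bool := `[< bclosure (lspan N) x >].

Fact closed_span_submod : subsemimod_closed closed_span.
Proof.
have [[l0 lD] lZ] := lspan_submod N.
have sub x : lspan N x -> bclosure (lspan N) x by move=> Nx A [_]; exact.
have trans a A : bclosed A -> bclosed [set x : V | A (a + x)].
  move=> cA u x Au [T [e [sT e0 ue]]]; apply: (cA (fun n => a + u n)) => //.
  exists T, e; split=> // n; have [y Ty uE] := ue n; exists y => //.
  by rewrite -uE opprD addrACA subrr add0r.
have dil c A : bclosed A -> bclosed [set x : V | A (c *: x)].
  move=> cA u x Au [T [e [sT e0 ue]]]; apply: (cA (fun n => c *: u n)) => //.
  exists [set c *: y | y in T], e; split=> //; first exact: smallZ.
  move=> n; have [y Ty uE] := ue n; exists (c *: y); first by exists y.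
  by rewrite -scalerBr uE !scalerA mulrC.
split; first split.
- by apply/asboolP; apply: sub; apply/asboolP; exact: l0.
- move=> x y /asboolP clx /asboolP cly; apply/asboolP.
  have step a : lspan N a -> bclosure (lspan N) (a + y).
    move=> Na A [cA NA]; apply: (cly [set z | A (a + z)]).
    split; first exact: trans.
    by move=> z Nz; apply: NA; apply/asboolP; apply: lD; apply/asboolP.
  move=> A [cA NA]; rewrite addrC; apply: (clx [set z | A (y + z)]).
  split; first exact: trans.
  by move=> z Nz /=; rewrite addrC; apply: (step z Nz).
- move=> c x /asboolP clx; apply/asboolP => A [cA NA].
  apply: (clx [set z | A (c *: z)]); split; first exact: dil.
  by move=> z Nz; apply: NA; apply/asboolP; apply: lZ; apply/asboolP.
Qed.

HB.instance Definition _ :=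
  GRing.isSubmodClosed.Build R[i] V closed_span closed_span_submod.

Definition closed_submod : zmodClosed V := GRing.ZmodClosed.clone V closed_span _.

(* V modulo the closure of the span of N *)
Definition bquot := Quotient.quot closed_submod.
HB.instance Definition _ := GRing.Zmodule.on bquot.

Definition bproj (x : V) : bquot := \pi_(Quotient.quot closed_submod)%qT x.

Let pi_eq x y : (bproj x == bproj y) = (x - y \in closed_span).
Proof. by rewrite -Quotient.idealrBE. Qed.

Let piD x y : bproj (x + y) = bproj x + bproj y.
Proof. exact: (raddfD \pi_(Quotient.quot closed_submod)%qT). Qed.

Let reprK (q : bquot) : bproj (repr q) = q.
Proof. exact: generic_quotient.reprK. Qed.

Definition bquot_scale (c : R[i]) (q : bquot) : bquot := bproj (c *: repr q).

Let piZ c x : bproj (c *: x) = bquot_scale c (bproj x).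
Proof.
apply/eqP; rewrite pi_eq -scalerBr rpredZ// -pi_eq; apply/eqP.
by rewrite reprK.
Qed.

Fact bquot_scaleA a b q : bquot_scale a (bquot_scale b q) = bquot_scale (a * b) q.
Proof. by rewrite -(reprK q) -!piZ scalerA. Qed.
Fact bquot_scale1 : left_id 1 bquot_scale.
Proof. by move=> q; rewrite -(reprK q) -piZ scale1r. Qed.
Fact bquot_scaleDr : right_distributive bquot_scale +%R.
Proof.
move=> a x y; rewrite -(reprK x) -(reprK y) -piD -!piZ -piD.
by rewrite scalerDr.
Qed.
Fact bquot_scaleDl q : {morph bquot_scale^~ q : a b / a + b}.
Proof. by move=> a b; rewrite -(reprK q) -!piZ -piD scalerDl. Qed.

HB.instance Definition _ := GRing.Zmodule_isLmodule.Build R[i] bquot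
  bquot_scaleA bquot_scale1 bquot_scaleDr bquot_scaleDl.

Fact bproj_linear : linear bproj.
Proof. by move=> a x y; rewrite piD piZ. Qed.
HB.instance Definition _ := GRing.isLinear.Build R[i] V bquot *:%R bproj bproj_linear.

Definition bquot_small (A : set bquot) := exists2 B, small B & A `<=` bproj @` B.

Fact bquot1 q : bquot_small [set q].
Proof.
by exists [set repr q]; [exact: small1|move=> _ ->; exists (repr q); rewrite ?reprK].
Qed.
Fact bquotS A B : A `<=` B -> bquot_small B -> bquot_small A.
Proof. by move=> AB [C sC BC]; exists C => // x /AB /BC. Qed.
Fact bquotU A B : bquot_small A -> bquot_small B -> bquot_small (A `|` B).
Proof.
move=> [A' sA AA'] [B' sB BB']; exists (A' `|` B'); first exact: smallU.
by rewrite image_setU; exact: setUSS.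
Qed.
Fact bquotD A B : bquot_small A -> bquot_small B ->
  bquot_small [set x + y | x in A & y in B].
Proof.
move=> [A' sA AA'] [B' sB BB']; exists [set x + y | x in A' & y in B'].
  exact: smallD.
move=> _ [_ /AA' [x Ax <-] [_ /BB' [y By <-] <-]].
by exists (x + y); [exists x => //; exists y|rewrite linearD].
Qed.
Fact bquotZ c A : bquot_small A -> bquot_small [set c *: x | x in A].
Proof.
move=> [A' sA AA']; exists [set c *: x | x in A']; first exact: smallZ.
by move=> _ [_ /AA' [x Ax <-] <-]; exists (c *: x); [exists x|rewrite linearZ].
Qed.
Fact bquot_hull A : bquot_small A -> bquot_small (disked_hull A).
Proof.
move=> [A' sA AA']; exists (disked_hull A'); first exact: small_hull.
have [H0 cH xH] := disked_hullP A'.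
apply: disked_hull_min; last first.
  by move=> _ /AA' [x Ax <-]; exists x => //; exact: sub_disked_hull.
split=> [|c _ c1 [x Hx <-]|t _ _ t1 [x Hx <-] [y Hy <-]].
- by exists 0; rewrite ?linear0.
- by exists (c *: x); [exact: cH|rewrite linearZ].
- exists (t%:C *: x + (1 - t)%:C *: y); first exact: xH.
  by rewrite linearD !linearZ.
Qed.

HB.instance Definition _ := Lmodule_isBornological.Build R bquot
  bquot1 bquotS bquotU bquotD bquotZ bquot_hull.

End Quotient.

Section BoundedMaps.
Context {R : realType}.

Fact bhom_comp_subproof (U V W : bornType R) (f : bhom V W) (g : bhom U V) :
  is_bhom (f \o g).
Proof.
apply/asboolP; split=> [a x y|A sA]; first by rewrite /= !linearP.
by rewrite -image_comp; apply: bhom_bounded; apply: bhom_bounded.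
Qed.
Definition bhom_comp (U V W : bornType R) (f : bhom V W) (g : bhom U V) : bhom U W :=
  BHom (bhom_comp_subproof f g).

Fact bhom_id_subproof (V : bornType R) : is_bhom (@idfun V).
Proof. by apply/asboolP; split=> // A sA; rewrite image_id. Qed.
Definition bhom_id (V : bornType R) : bhom V V := BHom (bhom_id_subproof V).

Definition isomorphism (V W : bornType R) (f : bhom V W) :=
  exists2 g : bhom W V, cancel f g & cancel g f.

(* The completed bornological tensor product is only determined up to isomorphism
   by its universal property; (T, t) is any model of it, t v w being v (x) w. *)
Definition is_ctensor (V W T : bornType R) (t : V -> W -> T) :=
  [/\ complete T, bounded_bilinear t &
      forall X : bornType R, complete X ->
      forall b : V -> W -> X, bounded_bilinear b ->
      exists! f : bhom T X, forall v w, f (t v w) = b v w].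

End BoundedMaps.

HB.mixin Record Bornological_isAlgebra (R : realType) H of Bornological R H := {
  amul : H -> H -> H;
  amulA : associative amul;
  amul_bounded : bounded_bilinear amul
}.

#[short(type="bornAlgType")]
HB.structure Definition BornAlgebra (R : realType) :=
  {H of Bornological_isAlgebra R H & Bornological R H}.

Notation "x ** y" := (amul x y) (at level 40, left associativity).

Section Multipliers.
Context {R : realType}.
Variable H : bornAlgType R.

Fact amul_linearl (g : H) : linear (amul^~ g).
Proof. by have [_] := @amul_bounded R H. Qed.
Fact amul_linearr (f : H) : linear (amul f).
Proof. by have [] := @amul_bounded R H. Qed.
HB.instance Definition _ f := GRing.isLinear.Build R[i] H H *:%R (amul f) (amul_linearr f).

(* m = (L, R); f * m is R f *)
Definition is_multiplier (m : bhom H H * bhom H H) : bool := `[<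
  [/\ forall f g, m.1 (f ** g) = m.1 f ** g,
      forall f g, m.2 (f ** g) = f ** m.2 g &
      forall f g, f ** m.1 g = m.2 f ** g] >].

Record multiplier := Multiplier
  { mult_val : bhom H H * bhom H H; _ : is_multiplier mult_val }.
HB.instance Definition _ := [isSub for mult_val].
HB.instance Definition _ := [Choice of multiplier by <:].

Fact is_multiplier_submod : subsemimod_closed is_multiplier.
Proof.
have ml := amul_linearl; have mr := amul_linearr.
have m0l (g : H) : (0 : H) ** g = 0.
  by have := ml g (-1) 0 0; rewrite scaler0 addr0 scaleN1r addNr.
have m0r (g : H) : g ** (0 : H) = 0.
  by have := mr g (-1) 0 0; rewrite scaler0 addr0 scaleN1r addNr.
have mDl (f f' g : H) : (f + f') ** g = f ** g + f' ** g.
  by have := ml g 1 f f'; rewrite !scale1r.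
have mDr (f f' g : H) : g ** (f + f') = g ** f + g ** f'.
  by have := mr g 1 f f'; rewrite !scale1r.
have mZl (c : R[i]) (f g : H) : (c *: f) ** g = c *: (f ** g).
  by have := ml g c f 0; rewrite m0l !addr0.
have mZr (c : R[i]) (f g : H) : g ** (c *: f) = c *: (g ** f).
  by have := mr g c f 0; rewrite m0r !addr0.
split; first split.
- by apply/asboolP; split=> f g; rewrite /= ?m0l ?m0r.
- move=> m m' /asboolP[m1 m2 m3] /asboolP[m1' m2' m3']; apply/asboolP.
  split=> f g.
  + rewrite -[LHS]/(m.1 (f ** g) + m'.1 (f ** g)) m1 m1' -mDl //.
  + rewrite -[LHS]/(m.2 (f ** g) + m'.2 (f ** g)) m2 m2' -mDr //.
  + rewrite -[LHS]/(f ** (m.1 g + m'.1 g)) mDr m3 m3' -mDl //.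
- move=> c m /asboolP[m1 m2 m3]; apply/asboolP; split=> f g.
  + by rewrite -[LHS]/(c *: m.1 (f ** g)) m1 -mZl.
  + by rewrite -[LHS]/(c *: m.2 (f ** g)) m2 -mZr.
  + by rewrite -[LHS]/(f ** (c *: m.1 g)) mZr m3 -mZl.
Qed.

HB.instance Definition _ := GRing.isSubmodClosed.Build R[i]
  (bhom H H * bhom H H)%type is_multiplier is_multiplier_submod.
HB.instance Definition _ := [SubChoice_isSubLmodule of multiplier by <:].

Fact mult_val_linear : linear mult_val.
Proof. by []. Qed.
HB.instance Definition _ : Lmodule_isBornological R multiplier :=
  induced_bornology mult_val_linear.

Definition mulL (m : multiplier) : bhom H H := (mult_val m).1.
Definition mulR (m : multiplier) : bhom H H := (mult_val m).2.

Lemma multiplierP (m : multiplier) :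
  [/\ forall f g, mulL m (f ** g) = mulL m f ** g,
      forall f g, mulR m (f ** g) = f ** mulR m g &
      forall f g, f ** mulL m g = mulR m f ** g].
Proof. by case: m => m im; have /asboolP := im. Qed.

Lemma multiplier_eq (m m' : multiplier) :
  mulL m =1 mulL m' -> mulR m =1 mulR m' -> m = m'.
Proof.
move=> eL eR; apply: val_inj => /=; apply: injective_projections.
  by apply: val_inj; apply/funext.
by apply: val_inj; apply/funext.
Qed.

Fact mult_mul_subproof (m m' : multiplier) : is_multiplier
  (bhom_comp (mulL m) (mulL m'), bhom_comp (mulR m') (mulR m)).
Proof.
have [m1 m2 m3] := multiplierP m; have [m1' m2' m3'] := multiplierP m'.
by apply/asboolP; split=> f g /=; rewrite ?m1' ?m1 ?m2 ?m2' ?m3 ?m3'.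
Qed.
Definition mult_mul m m' : multiplier := Multiplier (mult_mul_subproof m m').

Fact mult_mulA : associative mult_mul.
Proof. by move=> m m' m''; apply: multiplier_eq. Qed.

Fact mult_mul_bounded : bounded_bilinear mult_mul.
Proof.
split=> [m|m|A B [sA1 sA2] [sB1 sB2]].
- move=> a m1 m2; apply: multiplier_eq => f //=.
  by rewrite -[LHS]/(mulL m (a *: mulL m1 f + mulL m2 f)) linearP.
- move=> a m1 m2; apply: multiplier_eq => f //=.
  by rewrite -[LHS]/(mulR m (a *: mulR m1 f + mulR m2 f)) linearP.
split=> S sS.
- have : small [set f x | f in [set mulL m | m in B] & x in S].
    by apply: smallS (sB1 S sS) => _ [_ [m Bm <-] [x Sx <-]];
      exists (mulL m); [exists (mult_val m) => //; exists m|exists x].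
  move=> sBS; apply: smallS (sA1 _ sBS).
  move=> _ [_ [_ [_ [m Am [m' Bm' <-]] <-] <-] [x Sx <-]].
  exists (mulL m); first by exists (mult_val m) => //; exists m.
  exists (mulL m' x) => //; exists (mulL m'); first by exists m'.
  by exists x.
- have : small [set f x | f in [set mulR m | m in A] & x in S].
    by apply: smallS (sA2 S sS) => _ [_ [m Am <-] [x Sx <-]];
      exists (mulR m); [exists (mult_val m) => //; exists m|exists x].
  move=> sAS; apply: smallS (sB2 _ sAS).
  move=> _ [_ [_ [_ [m Am [m' Bm' <-]] <-] <-] [x Sx <-]].
  exists (mulR m'); first by exists (mult_val m') => //; exists m'.
  exists (mulR m x) => //; exists (mulR m); first by exists m.
  by exists x.
Qed.

HB.instance Definition _ := Bornological_isAlgebra.Build R multiplier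
  mult_mulA mult_mul_bounded.

Fact mult_one_subproof : is_multiplier (bhom_id H, bhom_id H).
Proof. by apply/asboolP. Qed.
Definition mult_one : multiplier := Multiplier mult_one_subproof.

Fact amull_subproof (h : H) : is_bhom (amul h).
Proof.
have [_ _ b] := @amul_bounded R H.
apply/asboolP; split=> [|A sA]; first exact: amul_linearr.
by apply: smallS (b _ _ (small1 h) sA) => _ [x Ax <-]; exists h => //; exists x.
Qed.
Fact amulr_subproof (h : H) : is_bhom (amul^~ h).
Proof.
have [_ _ b] := @amul_bounded R H.
apply/asboolP; split=> [|A sA]; first exact: amul_linearl.
by apply: smallS (b _ _ sA (small1 h)) => _ [x Ax <-]; exists x => //; exists h.
Qed.
Fact mult_of_subproof (h : H) :
  is_multiplier (BHom (amull_subproof h), BHom (amulr_subproof h)).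
Proof. by apply/asboolP; split=> f g /=; rewrite amulA. Qed.
Definition mult_of_fun (h : H) : multiplier := Multiplier (mult_of_subproof h).

Fact mult_of_is_bhom : is_bhom mult_of_fun.
Proof.
have [_ _ b] := @amul_bounded R H.
apply/asboolP; split=> [a x y|A sA].
  apply: multiplier_eq => f; first exact: (amul_linearl f a x y).
  exact: (amul_linearr f a x y).
split=> S sS.
- by apply: smallS (b _ _ sA sS) => _ [_ [_ [_ [h Ah <-] <-] <-] [x Sx <-]];
    exists h => //; exists x.
- by apply: smallS (b _ _ sS sA) => _ [_ [_ [_ [h Ah <-] <-] <-] [x Sx <-]];
    exists x => //; exists h.
Qed.
Definition mult_of : bhom H multiplier := BHom mult_of_is_bhom.

End Multipliers.

Arguments mulL {R H} m.
Arguments mulR {R H} m.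
Arguments mult_of {R H}.
Arguments mult_one {R H}.

Section Modules.
Context {R : realType}.
Variable H : bornAlgType R.

Definition left_module (V : bornType R) (act : H -> V -> V) :=
  bounded_bilinear act /\ forall f g v, act (f ** g) v = act f (act g v).

Definition right_module (M : bornType R) (act : M -> H -> M) :=
  bounded_bilinear act /\ forall m f g, act m (f ** g) = act (act m f) g.

(* bquot (balanced t ra la) is the tensor product of M and V over H *)
Definition balanced (M V T : bornType R) (t : M -> V -> T)
    (ra : M -> H -> M) (la : H -> V -> V) : set T :=
  [set z | exists m h v, z = t (ra m h) v - t m (la h v)].

Definition essential_left (V : bornType R) (act : H -> V -> V) :=
  left_module act /\
  exists (T : bornType R) (t : H -> V -> T)
         (f : bhom (bquot (balanced t amul act)) V),
    [/\ is_ctensor t, forall h v, f (bproj _ (t h v)) = act h v & isomorphism f].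

Definition essential_right (M : bornType R) (act : M -> H -> M) :=
  right_module act /\
  exists (T : bornType R) (t : M -> H -> T)
         (f : bhom (bquot (balanced t act amul)) M),
    [/\ is_ctensor t, forall m h, f (bproj _ (t m h)) = act m h & isomorphism f].

Definition essential_algebra :=
  (exists h : H, h != 0) /\ essential_left (@amul R H).

Definition functional (w : H -> R[i]^o) := linear w /\ bounded_map w.

Definition faithful (w : H -> R[i]^o) :=
  (forall f, (forall g, w (f ** g) = 0) -> f = 0) /\
  (forall g, (forall f, w (f ** g) = 0) -> g = 0).

End Modules.

Section Homomorphisms.
Context {R : realType}.

Definition algebra_hom (A B : bornAlgType R) (f : bhom A B) :=
  forall a b, f (a ** b) = f a ** f b.

Definition essential_hom (A B : bornAlgType R) (f : bhom A (multiplier B)) :=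
  [/\ algebra_hom f, essential_left (fun a b => mulL (f a) b) &
      essential_right (fun b a => mulR (f a) b)].

Definition unital_extension (A B : bornAlgType R) (f : bhom A (multiplier B))
    (F : bhom (multiplier A) (multiplier B)) :=
  [/\ algebra_hom F, F mult_one = mult_one & forall a, F (mult_of a) = f a].

Definition tensor_algebra (A B AB : bornAlgType R) (t : A -> B -> AB) :=
  is_ctensor t /\ forall a b c d, t a b ** t c d = t (a ** c) (b ** d).

(* x is the multiplier m (x) n *)
Definition tensor_mult (A B AB : bornAlgType R) (t : A -> B -> AB)
    (m : multiplier A) (n : multiplier B) (x : multiplier AB) :=
  (forall a b, mulL x (t a b) = t (mulL m a) (mulL n b)) /\
  (forall a b, mulR x (t a b) = t (mulR m a) (mulR n b)).

(* F is the tensor product of f and g *)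
Definition tensor_hom (A B AB A' B' AB' : bornAlgType R)
    (t : A -> B -> AB) (t' : A' -> B' -> AB')
    (f : bhom A (multiplier A')) (g : bhom B (multiplier B'))
    (F : bhom AB (multiplier AB')) :=
  forall a b, tensor_mult t' (f a) (g b) (F (t a b)).

End Homomorphisms.

Section QuantumGroups.
Context {R : realType}.
Variables (H H2 : bornAlgType R) (t : H -> H -> H2).

(* Di and iD are D (x) id and id (x) D; DI and ID extend them to M(H (x) H) *)
Definition coassociative (D : bhom H (multiplier H2)) :=
  exists (H3 : bornAlgType R) (tl : H2 -> H -> H3) (tr : H -> H2 -> H3)
         (Di iD : bhom H2 (multiplier H3))
         (DI ID : bhom (multiplier H2) (multiplier H3)),
  [/\ tensor_algebra tl, tensor_algebra tr &
      forall a b c, tl (t a b) c = tr a (t b c)] /\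
  [/\ tensor_hom t tl D mult_of Di, unital_extension Di DI,
      tensor_hom t tr mult_of D iD, unital_extension iD ID &
      forall f, DI (D f) = ID (D f)].

Definition comultiplication (D : bhom H (multiplier H2)) :=
  essential_hom D /\ coassociative D.

(* G is the Galois map, corestricted to H (x) H *)
Definition is_gamma_l (D : bhom H (multiplier H2)) (G : bhom H2 H2) :=
  forall f g, exists2 m, tensor_mult t (mult_of g) mult_one m &
    mult_of (G (t f g)) = D f ** m.

Definition is_gamma_r (D : bhom H (multiplier H2)) (G : bhom H2 H2) :=
  forall f g, exists2 m, tensor_mult t mult_one (mult_of g) m &
    mult_of (G (t f g)) = D f ** m.

Definition is_rho_l (D : bhom H (multiplier H2)) (G : bhom H2 H2) :=
  forall f g, exists2 m, tensor_mult t (mult_of f) mult_one m &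
    mult_of (G (t f g)) = m ** D g.

Definition is_rho_r (D : bhom H (multiplier H2)) (G : bhom H2 H2) :=
  forall f g, exists2 m, tensor_mult t mult_one (mult_of f) m &
    mult_of (G (t f g)) = m ** D g.

(* m is the multiplier (id (x) w)D(f), where gl = gamma_l and rl = rho_l for D *)
Definition is_slice (gl rl : bhom H2 H2) (w : H -> R[i]^o) (f : H) (m : multiplier H) :=
  exists2 s : bhom H2 H, forall a b, s (t a b) = w b *: a &
  forall g, mulL m g = s (gl (t f g)) /\ mulR m g = s (rl (t g f)).

Definition left_invariant (gl rl : bhom H2 H2) (w : H -> R[i]^o) :=
  forall f, is_slice gl rl w f (w f *: mult_one).

Definition bornological_quantum_group
    (D : bhom H (multiplier H2)) (phi : H -> R[i]^o) :=
  [/\ complete H, essential_algebra H, approximation_property H,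
      tensor_algebra t & comultiplication D] /\
  exists gl gr rl rr : bhom H2 H2,
    [/\ is_gamma_l D gl, is_gamma_r D gr, is_rho_l D rl & is_rho_r D rr] /\
    [/\ isomorphism gl, isomorphism gr, isomorphism rl & isomorphism rr] /\
    [/\ functional phi, faithful phi & left_invariant gl rl phi].

End QuantumGroups.

Local Notation Re := complex.Re.
Local Notation Im := complex.Im.

Section PartialDerivatives.
Context {R : realType}.

Definition pderive n (i : 'I_n) (f : 'rV[R]_n -> R[i]) : 'rV[R]_n -> R[i] := fun x =>
  'D_(delta_mx 0 i) (fun y => Re (f y)) x +i* 'D_(delta_mx 0 i) (fun y => Im (f y)) x.

(* The word w = i1 .. il stands for the multiindex in which j has as many
   occurrences as in w; partial derivatives of smooth functions commute, so the
   derivatives along words are the usual derivatives along multiindices. *)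
Definition pderives n (w : seq 'I_n) (f : 'rV[R]_n -> R[i]) := foldr (@pderive n) f w.

Definition partially_C1 n (f : 'rV[R]_n -> R[i]) :=
  [/\ continuous (fun y => Re (f y)), continuous (fun y => Im (f y)),
      forall i x, derivable (fun y => Re (f y)) x (delta_mx 0 i) &
      forall i x, derivable (fun y => Im (f y)) x (delta_mx 0 i)].

Definition smooth n (f : 'rV[R]_n -> R[i]) := forall w, partially_C1 (pderives w f).

Definition enorm n (x : 'rV[R]_n) : R := Num.sqrt (\sum_i x 0 i ^+ 2).

Definition seminorm n (k : nat) (w : seq 'I_n) (f : 'rV[R]_n -> R[i]) : \bar R :=
  ereal_sup (range (fun x => (normc (pderives w f x) * (1 + enorm x) ^+ k)%:E)).

Lemma normc_ge0 (c : R[i]) : 0 <= normc c.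
Proof. by case: c => ? ? /=; rewrite sqrtr_ge0. Qed.

Lemma enorm_ge0 n (x : 'rV[R]_n) : 0 <= enorm x.
Proof. exact: sqrtr_ge0. Qed.

Lemma weight_ge0 n k (x : 'rV[R]_n) : 0 <= (1 + enorm x) ^+ k.
Proof. by rewrite exprn_ge0// addr_ge0// enorm_ge0. Qed.

Lemma seminorm_leP n k w (f : 'rV[R]_n -> R[i]) (M : R) :
  (seminorm k w f <= M%:E)%E <->
  forall x, normc (pderives w f x) * (1 + enorm x) ^+ k <= M.
Proof.
split=> [fM x|fM].
  by rewrite -lee_fin; apply: le_trans fM; apply: ereal_sup_ubound; exists x.
by apply: ge_ereal_sup => _ [x _ <-]; rewrite lee_fin.
Qed.

Lemma seminorm_ltP n k w (f : 'rV[R]_n -> R[i]) :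
  (seminorm k w f < +oo)%E <-> exists M : R, (seminorm k w f <= M%:E)%E.
Proof.
split=> [|[M fM]]; last by apply: le_lt_trans fM _; rewrite ltry.
case E : (seminorm k w f) => [r| |]// _; first by exists r.
by exists 0; rewrite leNye.
Qed.

Lemma ReM (a b : R[i]) : Re (a * b) = Re a * Re b - Im a * Im b.
Proof. by case: a; case: b. Qed.
Lemma ImM (a b : R[i]) : Im (a * b) = Re a * Im b + Im a * Re b.
Proof. by case: a; case: b. Qed.
Lemma ReD (a b : R[i]) : Re (a + b) = Re a + Re b.
Proof. by case: a; case: b. Qed.
Lemma ImD (a b : R[i]) : Im (a + b) = Im a + Im b.
Proof. by case: a; case: b. Qed.

Section Rules.
Variable n : nat.
Implicit Types (f g : 'rV[R]_n -> R[i]) (w : seq 'I_n).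

Let ReMf f g : (fun y => Re (f y * g y)) =
  (fun y => Re (f y)) * (fun y => Re (g y)) - (fun y => Im (f y)) * (fun y => Im (g y)).
Proof. by apply/funext => y; rewrite ReM. Qed.
Let ImMf f g : (fun y => Im (f y * g y)) =
  (fun y => Re (f y)) * (fun y => Im (g y)) + (fun y => Im (f y)) * (fun y => Re (g y)).
Proof. by apply/funext => y; rewrite ImM. Qed.
Let ReDf f g : (fun y => Re (f y + g y)) = (fun y => Re (f y)) + (fun y => Re (g y)).
Proof. by apply/funext => y; rewrite ReD. Qed.
Let ImDf f g : (fun y => Im (f y + g y)) = (fun y => Im (f y)) + (fun y => Im (g y)).
Proof. by apply/funext => y; rewrite ImD. Qed.

Lemma partially_C1_cst (c : R[i]) : partially_C1 (fun _ : 'rV[R]_n => c).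
Proof.
by split=> *; [exact: cst_continuous|exact: cst_continuous
  |exact: derivable_cst|exact: derivable_cst].
Qed.

Lemma partially_C1D f g : partially_C1 f -> partially_C1 g ->
  partially_C1 (fun x => f x + g x).
Proof.
move=> [f1 f2 f3 f4] [g1 g2 g3 g4]; split.
- by rewrite ReDf => x; apply: continuousD; [exact: f1|exact: g1].
- by rewrite ImDf => x; apply: continuousD; [exact: f2|exact: g2].
- by move=> i x; rewrite ReDf; apply: derivableD.
- by move=> i x; rewrite ImDf; apply: derivableD.
Qed.

Lemma partially_C1M f g : partially_C1 f -> partially_C1 g ->
  partially_C1 (fun x => f x * g x).
Proof.
move=> [f1 f2 f3 f4] [g1 g2 g3 g4]; split.
- rewrite ReMf => x; apply: continuousB; apply: continuousM;
    by [exact: f1|exact: g1|exact: f2|exact: g2].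
- rewrite ImMf => x; apply: continuousD; apply: continuousM;
    by [exact: f1|exact: g1|exact: f2|exact: g2].
- by move=> i x; rewrite ReMf; apply: derivableB; apply: derivableM.
- by move=> i x; rewrite ImMf; apply: derivableD; apply: derivableM.
Qed.

Lemma pderive_cst i (c : R[i]) : pderive i (fun _ : 'rV[R]_n => c) = fun=> 0.
Proof.
apply/funext => x; rewrite /pderive.
rewrite -[(fun=> Re c)]/(cst (Re c)) -[(fun=> Im c)]/(cst (Im c)).
by rewrite !derive_val.
Qed.

Lemma pderives0 w : pderives w (fun _ : 'rV[R]_n => 0) = fun=> 0.
Proof. by elim: w => //= i w ->; rewrite pderive_cst. Qed.

Lemma pderiveD i f g : partially_C1 f -> partially_C1 g ->
  pderive i (fun x => f x + g x) = fun x => pderive i f x + pderive i g x.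
Proof.
move=> [f1 f2 f3 f4] [g1 g2 g3 g4]; apply/funext => x.
by rewrite /pderive ReDf ImDf !deriveD.
Qed.

Lemma pderiveM i f g : partially_C1 f -> partially_C1 g ->
  pderive i (fun x => f x * g x) = fun x => pderive i f x * g x + f x * pderive i g x.
Proof.
move=> [f1 f2 f3 f4] [g1 g2 g3 g4]; apply/funext => x.
rewrite /pderive ReMf ImMf.
rewrite (deriveB (derivableM (f3 i x) (g3 i x)) (derivableM (f4 i x) (g4 i x))).
rewrite (deriveD (derivableM (f3 i x) (g4 i x)) (derivableM (f4 i x) (g3 i x))).
rewrite (deriveM (f3 i x) (g3 i x)) (deriveM (f4 i x) (g4 i x)).
rewrite (deriveM (f3 i x) (g4 i x)) (deriveM (f4 i x) (g3 i x)).
move: ('D__ _ _) ('D__ _ _) ('D__ _ _) ('D__ _ _) => a b c d.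
apply/eqP; rewrite eq_complex !ReD !ImD !ReM !ImM /=.
have E1 (p q r s t u v w : R) :
  p * w + r * v - (q * u + s * t) = v * r - t * s + (p * w - q * u) by ring.
have E2 (p q r s t u v w : R) :
  p * u + s * v + (q * w + r * t) = v * s + t * r + (p * u + q * w) by ring.
by apply/andP; split; apply/eqP; [exact: E1|exact: E2].
Qed.

Lemma partially_C1_sum (I : Type) (r : seq I) (F : I -> 'rV[R]_n -> R[i]) :
  (forall i, partially_C1 (F i)) -> partially_C1 (fun x => \sum_(i <- r) F i x).
Proof.
move=> FC; elim: r => [|i r IH].
  rewrite (_ : (fun x => _) = fun=> 0); first exact: partially_C1_cst.
  by apply/funext => x; rewrite big_nil.
rewrite (_ : (fun x => _) = fun x => F i x + \sum_(j <- r) F j x).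
  exact: (partially_C1D (FC i) IH).
by apply/funext => x; rewrite big_cons.
Qed.

Lemma pderive_sum (I : Type) (r : seq I) (F : I -> 'rV[R]_n -> R[i]) j :
  (forall i, partially_C1 (F i)) ->
  pderive j (fun x => \sum_(i <- r) F i x) = fun x => \sum_(i <- r) pderive j (F i) x.
Proof.
move=> FC; elim: r => [|i r IH].
  rewrite (_ : (fun x => _) = fun=> 0); last by apply/funext => x; rewrite big_nil.
  by rewrite pderive_cst; apply/funext => x; rewrite big_nil.
rewrite (_ : (fun x => _) = fun x => F i x + \sum_(j <- r) F j x); last first.
  by apply/funext => x; rewrite big_cons.
rewrite pderiveD// ?IH; last exact: partially_C1_sum.
by apply/funext => x; rewrite big_cons.
Qed.

Fixpoint splits w : seq (seq 'I_n * seq 'I_n) := if w is i :: w' then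
  [seq (i :: p.1, p.2) | p <- splits w'] ++ [seq (p.1, i :: p.2) | p <- splits w']
  else [:: ([::], [::])].

Lemma pderivesM w f g : smooth f -> smooth g -> pderives w (fun x => f x * g x) =
  fun x => \sum_(p <- splits w) pderives p.1 f x * pderives p.2 g x.
Proof.
move=> sf sg; elim: w => [|i w /= ->] /=.
  by apply/funext => x; rewrite big_seq1.
rewrite pderive_sum; last by move=> p; apply: partially_C1M; [exact: sf|exact: sg].
apply/funext => x; rewrite big_cat !big_map /= -big_split /=; apply: eq_bigr => p _.
by rewrite pderiveM; [|exact: sf|exact: sg].
Qed.

Lemma pderivesD w f g : smooth f -> smooth g -> pderives w (fun x => f x + g x) =
  fun x => pderives w f x + pderives w g x.
Proof.
move=> sf sg; elim: w => [|i w /= ->] //=.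
by rewrite pderiveD; [|exact: sf|exact: sg].
Qed.

Lemma smooth_cst (c : R[i]) : smooth (fun _ : 'rV[R]_n => c).
Proof.
move=> w; case: w => [|i w]; first exact: partially_C1_cst.
suff -> : pderives (i :: w) (fun _ : 'rV[R]_n => c) = fun=> 0.
  exact: partially_C1_cst.
elim: w i => [|j w IH] i /=; first exact: pderive_cst.
by rewrite [pderive j _]IH pderive_cst.
Qed.

Lemma smoothD f g : smooth f -> smooth g -> smooth (fun x => f x + g x).
Proof.
by move=> sf sg w; rewrite pderivesD//; apply: partially_C1D; [exact: sf|exact: sg].
Qed.

Lemma smoothM f g : smooth f -> smooth g -> smooth (fun x => f x * g x).
Proof.
move=> sf sg w; rewrite pderivesM//; apply: partially_C1_sum => p.
by apply: partially_C1M; [exact: sf|exact: sg].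
Qed.

Lemma pderivesZ w (c : R[i]) f : smooth f ->
  pderives w (fun x => c * f x) = fun x => c * pderives w f x.
Proof.
move=> sf; elim: w => [|i w /= ->] //=.
rewrite pderiveM; [|exact: partially_C1_cst|exact: sf].
by rewrite pderive_cst; apply/funext => x; rewrite mul0r add0r.
Qed.

Lemma normc_sum (I : Type) (r : seq I) (F : I -> R[i]) :
  normc (\sum_(i <- r) F i) <= \sum_(i <- r) normc (F i).
Proof.
elim: r => [|i r IH]; first by rewrite !big_nil normc0.
by rewrite !big_cons (le_trans (le_normcD _ _))// lerD2l.
Qed.

Lemma Leibniz_bound w f g x (A B : R) (a b : seq 'I_n -> R) :
  smooth f -> smooth g -> 0 <= A -> 0 <= B ->
  (forall u, normc (pderives u f x) * A <= a u) ->
  (forall v, normc (pderives v g x) * B <= b v) ->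
  normc (pderives w (fun x => f x * g x) x) * (A * B) <=
  \sum_(p <- splits w) a p.1 * b p.2.
Proof.
move=> sf sg A0 B0 fa gb; rewrite pderivesM//.
apply: (@le_trans _ _ (\sum_(p <- splits w)
    normc (pderives p.1 f x * pderives p.2 g x) * (A * B))).
  by rewrite -mulr_suml ler_wpM2r ?mulr_ge0// normc_sum.
apply: ler_sum => p _; rewrite normcM mulrACA ler_pM//.
  by rewrite mulr_ge0// normc_ge0.
by rewrite mulr_ge0// normc_ge0.
Qed.

End Rules.

(* linear substitutions mapping each basis vector to a basis vector or to 0 *)
Section Substitution.
Variables (p q : nat) (L : 'rV[R]_p -> 'rV[R]_q) (s : 'I_p -> option 'I_q).
Hypothesis lL : linear L.
Hypothesis cL : continuous L.
Hypothesis LE : forall i, L (delta_mx 0 i) = if s i is Some j then delta_mx 0 j else 0.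

Let quotient_subst (g : 'rV[R]_q -> R) x v :
  (fun h : R => h^-1 *: (((fun y => g (L y)) \o shift x) (h *: v) - g (L x))) =
  (fun h : R => h^-1 *: ((g \o shift (L x)) (h *: L v) - g (L x))).
Proof. by apply/funext => h; rewrite /= lL. Qed.

Lemma derive_subst (g : 'rV[R]_q -> R) x v :
  'D_v (fun y => g (L y)) x = 'D_(L v) g (L x).
Proof. by rewrite /derive quotient_subst. Qed.

Lemma derivable_subst (g : 'rV[R]_q -> R) x v :
  derivable g (L x) (L v) -> derivable (fun y => g (L y)) x v.
Proof. by rewrite /derivable quotient_subst. Qed.

Fixpoint subst_word (w : seq 'I_p) : option (seq 'I_q) :=
  if w is i :: w' then
    if s i is Some j then omap (cons j) (subst_word w') else None
  else Some [::].

Lemma pderives_subst w f : pderives w (fun y => f (L y)) =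
  if subst_word w is Some w' then (fun y => pderives w' f (L y)) else fun=> 0.
Proof.
elim: w => [|i w /= ->] //=.
case: (subst_word w) => [w'|]; last by rewrite pderive_cst; case: (s i).
apply/funext => x; rewrite /pderive.
rewrite (derive_subst (fun y => Re (pderives w' f y))).
rewrite (derive_subst (fun y => Im (pderives w' f y))) LE.
case: (s i) => [j|] //=.
by rewrite (@derive_val _ _ _ _ _ _ _ (is_derive0 _ _))
  (@derive_val _ _ _ _ _ _ _ (is_derive0 _ _)).
Qed.

Lemma smooth_subst f : smooth f -> smooth (fun y => f (L y)).
Proof.
move=> sf w; rewrite pderives_subst.
case: (subst_word w) => [w'|]; last exact: partially_C1_cst.
have [f1 f2 f3 f4] := sf w'; split=> [x|x|i x|i x].
- by apply: (@continuous_comp _ _ _ L (fun y => Re (pderives w' f y)));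
    [exact: cL|exact: f1].
- by apply: (@continuous_comp _ _ _ L (fun y => Im (pderives w' f y)));
    [exact: cL|exact: f2].
- apply: (derivable_subst (g := fun y => Re (pderives w' f y))); rewrite LE.
  by case: (s i) => [j|]; [exact: f3|exact: derivable0].
- apply: (derivable_subst (g := fun y => Im (pderives w' f y))); rewrite LE.
  by case: (s i) => [j|]; [exact: f4|exact: derivable0].
Qed.

Definition subst_bound (a : seq 'I_q -> R) (u : seq 'I_p) : R :=
  if subst_word u is Some u' then a u' else 0.

Lemma subst_boundP f (a : seq 'I_q -> R) y (A : R) :
  (forall w, normc (pderives w f (L y)) * A <= a w) ->
  forall w, normc (pderives w (fun y => f (L y)) y) * A <= subst_bound a w.
Proof.
move=> fa w; rewrite /subst_bound pderives_subst.
by case: (subst_word w) => [w'|]; rewrite ?normc0 ?mul0r.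
Qed.

End Substitution.

End PartialDerivatives.

Section Schwartz.
Context {R : realType} {n : nat}.

Definition is_schwartz (f : 'rV[R]_n -> R[i]^o) : bool :=
  `[< smooth f /\ forall k w, (seminorm k w f < +oo)%E >].

Record schwartz := Schwartz
  { schwartz_fun :> 'rV[R]_n -> R[i]^o; _ : is_schwartz schwartz_fun }.
HB.instance Definition _ := [isSub for schwartz_fun].
HB.instance Definition _ := [Choice of schwartz by <:].

Lemma schwartz_smooth (f : schwartz) : smooth f.
Proof. by case: f => f sf; have /asboolP[] := sf. Qed.

Definition schwartz_small (A : set schwartz) := forall k w,
  exists M : R, forall f, A f -> (seminorm k w f <= M%:E)%E.

Fact is_schwartz_submod : subsemimod_closed is_schwartz.
Proof.
split; first split.
- apply/asboolP; split; first exact: smooth_cst.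
  move=> k w; apply/seminorm_ltP; exists 0; apply/seminorm_leP => x.
  by rewrite pderives0 normc0 mul0r.
- move=> f g /asboolP[sf bf] /asboolP[sg bg]; apply/asboolP; split.
    exact: smoothD.
  move=> k w; have /seminorm_ltP[M /seminorm_leP fM] := bf k w.
  have /seminorm_ltP[N /seminorm_leP gN] := bg k w.
  apply/seminorm_ltP; exists (M + N); apply/seminorm_leP => x.
  rewrite pderivesD// (le_trans _ (lerD (fM x) (gN x)))// -mulrDl.
  by rewrite ler_wpM2r ?weight_ge0// le_normcD.
- move=> c f /asboolP[sf bf]; apply/asboolP; split.
    exact: (smoothM (smooth_cst c) sf).
  move=> k w; have /seminorm_ltP[M /seminorm_leP fM] := bf k w.
  apply/seminorm_ltP; exists (normc c * M); apply/seminorm_leP => x.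
  by rewrite pderivesZ// normcM -mulrA ler_wpM2l ?normc_ge0.
Qed.

HB.instance Definition _ := GRing.isSubmodClosed.Build R[i]
  ('rV[R]_n -> R[i]^o) is_schwartz is_schwartz_submod.
HB.instance Definition _ := [SubChoice_isSubLmodule of schwartz by <:].

Lemma schwartz_eq (f g : schwartz) : f =1 g -> f = g.
Proof. by move=> fg; apply: val_inj; apply/funext. Qed.

Lemma schwartz_smallP (A : set schwartz) : schwartz_small A <->
  exists a : nat -> seq 'I_n -> R, forall k w f x, A f ->
    normc (pderives w f x) * (1 + enorm x) ^+ k <= a k w.
Proof.
split=> [sA|[a Aa] k w]; last first.
  by exists (a k w) => f Af; apply/seminorm_leP => x; exact: Aa.
have M k w := cid (sA k w).
exists (fun k w => sval (M k w)) => k w f x Af.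
by case: (M k w) => m /= /(_ _ Af)/seminorm_leP.
Qed.

Fact schwartz_small1 f : schwartz_small [set f].
Proof.
case: f => f sf k w; have /asboolP[_ /(_ k w)/seminorm_ltP[M fM]] := sf.
by exists M => _ ->.
Qed.
Fact schwartz_smallS A B : A `<=` B -> schwartz_small B -> schwartz_small A.
Proof. by move=> AB sB k w; have [M BM] := sB k w; exists M => f /AB /BM. Qed.
Fact schwartz_smallU A B : schwartz_small A -> schwartz_small B ->
  schwartz_small (A `|` B).
Proof.
move=> sA sB k w; have [M AM] := sA k w; have [N BN] := sB k w.
exists (Num.max M N) => f [/AM|/BN] fM; apply: le_trans fM _;
  by rewrite lee_fin le_max lexx ?orbT.
Qed.
Fact schwartz_smallD A B : schwartz_small A -> schwartz_small B ->
  schwartz_small [set f + g | f in A & g in B].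
Proof.
move=> sA sB k w; have [M AM] := sA k w; have [N BN] := sB k w.
exists (M + N) => _ [f /AM/seminorm_leP fM [g /BN/seminorm_leP gN <-]].
apply/seminorm_leP => x; have sf := schwartz_smooth f; have sg := schwartz_smooth g.
rewrite (pderivesD w sf sg) (le_trans _ (lerD (fM x) (gN x)))// -mulrDl.
by rewrite ler_wpM2r ?weight_ge0// le_normcD.
Qed.
Fact schwartz_smallZ (c : R[i]) A : schwartz_small A ->
  schwartz_small [set c *: f | f in A].
Proof.
move=> sA k w; have [M AM] := sA k w.
exists (normc c * M) => _ [f /AM/seminorm_leP fM <-]; apply/seminorm_leP => x.
rewrite pderivesZ; last exact: schwartz_smooth.
by rewrite normcM -mulrA ler_wpM2l ?normc_ge0.
Qed.
Fact schwartz_small_hull A : schwartz_small A -> schwartz_small (disked_hull A).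
Proof.
have ncR (t : R) : 0 <= t -> normc t%:C = t.
  by move=> t0; rewrite /normc /= expr0n addr0 sqrtr_sqr ger0_norm.
move=> sA k w; have [M AM] := sA k w; exists (Num.max 0 M).
apply: disked_hull_min; last first.
  by move=> f /AM fM; apply: le_trans fM _; rewrite lee_fin le_max lexx orbT.
split=> [|c f c1 /seminorm_leP fM|t f g /andP[t0 t1] /seminorm_leP fM /seminorm_leP gM];
    apply/seminorm_leP => x.
- by rewrite pderives0 normc0 mul0r le_max lexx.
- rewrite pderivesZ; last exact: schwartz_smooth.
  rewrite normcM -mulrA (le_trans _ (fM x))// ler_piMl//.
  by rewrite mulr_ge0 ?normc_ge0 ?weight_ge0.
- have st : smooth (fun x => t%:C * f x).
    exact: (smoothM (smooth_cst _) (schwartz_smooth f)).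
  have st' : smooth (fun x => (1 - t)%:C * g x).
    exact: (smoothM (smooth_cst _) (schwartz_smooth g)).
  rewrite (pderivesD w st st') (pderivesZ w _ (schwartz_smooth f)).
  rewrite (pderivesZ w _ (schwartz_smooth g)).
  have -> : Num.max 0 M = t * Num.max 0 M + (1 - t) * Num.max 0 M.
    by rewrite -mulrDl addrCA subrr addr0 mul1r.
  apply: le_trans (ler_wpM2r (weight_ge0 k x) (le_normcD _ _)) _.
  rewrite mulrDl !normcM !ncR ?subr_ge0// -!mulrA.
  by rewrite lerD// ler_wpM2l// subr_ge0.
Qed.

HB.instance Definition _ := Lmodule_isBornological.Build R schwartz
  schwartz_small1 schwartz_smallS schwartz_smallU schwartz_smallD schwartz_smallZ
  schwartz_small_hull.

End Schwartz.

Arguments schwartz R n : clear implicits.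

Section SchwartzAlgebra.
Context {R : realType}.

Lemma schwartz_bound n (f : schwartz R n) k w : exists M : R, forall x,
  normc (pderives w f x) * (1 + enorm x) ^+ k <= M.
Proof.
have [M fM] := schwartz_small1 f k w.
by exists M; apply/seminorm_leP; apply: fM.
Qed.

Lemma mul_bound n (g : 'rV[R]_n -> R[i]) (b : seq 'I_n -> R) (f : schwartz R n)
    (a : nat -> seq 'I_n -> R) :
  smooth g -> (forall v x, normc (pderives v g x) <= b v) ->
  (forall k w x, normc (pderives w f x) * (1 + enorm x) ^+ k <= a k w) ->
  forall k w x, normc (pderives w (fun x => g x * f x) x) * (1 + enorm x) ^+ k <=
    \sum_(p <- splits w) b p.1 * a k p.2.
Proof.
move=> sg gb fa k w x; rewrite -[X in _ * X]mul1r.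
apply: (Leibniz_bound w sg (schwartz_smooth f) ler01 (weight_ge0 k x)) => u.
  by rewrite mulr1.
exact: fa.
Qed.

Lemma schwartz_sup n (f : schwartz R n) : exists a : nat -> seq 'I_n -> R,
  forall k w x, normc (pderives w f x) * (1 + enorm x) ^+ k <= a k w.
Proof.
have /schwartz_smallP[a fa] := schwartz_small1 f.
by exists a => k w x; exact: fa.
Qed.

Lemma is_schwartz_mul n (g : 'rV[R]_n -> R[i]) (f : schwartz R n) :
  smooth g -> (forall v, exists b, forall x, normc (pderives v g x) <= b) ->
  is_schwartz (fun x => g x * f x).
Proof.
move=> sg gb; have [a fa] := schwartz_sup f.
have b v := cid (gb v).
apply/asboolP; split; first exact: (smoothM sg (schwartz_smooth f)).
move=> k w; apply/seminorm_ltP; exists (\sum_(p <- splits w) sval (b p.1) * a k p.2).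
apply/seminorm_leP => x.
apply: (mul_bound (b := fun v => sval (b v)) sg _ fa) => v y.
by case: (b v).
Qed.

Section Product.
Variable n : nat.
Implicit Types f g : schwartz R n.

Fact schwartz_mul_subproof f g : is_schwartz (fun x => f x * g x).
Proof.
apply: is_schwartz_mul; first exact: schwartz_smooth.
move=> v; have [M fM] := schwartz_bound f 0 v; exists M => x.
by have := fM x; rewrite expr0 mulr1.
Qed.
Definition schwartz_mul f g : schwartz R n := Schwartz (schwartz_mul_subproof f g).

Fact schwartz_mulA : associative schwartz_mul.
Proof. by move=> f g h; apply: schwartz_eq => x /=; rewrite mulrA. Qed.

Fact schwartz_mul_bounded : bounded_bilinear schwartz_mul.
Proof.
split=> [f|g|A B].
- move=> a g h; apply: schwartz_eq => x.
  rewrite -[LHS]/(f x * (a * g x + h x)) -[RHS]/(a * (f x * g x) + f x * h x); ring.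
- move=> a f h; apply: schwartz_eq => x.
  rewrite -[LHS]/((a * f x + h x) * g x) -[RHS]/(a * (f x * g x) + h x * g x); ring.
move=> /schwartz_smallP[a Aa] /schwartz_smallP[b Bb]; apply/schwartz_smallP.
exists (fun k w => \sum_(p <- splits w) a 0%N p.1 * b k p.2).
move=> k w _ x [f Af [g Bg <-]].
apply: (mul_bound (b := a 0%N) (a := b) (schwartz_smooth f)) => [v y|k' w' y].
- by have := Aa 0%N v f y Af; rewrite expr0 mulr1.
- exact: Bb.
Qed.

HB.instance Definition _ := Bornological_isAlgebra.Build R (schwartz R n)
  schwartz_mulA schwartz_mul_bounded.

End Product.

Lemma linear_lsubmx m n : linear (@lsubmx R 1 m n).
Proof. exact: linearP. Qed.
Lemma linear_rsubmx m n : linear (@rsubmx R 1 m n).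
Proof. exact: linearP. Qed.
Lemma continuous_lsubmx m n : continuous (@lsubmx R 1 m n).
Proof.
move=> x U /nbhs_ballP[e e0 eU]; apply/nbhs_ballP; exists e => //= y [_ xy].
by apply: eU; split=> // i j; rewrite !mxE; exact: xy.
Qed.
Lemma continuous_rsubmx m n : continuous (@rsubmx R 1 m n).
Proof.
move=> x U /nbhs_ballP[e e0 eU]; apply/nbhs_ballP; exists e => //= y [_ xy].
by apply: eU; split=> // i j; rewrite !mxE; exact: xy.
Qed.

Definition left_index m n (i : 'I_(m + n)) : option 'I_m :=
  match fintype.split i with inl j => Some j | inr _ => None end.
Definition right_index m n (i : 'I_(m + n)) : option 'I_n :=
  match fintype.split i with inl _ => None | inr j => Some j end.

Lemma lsubmx_delta m n (i : 'I_(m + n)) : lsubmx (delta_mx 0 i : 'rV[R]_(m + n)) =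
  if left_index i is Some j then delta_mx 0 j else 0.
Proof.
rewrite /left_index; case: split_ordP => j ->; apply/rowP => l; rewrite !mxE eqxx /=.
  by rewrite (inj_eq (@lshift_inj _ _)).
by rewrite eq_lrshift.
Qed.
Lemma rsubmx_delta m n (i : 'I_(m + n)) : rsubmx (delta_mx 0 i : 'rV[R]_(m + n)) =
  if right_index i is Some j then delta_mx 0 j else 0.
Proof.
rewrite /right_index; case: split_ordP => j ->; apply/rowP => l; rewrite !mxE eqxx /=.
  by rewrite eq_rlshift.
by rewrite (inj_eq (@rshift_inj _ _)).
Qed.

Lemma weight_row m n k (x : 'rV[R]_(m + n)) :
  (1 + enorm x) ^+ k <= (1 + enorm (lsubmx x)) ^+ k * (1 + enorm (rsubmx x)) ^+ k.
Proof.
have e0 := @enorm_ge0 R; rewrite -exprMn lerXn2r ?nnegrE ?mulr_ge0 ?addr_ge0//.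
apply: (@le_trans _ _ (1 + (enorm (lsubmx x) + enorm (rsubmx x)))); last first.
  rewrite mulrDr mulr1 mulrDl mul1r -!addrA lerD2l lerD2l.
  by rewrite lerDl mulr_ge0.
rewrite lerD2l -(ler_pXn2r (ltn0Sn 1)) ?nnegrE ?addr_ge0//.
rewrite sqrrD !sqr_sqrtr ?sumr_ge0//; try by move=> i _; rewrite sqr_ge0.
rewrite big_split_ord /=.
rewrite [X in _ <= X + _ + _](_ : _ = \sum_i x 0 (lshift n i) ^+ 2); last first.
  by apply: eq_bigr => i _; rewrite mxE.
rewrite [X in _ <= _ + _ + X](_ : _ = \sum_i x 0 (rshift m i) ^+ 2); last first.
  by apply: eq_bigr => i _; rewrite mxE.
by rewrite addrAC lerDl mulrn_wge0// mulr_ge0.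
Qed.

Section ExternalProduct.
Variables m n : nat.

Lemma tensor_bound (f : schwartz R m) (g : schwartz R n)
    (a : nat -> seq 'I_m -> R) (b : nat -> seq 'I_n -> R) :
  (forall k w x, normc (pderives w f x) * (1 + enorm x) ^+ k <= a k w) ->
  (forall k w x, normc (pderives w g x) * (1 + enorm x) ^+ k <= b k w) ->
  forall k w x,
    normc (pderives w (fun x : 'rV[R]_(m + n) => f (lsubmx x) * g (rsubmx x)) x) *
      (1 + enorm x) ^+ k <=
    \sum_(p <- splits w) subst_bound (@left_index m n) (a k) p.1 *
                         subst_bound (@right_index m n) (b k) p.2.
Proof.
move=> fa gb k w x.
apply: (le_trans (ler_wpM2l (normc_ge0 _) (weight_row k x))).
apply: (Leibniz_bound w
  (smooth_subst (@linear_lsubmx m n) (@continuous_lsubmx m n) (@lsubmx_delta m n)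
    (schwartz_smooth f))
  (smooth_subst (@linear_rsubmx m n) (@continuous_rsubmx m n) (@rsubmx_delta m n)
    (schwartz_smooth g)) (weight_ge0 k _) (weight_ge0 k _)) => u.
- by apply: (subst_boundP (@linear_lsubmx m n) (@lsubmx_delta m n)) => v; exact: fa.
- by apply: (subst_boundP (@linear_rsubmx m n) (@rsubmx_delta m n)) => v; exact: gb.
Qed.

Fact schwartz_tensor_subproof (f : schwartz R m) (g : schwartz R n) :
  is_schwartz (fun x : 'rV[R]_(m + n) => f (lsubmx x) * g (rsubmx x)).
Proof.
apply/asboolP; split.
  exact: (smoothM
    (smooth_subst (@linear_lsubmx m n) (@continuous_lsubmx m n) (@lsubmx_delta m n)
      (schwartz_smooth f))
    (smooth_subst (@linear_rsubmx m n) (@continuous_rsubmx m n) (@rsubmx_delta m n)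
      (schwartz_smooth g))).
have [a fa] := schwartz_sup f; have [b gb] := schwartz_sup g.
move=> k w; apply/seminorm_ltP; eexists; apply/seminorm_leP => x.
exact: (tensor_bound fa gb).
Qed.

(* (f (x) g)(s, t) = f(s) g(t), with (s, t) encoded as [row_mx s t] *)
Definition schwartz_tensor (f : schwartz R m) (g : schwartz R n) : schwartz R (m + n) :=
  Schwartz (schwartz_tensor_subproof f g).

End ExternalProduct.

Section Comultiplication.
Variable n : nat.

Let add (x : 'rV[R]_(n + n)) : 'rV[R]_n := lsubmx x + rsubmx x.
Let add_index (i : 'I_(n + n)) : option 'I_n :=
  match fintype.split i with inl j => Some j | inr j => Some j end.

Let linear_add : linear add.
Proof.
by move=> a x y; rewrite /add linear_lsubmx linear_rsubmx scalerDr addrACA.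
Qed.
Let continuous_add : continuous add.
Proof.
by move=> x; apply: continuousD; [exact: continuous_lsubmx|exact: continuous_rsubmx].
Qed.
Let add_delta i : add (delta_mx 0 i) =
  if add_index i is Some j then delta_mx 0 j else 0.
Proof.
rewrite /add lsubmx_delta rsubmx_delta /left_index /right_index /add_index.
by case: fintype.split => j; rewrite ?addr0 ?add0r.
Qed.

Let smooth_add (f : schwartz R n) : smooth (fun x => f (add x)).
Proof. exact: (smooth_subst linear_add continuous_add add_delta (schwartz_smooth f)). Qed.

Let comul_bound (f : schwartz R n) (a : nat -> seq 'I_n -> R) :
  (forall k w x, normc (pderives w f x) * (1 + enorm x) ^+ k <= a k w) ->
  forall w x, normc (pderives w (fun x => f (add x)) x) <= subst_bound add_index (a 0%N) w.
Proof.
move=> fa w x; rewrite -[leLHS]mulr1.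
apply: (subst_boundP linear_add add_delta) => u.
by have := fa 0%N u (add x); rewrite expr0.
Qed.

Fact comul_op_subproof (f : schwartz R n) (F : schwartz R (n + n)) :
  is_schwartz (fun x : 'rV[R]_(n + n) => f (lsubmx x + rsubmx x) * F x).
Proof.
have [a fa] := schwartz_sup f.
apply: is_schwartz_mul (smooth_add f) _ => v.
by exists (subst_bound add_index (a 0%N) v) => x; exact: comul_bound.
Qed.

Definition comul_op (f : schwartz R n) (F : schwartz R (n + n)) : schwartz R (n + n) :=
  Schwartz (comul_op_subproof f F).

Fact comul_op_bounded : bounded_bilinear comul_op.
Proof.
split=> [f|F|A B].
- move=> a F G; apply: schwartz_eq => x; set y := lsubmx x + rsubmx x.
  rewrite -[LHS]/(f y * (a * F x + G x)) -[RHS]/(a * (f y * F x) + f y * G x); ring.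
- move=> a f g; apply: schwartz_eq => x; set y := lsubmx x + rsubmx x.
  rewrite -[LHS]/((a * f y + g y) * F x) -[RHS]/(a * (f y * F x) + g y * F x); ring.
move=> /schwartz_smallP[a Aa] /schwartz_smallP[b Bb]; apply/schwartz_smallP.
exists (fun k w => \sum_(p <- splits w) subst_bound add_index (a 0%N) p.1 * b k p.2).
move=> k w _ x [f Af [F BF <-]];
apply: (mul_bound (b := subst_bound add_index (a 0%N)) (a := b) (smooth_add f))
  => [v y|k' w' y].
  by apply: comul_bound => k' w' z; exact: Aa.
exact: Bb.
Qed.

Fact comul_op_bhom f : is_bhom (comul_op f).
Proof.
have [l _ b] := comul_op_bounded; apply/asboolP; split=> // A sA.
by apply: smallS (b _ _ (small1 f) sA) => _ [F AF <-]; exists f => //; exists F.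
Qed.

Fact comul_mult_subproof f :
  is_multiplier (BHom (comul_op_bhom f), BHom (comul_op_bhom f)).
Proof.
apply/asboolP; split=> F G; apply: schwartz_eq => x /=.
- by rewrite mulrA.
- by rewrite mulrCA.
- by rewrite mulrCA mulrA.
Qed.

Definition schwartz_comul_fun (f : schwartz R n) : multiplier (schwartz R (n + n)) :=
  Multiplier (comul_mult_subproof f).

Fact schwartz_comul_subproof : is_bhom schwartz_comul_fun.
Proof.
have [_ l b] := comul_op_bounded; apply/asboolP; split=> [a f g|A sA].
  by apply: multiplier_eq => F; exact: (l F a f g).
by split=> S sS; apply: smallS (b _ _ sA sS);
  move=> _ [_ [_ [_ [f Af <-] <-] <-] [F SF <-]]; exists f => //; exists F.
Qed.

(* Delta(f) is the multiplier given by multiplication with f(s + t) *)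
Definition schwartz_comul : bhom (schwartz R n) (multiplier (schwartz R (n + n))) :=
  BHom schwartz_comul_subproof.

End Comultiplication.

Fixpoint iterated_integral n : ('rV[R]_n -> R) -> R :=
  if n is n'.+1 return ('rV[R]_n -> R) -> R then
    fun f => (\int[lebesgue_measure]_x
      iterated_integral (fun y : 'rV[R]_n' => f (row_mx (x%:M : 'rV[R]_1) y)))%R
  else fun f => f 0.

(* By Fubini, the Lebesgue integral of f over R^n. *)
Definition schwartz_integral n (f : schwartz R n) : R[i]^o :=
  iterated_integral (fun x => Re (f x)) +i* iterated_integral (fun x => Im (f x)).

End SchwartzAlgebra.

(* Main.v *)
Require Import Defs.
From HB Require Import structures.
From mathcomp Require Import all_boot all_order all_algebra.
From mathcomp Require Import complex ring_quotient ring lra.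
From mathcomp Require Import all_classical all_reals all_analysis.
From mathcomp Require Import measurable_realfun.

(** Everything rests on expansions in Hermite functions. On the line, the creation operator
    x - d/dx can be inverted on functions orthogonal to the Gaussian, which gives a spectral
    gap for the number operator and hence, by a Sobolev inequality, pointwise convergence of
    Hermite series; iterating the number operator shows that coefficients decrease rapidly,
    uniformly on small sets. Tensor products of Hermite functions then expand S(R^n) with
    partial sums converging at a uniform rate. Partial sums are finite rank operators, so
    this is the approximation property, and summing b(e_i, e_j) against the coefficients
    extends a bounded bilinear map b to S(R^(m+n)), so this is the completed tensor product.

    For a linear map L : R^k -> R^p, let S(R^p) act on S(R^k) by (f F)(y) = f(L y) F(y). The
    action map is restriction to the graph of L; its section is F |-> w(r - L y) F(y) with
    w(0) = 1, and cut-offs in the first variable show that its kernel is the closed span of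
    the balancing relations. With L = id and L(s, t) = s + t this proves that the algebra and
    the comultiplication are essential. Multipliers are multiplications by functions, so
    they pull back along L, which gives coassociativity pointwise. The Galois maps are
    linear changes of variables, the integral is faithful because f conj(f) >= 0, and its
    left invariance is translation invariance. *)

Set Implicit Arguments.
Unset Strict Implicit.
Unset Printing Implicit Defensive.

Import Order.TTheory GRing.Theory Num.Theory.
Import ComplexField.Normc.
Import numFieldNormedType.Exports.

Local Open Scope classical_set_scope.
Local Open Scope ring_scope.
Local Open Scope complex_scope.

Local Notation Re := complex.Re.
Local Notation Im := complex.Im.

(** * Calculus of smooth functions *)

(** Convergence is proved at an explicit rate: u_N - x = y_N / (N + 1) with all y_N in one small
    set. The rescaled errors (N + 1)(u_N - x) are then equibounded, so results about families apply
    to them. This is why series, slices and extensions from tensors are stated for families with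
    uniform bounds: small sets of multipliers, rescaled cut-off errors and rescaled errors of
    partial sums all occur as such families.

    No Hilbert space completion is formed. The remainder r of a Hermite expansion after N terms
    satisfies ||lower r||^2 >= 2 N ||r||^2, and comparing this with the energy of the function makes
    r small in norm together with its derivative.

    To extend a bilinear map, a rapidly decreasing coefficient at (e_i, e_j) is factored through its
    square root, so that each argument stays in a fixed small set.

    Smoothness is deduced from second-order expansions with bounded constants. Such bounds survive
    pointwise limits, substitutions and slices, so derivatives are never interchanged with limits or
    integrals directly. *)

Section Calculus1.
Context {R : realType}.

Lemma lip1 (u du : R -> R) (C : R) :
  (forall x : R, is_derive x 1 u (du x)) -> (forall x, `|du x| <= C) ->
  forall x y, `|u y - u x| <= C * `|y - x|.
Proof.
move=> ud duC.
have cu (x y : R) : {within `[x, y], continuous u}.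
  apply: derivable_within_continuous => z _; exact: (ex_derive (is_derive := ud z)).
have aux x y : x <= y -> `|u y - u x| <= C * `|y - x|.
  move=> xy; have [c _ ->] := MVT_segment xy (fun z _ => ud z) (cu x y).
  by rewrite normrM ler_wpM2r.
move=> x y; case: (leP x y) => [|/ltW]; first exact: aux.
by rewrite distrC (distrC y x); exact: aux.
Qed.

Lemma lip1_loc (u du : R -> R) (C h : R) :
  (forall x : R, is_derive x 1 u (du x)) -> (forall x, `|x| <= `|h| -> `|du x| <= C) ->
  `|u h - u 0| <= C * `|h|.
Proof.
move=> ud duC.
have cu (x y : R) : {within `[x, y], continuous u}.
  apply: derivable_within_continuous => z _; exact: (ex_derive (is_derive := ud z)).
case: (leP 0 h) => [h0|/ltW h0].
  have [c + ->] := MVT_segment h0 (fun z _ => ud z) (cu _ _).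
  rewrite in_itv/= => /andP[c0 ch]; rewrite subr0 normrM ler_wpM2r// duC//.
  by rewrite !ger0_norm.
rewrite distrC; have [c + ->] := MVT_segment h0 (fun z _ => ud z) (cu _ _).
rewrite in_itv/= => /andP[c0 ch]; rewrite sub0r normrM normrN ler_wpM2r// duC//.
by rewrite !ler0_norm// lerN2.
Qed.

(** The mean value theorem is applied to [u], then to [du] between 0 and the intermediate point;
    this loses the usual factor 1/2. *)
Lemma taylor1 (u du ddu : R -> R) (C : R) :
  (forall x : R, is_derive x 1 u (du x)) -> (forall x : R, is_derive x 1 du (ddu x)) ->
  (forall x, `|ddu x| <= C) -> forall h, `|u h - u 0 - h * du 0| <= C * h ^+ 2.
Proof.
move=> ud dud dduC h.
have C0 : 0 <= C by apply: le_trans (dduC 0); exact: normr_ge0.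
have lip := lip1 dud dduC.
have cu (x y : R) : {within `[x, y], continuous u}.
  apply: derivable_within_continuous => z _; exact: (ex_derive (is_derive := ud z)).
case: (leP 0 h) => [h0|/ltW h0].
  have [c + ->] := MVT_segment h0 (fun z _ => ud z) (cu 0 h).
  rewrite in_itv/= => /andP[c0 ch]; rewrite subr0 [h * _]mulrC -mulrBl normrM.
  rewrite expr2 mulrA (ger0_norm h0) ler_wpM2r// (le_trans (lip 0 c))//.
  by rewrite subr0 ger0_norm// ler_wpM2l.
have [c + E] := MVT_segment h0 (fun z _ => ud z) (cu h 0).
rewrite in_itv/= => /andP[hc c0].
have -> : u h - u 0 - h * du 0 = h * (du c - du 0) by move: E; set a := du c; lra.
rewrite normrM mulrC [`|h|]ler0_norm// -[X in _ <= X](_ : (C * - h) * - h = _); last by ring.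
rewrite ler_wpM2r ?oppr_ge0// (le_trans (lip 0 c))// subr0 ler0_norm//.
by rewrite ler_wpM2l// lerN2.
Qed.

(** A converse of Taylor's formula: a quadratic error bound identifies the derivative. *)
Lemma taylor_derive (n : nat) (g : 'rV[R]_n -> R) x v (d C : R) :
  (forall h : R, `|g (x + h *: v) - g x - h * d| <= C * h ^+ 2) ->
  is_derive x v g d.
Proof.
move=> gC; have C0 : 0 <= C.
  by have := gC 1; rewrite expr1n mulr1; apply: le_trans.
have cv : (fun h : R => h^-1 *: ((g \o shift x) (h *: v) - g x)) @ 0^' --> d.
  apply/cvgrPdist_le => e e0; near=> h.
  have h0 : h != 0 by near: h; exact: nbhs_dnbhs_neq.
  rewrite distrC /= (_ : _ - d = h^-1 * (g (x + h *: v) - g x - h * d)); last first.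
    by rewrite [h *: v + _]addrC [RHS]mulrBr mulKf.
  rewrite normrM normfV ler_pdivrMl ?normr_gt0// (le_trans (gC h))//.
  rewrite -(real_normK (num_real h)) expr2 mulrCA ler_wpM2l//.
  rewrite (@le_trans _ _ ((C + 1) * `|h|))//.
    by rewrite ler_wpM2r// lerDl.
  rewrite -ler_pdivlMl ?ltr_wpDl//.
  near: h; apply: dnbhs0_le; rewrite mulr_gt0// invr_gt0 ltr_wpDl//.
by split; [apply/cvg_ex; exists d|exact/cvg_lim].
Unshelve. all: by end_near.
Qed.

Lemma is_derive_along (n : nat) (g : 'rV[R]_n -> R) x v (s : R) :
  derivable g (x + s *: v) v ->
  is_derive s 1 (fun t : R => g (x + t *: v)) ('D_v g (x + s *: v)).
Proof.
have E : (fun h : R => h^-1 *: (((fun t : R => g (x + t *: v)) \o shift s) (h *: 1) -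
      g (x + s *: v))) =
    (fun h : R => h^-1 *: ((g \o shift (x + s *: v)) (h *: v) - g (x + s *: v))).
  apply/funext => h /=; congr (_ *: (g _ - _)).
  by rewrite -[h *: 1]/(h * 1) mulr1 scalerDl addrCA.
by move=> dg; split; rewrite /derivable /derive E.
Qed.

End Calculus1.

(** * Real and imaginary parts and the modulus *)

Section Complex.
Context {R : realType}.
Implicit Types z : R[i].

Lemma normc_Re z : `|Re z| <= normc z.
Proof.
case: z => a b /=; rewrite -[X in X <= _]sqrtr_sqr ler_wsqrtr// lerDl.
exact: sqr_ge0.
Qed.
Lemma normc_Im z : `|Im z| <= normc z.
Proof.
case: z => a b /=; rewrite -[X in X <= _]sqrtr_sqr ler_wsqrtr// lerDr.
exact: sqr_ge0.
Qed.
Lemma normc_ReIm z : normc z <= `|Re z| + `|Im z|.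
Proof.
case: z => a b /=; rewrite -[X in _ <= X](@ger0_norm _ (`|a| + `|b|)) ?addr_ge0//.
rewrite -sqrtr_sqr ler_wsqrtr// sqrrD !real_normK ?num_real// addrAC lerDl.
by rewrite mulrn_wge0// mulr_ge0.
Qed.
Lemma normcR (t : R) : normc t%:C = `|t|.
Proof. by rewrite /normc /= expr0n addr0 sqrtr_sqr. Qed.
Lemma normcN z : normc (- z) = normc z.
Proof. by case: z => a b /=; rewrite !sqrrN. Qed.
Lemma normcBC z w : normc (z - w) = normc (w - z).
Proof. by rewrite -normcN opprB. Qed.
Lemma ReB z w : Re (z - w) = Re z - Re w. Proof. by case: z; case: w. Qed.
Lemma ImB z w : Im (z - w) = Im z - Im w. Proof. by case: z; case: w. Qed.
Lemma ReRM (t : R) z : Re (t%:C * z) = t * Re z.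
Proof. by case: z => a b /=; rewrite mul0r subr0. Qed.
Lemma ImRM (t : R) z : Im (t%:C * z) = t * Im z.
Proof. by case: z => a b /=; rewrite mul0r addr0. Qed.
(** The mean value theorem fails for complex values, so the two parts are estimated separately; this
    doubles the constant here and in the complex Taylor bounds below. *)
Lemma clip1 (u : R -> R[i]) du (C h : R) :
  (forall s : R, is_derive s 1 (fun s => Re (u s)) (Re (du s))) ->
  (forall s : R, is_derive s 1 (fun s => Im (u s)) (Im (du s))) ->
  (forall s, `|s| <= `|h| -> normc (du s) <= C) ->
  normc (u h - u 0) <= (C + C) * `|h|.
Proof.
move=> uR uI uC; apply: le_trans (normc_ReIm _) _; rewrite ReB ImB mulrDl.
apply: lerD.
  by apply: (lip1_loc uR) => s sh; exact: (le_trans (normc_Re _) (uC _ sh)).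
by apply: (lip1_loc uI) => s sh; exact: (le_trans (normc_Im _) (uC _ sh)).
Qed.
Lemma complexP z w : Re z = Re w -> Im z = Im w -> z = w.
Proof. by case: z w => a b [c d] /= -> ->. Qed.
End Complex.

Section Calculus.
Context {R : realType}.
Variable n : nat.
Implicit Types (f : 'rV[R]_n -> R[i]) (x : 'rV[R]_n).

Local Notation d_ i := (delta_mx 0 i : 'rV[R]_n).

Lemma pderive_taylor f i x (C : R) : smooth f ->
  (forall s : R, normc (pderive i (pderive i f) (x + s *: d_ i)) <= C) ->
  forall h : R, normc (f (x + h *: d_ i) - f x - h%:C * pderive i f x) <=
    (C + C) * h ^+ 2.
Proof.
move=> sf fC h.
have [_ _ r0 i0] := sf [::]; have [_ _ r1 i1] := sf [:: i].
have xE : x = x + 0 *: d_ i by rewrite scale0r addr0.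
apply: le_trans (normc_ReIm _) _; rewrite mulrDl !ReB !ImB ReRM ImRM.
apply: lerD.
- have := @taylor1 R (fun s => Re (f (x + s *: d_ i)))
    (fun s => Re (pderive i f (x + s *: d_ i)))
    (fun s => Re (pderive i (pderive i f) (x + s *: d_ i))) C.
  rewrite /= -xE; apply.
  + by move=> s; apply: is_derive_along (fun y => Re (f y)) _ _ _ _.
  + by move=> s; apply: is_derive_along (fun y => Re (pderive i f y)) _ _ _ _; exact: r1.
  + by move=> s; exact: (le_trans (normc_Re _) (fC _)).
- have := @taylor1 R (fun s => Im (f (x + s *: d_ i)))
    (fun s => Im (pderive i f (x + s *: d_ i)))
    (fun s => Im (pderive i (pderive i f) (x + s *: d_ i))) C.
  rewrite /= -xE; apply.
  + by move=> s; apply: is_derive_along (fun y => Im (f y)) _ _ _ _.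
  + by move=> s; apply: is_derive_along (fun y => Im (pderive i f y)) _ _ _ _; exact: i1.
  + by move=> s; exact: (le_trans (normc_Im _) (fC _)).
Qed.

Lemma pderive_lip f i (C : R) :
  (forall x, derivable (fun y => Re (f y)) x (d_ i)) ->
  (forall x, derivable (fun y => Im (f y)) x (d_ i)) ->
  (forall x, normc (pderive i f x) <= C) -> forall x (h : R), normc (f (x + h *: d_ i) - f x) <= (C + C) * `|h|.
Proof.
move=> r0 i0 fC x h.
have xE : x = x + 0 *: d_ i by rewrite scale0r addr0.
apply: le_trans (normc_ReIm _) _; rewrite mulrDl !ReB !ImB.
rewrite -[in `|h|](subr0 h); apply: lerD.
- have := @lip1 R (fun s => Re (f (x + s *: d_ i)))
    (fun s => Re (pderive i f (x + s *: d_ i))) C _ _ 0 h.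
  rewrite /= -xE; apply.
  + by move=> s; apply: is_derive_along (fun y => Re (f y)) _ _ _ _.
  + by move=> s; exact: (le_trans (normc_Re _) (fC _)).
- have := @lip1 R (fun s => Im (f (x + s *: d_ i)))
    (fun s => Im (pderive i f (x + s *: d_ i))) C _ _ 0 h.
  rewrite /= -xE; apply.
  + by move=> s; apply: is_derive_along (fun y => Im (f y)) _ _ _ _.
  + by move=> s; exact: (le_trans (normc_Im _) (fC _)).
Qed.

(** The point moves from [x] to [y] one coordinate at a time. *)
Lemma lip_coord f (C : R) :
  (forall i x (h : R), normc (f (x + h *: d_ i) - f x) <= C * `|h|) ->
  forall x y, normc (f y - f x) <= C * \sum_i `|y 0 i - x 0 i|.
Proof.
move=> fC x y.
have aux (r : seq 'I_n) (c : 'I_n -> R) : normc (f (x + \sum_(i <- r) c i *: d_ i) - f x) <=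
    C * \sum_(i <- r) `|c i|.
  elim: r => [|i r IH]; first by rewrite !big_nil addr0 subrr normc0 mulr0.
  rewrite !big_cons mulrDr [c i *: _ + _]addrC addrA.
  apply: le_trans (lerD (fC i (x + \sum_(i <- r) c i *: d_ i) (c i)) IH).
  apply: le_trans (le_normcD _ _); rewrite addrA subrK//.
suff {1}-> : y = x + \sum_i (y 0 i - x 0 i) *: d_ i by exact: aux.
rewrite -{1}(subrK x y) addrC; congr (x + _).
by rewrite [LHS]row_sum_delta; apply: eq_bigr => i _; rewrite !mxE.
Qed.

Lemma lip_continuous f (C : R) :
  (forall x y, normc (f y - f x) <= C * \sum_i `|y 0 i - x 0 i|) ->
  continuous (fun y => Re (f y)) /\ continuous (fun y => Im (f y)).
Proof.
move=> fC; suff aux (g : R[i] -> R) : (forall z w, `|g z - g w| <= normc (z - w)) ->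
    continuous (fun y => g (f y)).
  split; apply: aux => z w; first by rewrite -ReB normc_Re.
  by rewrite -ImB normc_Im.
move=> gl x U /nbhs_ballP[e /= e0 eU]; apply/nbhs_ballP.
(* The summand 1 keeps the radius well defined and positive when [n] or [C] is 0. *)
exists (e / (n%:R * `|C| + 1)) => /=.
  by rewrite divr_gt0// ltr_wpDl// mulr_ge0.
move=> y [_ xy]; apply: eU; rewrite /ball/= distrC.
apply: le_lt_trans (gl _ _) _; apply: le_lt_trans (fC _ _) _.
apply: (@le_lt_trans _ _ (`|C| * \sum_(i < n) (e / (n%:R * `|C| + 1)))).
  apply: (@le_trans _ _ (`|C| * \sum_i `|y 0 i - x 0 i|)).
    by rewrite ler_wpM2r ?ler_norm// sumr_ge0.
  rewrite ler_wpM2l//; apply: ler_sum => i _; apply/ltW.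
  by rewrite distrC; exact: xy.
rewrite sumr_const card_ord -[X in _ * X]mulr_natl mulrCA !mulrA.
rewrite ltr_pdivrMr ?ltr_wpDl// ?mulr_ge0// mulrDr mulr1 [_ * e]mulrC.
by rewrite ltrDl.
Qed.

(* Only pointwise second-order expansions are required: boundedness of the
   next derivative gives continuity. *)
Lemma smooth_family (G : seq 'I_n -> 'rV[R]_n -> R[i]) (b : seq 'I_n -> R)
    (c : seq 'I_n -> 'I_n -> R) :
  (forall w x, normc (G w x) <= b w) ->
  (forall w i x (h : R), normc (G w (x + h *: d_ i) - G w x - h%:C * G (i :: w) x) <=
     c w i * h ^+ 2) ->
  smooth (G [::]) /\ forall w, pderives w (G [::]) = G w.
Proof.
move=> Gb Gt.
have dR w i x : is_derive x (d_ i) (fun y => Re (G w y)) (Re (G (i :: w) x)).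
  apply: (@taylor_derive _ _ _ _ _ _ (c w i)) => h.
  by rewrite -ReRM -!ReB; exact: (le_trans (normc_Re _) (Gt _ _ _ _)).
have dI w i x : is_derive x (d_ i) (fun y => Im (G w y)) (Im (G (i :: w) x)).
  apply: (@taylor_derive _ _ _ _ _ _ (c w i)) => h.
  by rewrite -ImRM -!ImB; exact: (le_trans (normc_Im _) (Gt _ _ _ _)).
have dG w i : pderive i (G w) = G (i :: w).
  apply/funext => x; rewrite /pderive (derive_val (is_derive := dR w i x)).
  by rewrite (derive_val (is_derive := dI w i x)); case: (G _ _).
have pG w : pderives w (G [::]) = G w by elim: w => //= i w ->.
split=> // w; rewrite pG.
have lG : exists C, forall i x (h : R), normc (G w (x + h *: d_ i) - G w x) <= C * `|h|.
  exists (\sum_i (`|b (i :: w)| + `|b (i :: w)|)) => i x h.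
  apply: (@le_trans _ _ ((`|b (i :: w)| + `|b (i :: w)|) * `|h|)).
    apply: pderive_lip => [y|y|y]; [exact: (ex_derive (is_derive := dR w i y))|
      exact: (ex_derive (is_derive := dI w i y))|].
    by rewrite dG; apply: le_trans (Gb _ _) _; exact: ler_norm.
  rewrite ler_wpM2r// (bigD1 i)//= lerDl; apply: sumr_ge0 => j _.
  by rewrite addr_ge0.
have [C /lip_coord/lip_continuous[cR cI]] := lG.
by split.
Qed.

End Calculus.

(** * Taylor bounds and symmetry of mixed derivatives *)

Section SchwartzCalculus.
Context {R : realType}.

Section Fixed.
Variable n : nat.
Implicit Types (f g : schwartz R n) (x : 'rV[R]_n).
Local Notation d_ i := (delta_mx 0 i : 'rV[R]_n).

Lemma schwartz_bounded f w : exists M : R, forall x, normc (pderives w f x) <= M.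
Proof.
have [M fM] := schwartz_bound f 0 w; exists M => x.
by have := fM x; rewrite expr0 mulr1.
Qed.

Lemma weight_ge1 k x : 1 <= (1 + enorm x) ^+ k.
Proof. by rewrite exprn_ege1// lerDl enorm_ge0. Qed.

(** The construction principle behind limits, compositions, slices and conjugates: decay of every
    candidate derivative [G w], and a quadratic expansion linking [G w] to [G (i :: w)]. *)
Lemma schwartz_family (G : seq 'I_n -> 'rV[R]_n -> R[i])
    (c : seq 'I_n -> 'I_n -> R) :
  (forall k w, exists M : R, forall x, normc (G w x) * (1 + enorm x) ^+ k <= M) ->
  (forall w i x (h : R), normc (G w (x + h *: d_ i) - G w x - h%:C * G (i :: w) x) <=
     c w i * h ^+ 2) ->
  exists F : schwartz R n, forall w x, pderives w F x = G w x.
Proof.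
move=> Gb Gt; have b w := cid (Gb 0%N w).
have [|sG pG] := @smooth_family R n G (fun w => sval (b w)) c _ Gt.
  by move=> w x; case: (b w) => M /= /(_ x); rewrite expr0 mulr1.
have iG : is_schwartz (G [::] : _ -> R[i]^o).
  apply/asboolP; split=> // k w; apply/seminorm_ltP; have [M GM] := Gb k w.
  by exists M; apply/seminorm_leP => x; rewrite pG.
by exists (Schwartz iG) => w x; rewrite pG.
Qed.

(** Only the line through [x] enters the hypothesis, so [C] may depend on [x]; [restr_taylor] uses
    this to carry a weight. *)
Lemma schwartz_taylor f w i x (C : R) :
  (forall s : R, normc (pderives (i :: i :: w) f (x + s *: d_ i)) <= C) ->
  forall h : R, normc (pderives w f (x + h *: d_ i) - pderives w f x -
    h%:C * pderives (i :: w) f x) <= (C + C) * h ^+ 2.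
Proof.
move=> fC h; apply: pderive_taylor => // v.
by rewrite /pderives -foldr_cat; exact: schwartz_smooth.
Qed.

Fact sderive_subproof w f : is_schwartz (pderives w f : _ -> R[i]^o).
Proof.
have E v : pderives v (pderives w f) = pderives (v ++ w) f.
  by rewrite /pderives foldr_cat.
apply/asboolP; split=> [v|k v]; first by rewrite E; exact: schwartz_smooth.
have [M fM] := schwartz_bound f k (v ++ w); apply/seminorm_ltP; exists M.
by apply/seminorm_leP => x; rewrite E.
Qed.
Definition sderive w f : schwartz R n := Schwartz (sderive_subproof w f).

Lemma pderives_sderive v w f : pderives v (sderive w f) = pderives (v ++ w) f.
Proof. by rewrite /pderives foldr_cat. Qed.

Lemma sderive_bhom w : is_bhom (sderive w).
Proof.
apply/asboolP; split=> [a f g|A /schwartz_smallP[a Aa]].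
  apply: schwartz_eq => x; rewrite -[RHS]/(a * pderives w f x + pderives w g x).
  rewrite -[LHS]/(pderives w (fun y => a * f y + g y) x).
  rewrite pderivesD ?pderivesZ//; first exact: schwartz_smooth.
  - exact: (smoothM (smooth_cst a) (schwartz_smooth f)).
  - exact: schwartz_smooth.
apply/schwartz_smallP; exists (fun k v => a k (v ++ w)) => k v _ x [f Af <-].
by rewrite pderives_sderive; exact: Aa.
Qed.

Lemma pderives_linear w (a : R[i]) f g x :
  pderives w (a *: f + g) x = a * pderives w f x + pderives w g x.
Proof.
have /asboolP[l _] := sderive_bhom w.
by have := congr1 (fun F : schwartz R n => F x) (l a f g).
Qed.

Lemma schwartz_derivable f w i x :
  derivable (fun y => Re (pderives w f y)) x (d_ i) /\
  derivable (fun y => Im (pderives w f y)) x (d_ i).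
Proof. by have [_ _ r0 i0] := schwartz_smooth f w; split. Qed.

Lemma schwartz_lip f w i : exists2 C : R, 0 <= C & forall x (h : R),
  normc (pderives w f (x + h *: d_ i) - pderives w f x) <= C * `|h|.
Proof.
have [M fM] := schwartz_bounded f (i :: w); exists (M + M) => [|x h].
  by have := le_trans (normc_ge0 _) (fM 0) => M0; rewrite addr_ge0.
apply: (@pderive_lip _ _ (pderives w f)) => // y; first by case: (schwartz_derivable f w i y).
by case: (schwartz_derivable f w i y).
Qed.

Lemma schwartz_taylor_le f w i : exists2 C : R, 0 <= C & forall x (h : R),
  normc (pderives w f (x + h *: d_ i) - pderives w f x - h%:C * pderives (i :: w) f x) <=
  C * h ^+ 2.
Proof.
have [M fM] := schwartz_bounded f (i :: i :: w); exists (M + M) => [|x h].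
  by have := le_trans (normc_ge0 _) (fM 0) => M0; rewrite addr_ge0.
exact: schwartz_taylor.
Qed.

(* The second difference is h^2 times the mixed derivative up to O(h^3), and it is
   symmetric in the two directions. *)
Let second_difference f i j x : exists2 C : R, 0 <= C & forall h : R,
  normc (f (x + h *: d_ i + h *: d_ j) - f (x + h *: d_ i) - (f (x + h *: d_ j) - f x) -
    (h ^+ 2)%:C * pderives [:: j; i] f x) <= C * `|h| ^+ 3.
Proof.
have [C1 C10 f1] := schwartz_taylor_le f [:: i] j.
have [C2 C20 f2] := schwartz_lip f [:: j; i] i.
exists ((C1 + C2) + (C1 + C2)) => [|h]; first by rewrite !addr_ge0.
pose z := pderives [:: j; i] f x.
have fd y : is_derive (0 : R) 1 (fun s : R => Re (f (y + s *: d_ i))) (Re (pderive i f y)).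
  have [+ _] := schwartz_derivable f [::] i (y + 0 *: d_ i).
  by move=> /is_derive_along; rewrite /= !(scale0r, addr0).
(* [u s] is the increment in direction j at x + s e_i minus its expected part s h z. Its derivative
   [du] is O(h^2) for |s| <= |h|, so u h - u 0 is O(h^3). *)
pose u (s : R) := f (x + s *: d_ i + h *: d_ j) - f (x + s *: d_ i) - (s * h)%:C * z.
pose du (s : R) := pderive i f (x + s *: d_ i + h *: d_ j) - pderive i f (x + s *: d_ i) -
  h%:C * z.
have duR (s : R) : is_derive s 1 (fun s => Re (u s)) (Re (du s)).
  have [+ _] := schwartz_derivable f [::] i (x + h *: d_ j + s *: d_ i).
  move=> /(is_derive_along (g := fun y => Re (f y))) d1.
  have [+ _] := schwartz_derivable f [::] i (x + s *: d_ i).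
  move=> /(is_derive_along (g := fun y => Re (f y))) d2.
  have -> : (fun s => Re (u s)) = (fun s : R => Re (f (x + h *: d_ j + s *: d_ i))) -
      (fun s : R => Re (f (x + s *: d_ i))) - (h * Re z) *: id.
    apply/funext => t; rewrite /u !ReB ReRM [x + _ + _]addrAC.
    rewrite -[RHS]/(_ - _ - (h * Re z) * t); ring.
  apply: is_derive_eq; rewrite /du !ReB ReRM [x + h *: _ + _]addrAC.
  by rewrite -[X in _ - X]/(h * Re z * 1) mulr1.
have duI (s : R) : is_derive s 1 (fun s => Im (u s)) (Im (du s)).
  have [_ +] := schwartz_derivable f [::] i (x + h *: d_ j + s *: d_ i).
  move=> /(is_derive_along (g := fun y => Im (f y))) d1.
  have [_ +] := schwartz_derivable f [::] i (x + s *: d_ i).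
  move=> /(is_derive_along (g := fun y => Im (f y))) d2.
  have -> : (fun s => Im (u s)) = (fun s : R => Im (f (x + h *: d_ j + s *: d_ i))) -
      (fun s : R => Im (f (x + s *: d_ i))) - (h * Im z) *: id.
    apply/funext => t; rewrite /u !ImB ImRM [x + _ + _]addrAC.
    rewrite -[RHS]/(_ - _ - (h * Im z) * t); ring.
  apply: is_derive_eq; rewrite /du !ImB ImRM [x + h *: _ + _]addrAC.
  by rewrite -[X in _ - X]/(h * Im z * 1) mulr1.
have duC s : `|s| <= `|h| -> normc (du s) <= (C1 + C2) * `|h| ^+ 2.
  move=> sh; have -> : du s = (pderives [:: i] f (x + s *: d_ i + h *: d_ j) -
      pderives [:: i] f (x + s *: d_ i) - h%:C * pderives [:: j; i] f (x + s *: d_ i)) +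
      h%:C * (pderives [:: j; i] f (x + s *: d_ i) - z).
    by rewrite /du /=; ring.
  apply: le_trans (le_normcD _ _) _; rewrite mulrDl lerD//.
    by rewrite real_normK ?num_real.
  rewrite normcM normcR expr2 mulrCA ler_wpM2l//.
  by apply: le_trans (f2 _ _) _; rewrite ler_wpM2l.
have := clip1 duR duI duC.
rewrite /u scale0r addr0 mul0r mul0r subr0.
rewrite -mulrDl -mulrA -exprSr; apply: le_trans.
by rewrite le_eqVlt; apply/orP; left; apply/eqP; congr normc; rewrite expr2 /z; ring.
Qed.

(** Both orders give the same second difference, so h^2 times the difference of the mixed
    derivatives is O(h^3); divide by h^2 and let h tend to 0. *)
Lemma schwartz_clairaut f i j x :
  pderives [:: i; j] f x = pderives [:: j; i] f x.
Proof.
have [C C0 fC] := second_difference f i j x.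
have [D D0 fD] := second_difference f j i x.
apply/eqP; rewrite -subr_eq0; apply/eqP/eq0_normc/eqP.
set z := _ - _; rewrite eq_le normc_ge0 andbT; apply/ler_addgt0Pr => e e0.
rewrite add0r; have [h h0 he] : exists2 h, 0 < h & (C + D) * h <= e.
  exists (e / (C + D + 1)); first by rewrite divr_gt0// ltr_wpDl// addr_ge0.
  rewrite mulrA ler_pdivrMr ?ltr_wpDl ?addr_ge0// mulrC.
  by rewrite ler_pM2l// lerDl.
have : normc ((h ^+ 2)%:C * z) <= (C + D) * `|h| ^+ 3.
  have := lerD (fC h) (fD h); rewrite -mulrDl; apply: le_trans.
  rewrite [X in _ <= _ + X]normcBC; apply: le_trans (le_normcD _ _).
  have E (a b c d s p q : R[i]) :
      a - b - (c - d) - s * p + (s * q - (a - c - (b - d))) = s * (q - p) by ring.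
  by rewrite (addrAC x (h *: d_ j)) E.
rewrite normcM normcR (ger0_norm (ltW h0)) ger0_norm ?sqr_ge0//.
rewrite (_ : (C + D) * h ^+ 3 = h ^+ 2 * ((C + D) * h)); last by ring.
rewrite ler_pM2l; first by move=> /le_trans; apply.
by rewrite exprn_gt0.
Qed.

(** Moves the innermost derivative to the outside, where Taylor's formula in [restr_taylor] expects
    it. *)
Lemma schwartz_rot f i w x : pderives (i :: w) f x = pderives (rcons w i) f x.
Proof.
elim: w x => // j w IH x.
rewrite rcons_cons -[RHS]/(pderive j (pderives (rcons w i) f) x).
have <- : pderives (i :: w) f = pderives (rcons w i) f by apply/funext.
exact: (schwartz_clairaut (sderive w f)).
Qed.

End Fixed.
End SchwartzCalculus.

(** * Bornological vector spaces *)

Section Disks.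
Context {R : realType} {V : lmodType R[i]}.
Implicit Types (S T : set V) (x y : V).

Lemma disk_hull_id T : disk T -> disked_hull T `<=` T.
Proof. by move=> dT; apply: disked_hull_min. Qed.

Lemma lspan1 T x : T x -> lspan T x.
Proof.
by move=> Tx; exists 1%N, (fun=> 1), (fun=> x); split => //; rewrite big_ord1 scale1r.
Qed.

Lemma lspanD T x y : lspan T x -> lspan T y -> lspan T (x + y).
Proof.
have [[_ lD] _] := lspan_submod T.
by move=> /asboolP lx /asboolP ly; apply/asboolP; exact: lD.
Qed.

Lemma lspanZ T c x : lspan T x -> lspan T (c *: x).
Proof. by have [_ lZ] := lspan_submod T; move=> /asboolP lx; apply/asboolP; exact: lZ. Qed.

Lemma lspan0 T : lspan T 0.
Proof. by have [[l0 _] _] := lspan_submod T; apply/asboolP. Qed.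

Lemma lspan_sum T (I : Type) (r : seq I) (F : I -> V) :
  (forall i, lspan T (F i)) -> lspan T (\sum_(i <- r) F i).
Proof.
move=> lF; elim: r => [|i r IH]; first by rewrite big_nil; exact: lspan0.
by rewrite big_cons; exact: lspanD.
Qed.

Lemma diskN T x : disk T -> T x -> T (- x).
Proof.
move=> [_ cT _] Tx; rewrite -scaleN1r; apply: cT => //.
by rewrite normcN /normc /= expr1n expr0n addr0 sqrtr1.
Qed.

Lemma disk_scale T (c : R[i]) (e : R) x : disk T -> 0 < e -> normc c <= e -> T x ->
  exists2 y, T y & c *: x = e%:C *: y.
Proof.
move=> [_ cT _] e0 ce Tx; have e1 : e%:C != 0 :> R[i].
  by rewrite fmorph_eq0 gt_eqF.
exists ((e%:C)^-1 * c *: x).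
  apply: cT => //; rewrite -fmorphV normcM normcR ger0_norm ?invr_ge0 ?(ltW e0)//.
  by rewrite ler_pdivrMl ?mulr1.
by rewrite scalerA mulrA divff// mul1r.
Qed.

Lemma disk_sum T (I : Type) (r : seq I) (P : pred I) (c : I -> R) (z : I -> V) (s : R) :
  disk T -> (forall i, 0 <= c i) -> (forall i, T (z i)) -> \sum_(i <- r | P i) c i <= s ->
  exists2 y, T y & \sum_(i <- r | P i) (c i)%:C *: z i = s%:C *: y.
Proof.
move=> dT c0 Tz; suff [y Ty yE] : exists2 y, T y &
    \sum_(i <- r | P i) (c i)%:C *: z i = (\sum_(i <- r | P i) c i)%:C *: y.
  by move=> cs; rewrite yE; apply: diskZ => //; exact: sumr_ge0.
elim: r => [|i r [y Ty IH]].
  by case: dT => T0 _ _; exists 0; rewrite // !big_nil scaler0.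
rewrite !big_cons; case: ifP => _; last by exists y.
by rewrite IH; apply: diskD => //; exact: sumr_ge0.
Qed.

Lemma lspan_disk T x : disk T -> lspan T x ->
  exists2 r : R, 0 < r & exists2 y, T y & x = r%:C *: y.
Proof.
move=> dT /lspan_hull[r r0 [y /(disk_hull_id dT) Ty ->]].
exists (r + 1); first by rewrite ltr_wpDl.
by apply: diskZ => //; rewrite lerDl.
Qed.

Lemma gauge_lt T x e : disk T -> lspan T x -> gauge T x < e ->
  exists2 y, T y & x = e%:C *: y.
Proof.
move=> dT lx; have [r r0 [y Ty xE]] := lspan_disk dT lx.
move=> /inf_lt[|s [s0 [z Tz ->]] se]; last by apply: diskZ => //; exact: ltW.
by exists r; split=> //; exists y.
Qed.

Lemma gauge_le T x y e : 0 < e -> T y -> x = e%:C *: y -> gauge T x <= e.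
Proof.
move=> e0 Ty xE; apply: ge_inf; first by exists 0 => s [/ltW].
by split=> //; exists y.
Qed.

Lemma gauge_ge0 T x : 0 <= gauge T x.
Proof.
rewrite /gauge; set A := [set _ | _]; have [->|/set0P A0] := eqVneq A set0.
  by rewrite inf0.
by apply: lb_le_inf => // s [/ltW].
Qed.

End Disks.

Section LinearMaps.
Context {R : realType} {V W : lmodType R[i]}.
Variable l : V -> W.
Hypothesis ll : linear l.

Lemma linmap0 : l 0 = 0.
Proof. by have := ll (-1) 0 0; rewrite scaler0 addr0 scaleN1r addNr. Qed.
Lemma linmapZ c f : l (c *: f) = c *: l f.
Proof. by rewrite -[c *: f]addr0 ll linmap0 addr0. Qed.
Lemma linmapD f g : l (f + g) = l f + l g.
Proof. by have := ll 1 f g; rewrite !scale1r. Qed.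
Lemma linmapB f g : l (f - g) = l f - l g.
Proof. by rewrite linmapD -scaleN1r linmapZ scaleN1r. Qed.
Lemma linmap_sum (I : Type) (r : seq I) (F : I -> V) :
  l (\sum_(i <- r) F i) = \sum_(i <- r) l (F i).
Proof.
elim: r => [|i r IH]; first by rewrite !big_nil linmap0.
by rewrite !big_cons linmapD IH.
Qed.

End LinearMaps.

Section Bornologies.
Context {R : realType}.
Implicit Types X Y : bornType R.

(** The property that makes Mackey limits unique. It follows from completeness and is verified
    directly for the scalars. *)
Definition bseparated X := forall x : X,
  (exists2 T : set X, small T & forall e : R, 0 < e -> exists2 y, T y & x = e%:C *: y) ->
  x = 0.

Lemma complete_separated X : complete X -> bseparated X.
Proof.
move=> cX x [S sS xS]; have [T [sT ST [dT T0 _]]] := cX _ sS.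
apply: T0; first by have [y /ST Ty ->] := xS 1 ltr01; apply/lspanZ/lspan1.
apply/eqP; rewrite eq_le gauge_ge0 andbT; apply/ler_addgt0Pr => e e0.
by have [y /ST Ty xE] := xS _ e0; rewrite add0r (gauge_le e0 Ty xE).
Qed.

Lemma scalar_separated : bseparated (R[i]^o : bornType R).
Proof.
move=> z [T [M TM] zT]; apply: eq0_normc; apply/eqP; rewrite eq_le normc_ge0 andbT.
apply/ler_addgt0Pr => e e0; rewrite add0r.
have M0 : 0 <= M by have [y /TM yM _] := zT 1 ltr01; exact: le_trans (normc_ge0 _) yM.
have [|y /TM yM ->] := zT (e / (M + 1)); first by rewrite divr_gt0// ltr_wpDl.
rewrite -[_ *: _]/(_ * _) normcM normcR ger0_norm ?divr_ge0 ?addr_ge0 ?(ltW e0)//.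
rewrite mulrAC ler_pdivrMr ?ltr_wpDl// ler_wpM2l ?(ltW e0)//.
by rewrite (le_trans yM)// lerDl.
Qed.

Lemma bcvg_unique X (u : nat -> X) x y : bseparated X -> bcvg u x -> bcvg u y -> x = y.
Proof.
move=> sX [T [e [sT e0 ue]]] [T' [e' [sT' e'0 ue']]].
apply/eqP; rewrite -subr_eq0; apply/eqP/sX.
pose D := disked_hull (T `|` T'); have dD : disk D := disked_hullP _.
have sD : small D by apply: small_hull; exact: smallU.
exists [set a + b | a in D & b in D]; first exact: smallD.
move=> r r0; have : \forall n \near \oo, `|e n| <= r /\ `|e' n| <= r.
  near=> n; split; near: n.
    by move/cvgrPdist_le : e0 => /(_ _ r0); apply: filterS => n; rewrite sub0r normrN.
  by move/cvgrPdist_le : e'0 => /(_ _ r0); apply: filterS => n; rewrite sub0r normrN.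
move=> [N _ /(_ N (leqnn N))[eN e'N]].
have [a Ta aE] := ue N; have [b Tb bE] := ue' N.
have [||a' Da' aE'] := disk_scale (c := - (e N)%:C) dD r0 _ (_ : D a).
- by rewrite normcN normcR.
- by apply: sub_disked_hull; left.
have [||b' Db' bE'] := disk_scale (c := (e' N)%:C) dD r0 _ (_ : D b).
- by rewrite normcR.
- by apply: sub_disked_hull; right.
exists (a' + b'); first by exists a' => //; exists b'.
rewrite scalerDr -aE' -bE' -bE scaleNr -aE.
by rewrite opprB addrA subrK.
Unshelve. all: by end_near.
Qed.

Lemma bcvgI X (u : nat -> X) x : (exists2 T : set X, small T &
  forall N, exists2 y, T y & u N - x = (N.+1%:R^-1)%:C *: y) -> bcvg u x.
Proof.
move=> [T sT uT]; exists T, (fun N => N.+1%:R^-1); split=> //.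
exact: cvg_harmonic.
Qed.

Lemma bcvg_lin X Y (f : X -> Y) (u : nat -> X) x : linear f -> bounded_map f ->
  bcvg u x -> bcvg (f \o u) (f x).
Proof.
move=> lf bf [T [e [sT e0 ue]]]; exists (f @` T), e; split=> //; first exact: bf.
move=> n; have [y Ty uE] := ue n; exists (f y); first by exists y.
by rewrite -linmapB// uE linmapZ.
Qed.

(** The same [T] serves every sequence with this Cauchy rate; boundedness of limits in all
    parameters at once rests on it. *)
Lemma complete_limit X (S : set X) : complete X -> small S ->
  exists2 T : set X, small T & forall u : nat -> X,
    (forall N M, (N <= M)%N -> exists2 y, S y & u M - u N = (N.+1%:R^-1)%:C *: y) ->
    exists x, forall N, exists2 y, T y & u N - x = (N.+1%:R^-1)%:C *: y.
Proof.
move=> cX /cX[T [sT ST [dT T0 Tc]]]; exists [set a + b | a in T & b in T].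
  exact: smallD.
move=> u uS; have p0 N : 0 < N.+1%:R^-1 :> R by rewrite invr_gt0.
have uT N M K : (K <= N)%N -> (K <= M)%N ->
    exists2 y, T y & u M - u N = (K.+1%:R^-1)%:C *: y.
  have le1 a b : (a <= b)%N -> b.+1%:R^-1 <= a.+1%:R^-1 :> R.
    by move=> ab; rewrite lef_pV2 ?posrE// ler_nat.
  move=> KN KM; case: (leqP N M) => [/uS[y /ST Ty ->]|/ltnW /uS[y /ST Ty E]].
    by apply: diskZ => //; exact: le1.
  rewrite -opprB E -scalerN; apply: diskZ; rewrite ?le1// ?ltW//.
  exact: diskN.
(* Only the differences [u n - u 0] are known to lie in the span of [T]; [u 0] is added back to the
   limit. *)
have [|e e0|x lx xE] := Tc (fun n => u n - u 0%N).
- by move=> n; have [y Ty ->] := uT 0%N n 0%N (leqnn _) (leq0n _); apply/lspanZ/lspan1.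
- have /cvgrPdist_lt/(_ _ e0)[N _ Ne] := @cvg_harmonic R.
  exists N => m n Nm Nn; rewrite opprB addrA subrK.
  have [y Ty E] := uT n m N Nn Nm.
  apply: le_lt_trans (gauge_le (p0 N) Ty E) _.
  apply: le_lt_trans (ler_norm _) _.
  by have := Ne N (leqnn N); rewrite sub0r normrN; exact.
exists (u 0%N + x) => N.
move/cvgrPdist_lt : (xE) => /(_ _ (p0 N))[M _ MN].
(* The estimate passes through a far term [u K]: one element of [T] for [u N - u K], another for
   [u K] minus the limit, hence the sumset T + T. *)
pose K := maxn M N; have [a Ta aE] := uT K N N (leq_maxr _ _) (leqnn _).
have [||b Tb bE] := @gauge_lt _ _ T (u K - u 0%N - x) N.+1%:R^-1 dT.
- apply: lspanD; last by rewrite -scaleN1r; exact: lspanZ.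
  by have [y Ty ->] := uT 0%N K 0%N (leqnn _) (leq0n _); apply/lspanZ/lspan1.
- by have := MN K (leq_maxl _ _); rewrite sub0r normrN ger0_norm// gauge_ge0.
exists (a + b); first by exists a => //; exists b.
by rewrite scalerDr -aE -bE opprD !addrA subrK.
Qed.

Lemma bounded_bilinear_flip X Y (Z : bornType R) (b : X -> Y -> Z) :
  bounded_bilinear b -> bounded_bilinear (fun y x => b x y).
Proof.
move=> [b1 b2 b3]; split=> // A B sA sB; apply: smallS (b3 _ _ sB sA).
by move=> _ [x Ax [y By <-]]; exists y => //; exists x.
Qed.

End Bornologies.

(** * Completeness, linear substitutions and slices of Schwartz functions *)

Section SchwartzLimits.
Context {R : realType}.

Definition ctends (z : nat -> R[i]) (l : R[i]) :=
  forall e : R, 0 < e -> exists N, forall j, (N <= j)%N -> normc (z j - l) <= e.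

Lemma ctends_le z l C : ctends z l -> (exists N, forall j, (N <= j)%N -> normc (z j) <= C) ->
  normc l <= C.
Proof.
move=> zl [M zC]; apply/ler_addgt0Pr => e e0; have [N Ne] := zl _ e0.
pose K := maxn M N; rewrite -[l](subrK (z K)) addrC.
apply: le_trans (le_normcD _ _) _; apply: lerD; first by apply: zC; exact: leq_maxl.
by rewrite normcBC; apply: Ne; exact: leq_maxr.
Qed.

Lemma ctendsD z l z' l' : ctends z l -> ctends z' l' ->
  ctends (fun j => z j + z' j) (l + l').
Proof.
move=> zl zl' e e0; have e2 : 0 < e / 2 by rewrite divr_gt0.
have [N Ne] := zl _ e2; have [N' Ne'] := zl' _ e2.
exists (maxn N N') => j; rewrite geq_max => /andP[/Ne zj /Ne' z'j].
rewrite opprD addrACA (le_trans (le_normcD _ _))// (le_trans (lerD zj z'j))//.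
by rewrite -splitr.
Qed.

Lemma ctendsM c z l : ctends z l -> ctends (fun j => c * z j) (c * l).
Proof.
move=> zl e e0; have c0 : 0 < normc c + 1 by rewrite ltr_wpDl// normc_ge0.
have [|N Ne] := zl (e / (normc c + 1)); first by rewrite divr_gt0.
exists N => j /Ne zj; rewrite -mulrBr normcM.
apply: (@le_trans _ _ ((normc c + 1) * (e / (normc c + 1)))).
  by rewrite ler_pM// ?normc_ge0// lerDl.
by rewrite mulrCA divff ?mulr1// gt_eqF.
Qed.

Lemma ccauchy (z : nat -> R[i]) :
  (forall e : R, 0 < e -> exists N, forall j k, (N <= j)%N -> (N <= k)%N ->
    normc (z j - z k) <= e) -> exists l, ctends z l.
Proof.
move=> zc.
have aux (u : nat -> R) : (forall j k, `|u j - u k| <= normc (z j - z k)) ->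
    exists l : R, forall e : R, 0 < e -> exists N, forall j, (N <= j)%N -> `|u j - l| <= e.
  move=> uz; have cu : cvg (u @ \oo).
    apply/cauchy_cvgP/cauchy_exP => e e0; have e2 : 0 < e / 2 by rewrite divr_gt0.
    have [N Ne] := zc _ e2; exists (u N); exists N => // j Nj.
    apply: le_lt_trans (uz _ _) _; apply: le_lt_trans (Ne _ _ (leqnn N) Nj) _.
    by rewrite ltr_pdivrMr// mulr_natr mulr2n ltrDl.
  exists (lim (u @ \oo)) => e e0; move/cvgrPdist_le : cu => /(_ _ e0)[N _ Ne].
  by exists N => j Nj; rewrite distrC; exact: Ne.
have [|a ua] := aux (fun j => Re (z j)).
  by move=> j k; rewrite -ReB; exact: normc_Re.
have [|b ub] := aux (fun j => Im (z j)).
  by move=> j k; rewrite -ImB; exact: normc_Im.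
exists (a +i* b) => e e0; have e2 : 0 < e / 2 by rewrite divr_gt0.
have [N Ne] := ua _ e2; have [N' Ne'] := ub _ e2.
exists (maxn N N') => j; rewrite geq_max => /andP[/Ne aj /Ne' bj].
apply: le_trans (normc_ReIm _) _; rewrite ReB ImB /=.
by rewrite [X in _ <= X]splitr lerD.
Qed.

Section Fixed.
Variable n : nat.
Implicit Types (f g : schwartz R n) (x : 'rV[R]_n).
Local Notation d_ i := (delta_mx 0 i : 'rV[R]_n).

Lemma schwartzDE f g x : (f + g) x = f x + g x. Proof. by []. Qed.
Lemma schwartzZE c f x : (c *: f) x = c * f x. Proof. by []. Qed.
Lemma schwartz0E x : (0 : schwartz R n) x = 0. Proof. by []. Qed.
Lemma schwartzNE f x : (- f) x = - f x. Proof. by []. Qed.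
Lemma schwartzBE f g x : (f - g) x = f x - g x. Proof. by []. Qed.
Lemma schwartz_sumE (I : Type) (r : seq I) (P : pred I) (F : I -> schwartz R n) x :
  (\sum_(i <- r | P i) F i) x = \sum_(i <- r | P i) F i x.
Proof.
elim: r => [|i r IH]; first by rewrite !big_nil.
by rewrite !big_cons; case: ifP => _; rewrite ?schwartzDE IH.
Qed.

Lemma pderivesB w f g x : pderives w (f - g) x = pderives w f x - pderives w g x.
Proof. by rewrite addrC -scaleN1r pderives_linear mulN1r addrC. Qed.
Lemma pderives_scale w c f x : pderives w (c *: f) x = c * pderives w f x.
Proof.
rewrite -[c *: f]addr0 pderives_linear.
by rewrite (_ : pderives w (0 : schwartz R n) x = 0) ?addr0// pderives0.
Qed.

(** Explicit small sets, cofinal by [small_bounded_by]; with nonnegative bounds they are the Banach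
    disks of the space. *)
Definition bounded_by (a : nat -> seq 'I_n -> R) : set (schwartz R n) :=
  [set f | forall k w x, normc (pderives w f x) * (1 + enorm x) ^+ k <= a k w].

Lemma bounded_by_small a : small (bounded_by a).
Proof. by apply/schwartz_smallP; exists a => k w f x; exact. Qed.

Lemma bounded_by_disk a : (forall k w, 0 <= a k w) -> disk (bounded_by a).
Proof.
move=> a0; split=> [k w x|c f c1 fa k w x|t f g /andP[t0 t1] fa ga k w x].
- by rewrite (_ : pderives w _ x = 0) ?normc0 ?mul0r// pderives0.
- rewrite pderives_scale normcM -mulrA (le_trans _ (fa k w x))// ler_piMl//.
  by rewrite mulr_ge0 ?normc_ge0 ?weight_ge0.
- rewrite pderives_linear pderives_scale.
  apply: le_trans (ler_wpM2r (weight_ge0 k x) (le_normcD _ _)) _.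
  rewrite mulrDl !normcM !normcR !ger0_norm ?subr_ge0// -!mulrA.
  have -> : a k w = t * a k w + (1 - t) * a k w by ring.
  by rewrite lerD// ler_wpM2l// subr_ge0.
Qed.

Lemma small_bounded_by (A : set (schwartz R n)) : small A ->
  exists2 a, forall k w, 0 <= a k w & A `<=` bounded_by a.
Proof.
move=> /schwartz_smallP[a Aa]; exists (fun k w => Num.max 0 (a k w)).
  by move=> k w; rewrite le_max lexx.
by move=> f Af k w x; rewrite le_max (Aa k w f x Af) orbT.
Qed.

(** Weighted bounds and Taylor bounds are closed conditions, so pointwise convergence of every
    derivative along a bounded sequence is enough. *)
Lemma schwartz_limit (u : nat -> schwartz R n) a (G : seq 'I_n -> 'rV[R]_n -> R[i]) :
  (forall j, bounded_by a (u j)) -> (forall w x, ctends (fun j => pderives w (u j) x) (G w x)) ->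
  exists F : schwartz R n, forall w x, pderives w F x = G w x.
Proof.
move=> ua uG.
apply: (schwartz_family (c := fun w i => a 0%N (i :: i :: w) + a 0%N (i :: i :: w))).
  move=> k w; exists (a k w) => x; rewrite -[(1 + _) ^+ _]ger0_norm ?weight_ge0//.
  rewrite -normcR -normcM mulrC; apply: ctends_le (ctendsM _ (uG w x)) _.
  exists 0%N => j _; rewrite normcM normcR ger0_norm ?weight_ge0// mulrC.
  exact: ua.
move=> w i x h; apply: (ctends_le (z := fun j => pderives w (u j) (x + h *: d_ i) +
   ((-1) * pderives w (u j) x + (- h%:C) * pderives (i :: w) (u j) x))).
  rewrite -addrA -[- G w x]mulN1r -mulNr.
  by apply: ctendsD; [exact: uG|apply: ctendsD; apply: ctendsM; exact: uG].
exists 0%N => j _; rewrite mulN1r mulNr addrA.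
apply: schwartz_taylor => s.
by have := ua j 0%N (i :: i :: w) (x + s *: d_ i); rewrite expr0 mulr1.
Qed.

Theorem schwartz_complete : complete (schwartz R n).
Proof.
move=> S /small_bounded_by[a a0 Sa]; exists (bounded_by a).
have dT := bounded_by_disk a0.
(* [scale] and [unscale] translate between lying in e times the disk and having all seminorms at
   most [e * a k w]. *)
have scale (e : R) f k w x : 0 <= e -> (exists2 g, bounded_by a g & f = e%:C *: g) ->
    normc (pderives w f x) * (1 + enorm x) ^+ k <= e * a k w.
  move=> e0 [g ag ->]; rewrite pderives_scale normcM normcR ger0_norm// -mulrA.
  by rewrite ler_wpM2l.
have unscale (e : R) f : 0 < e ->
    (forall k w x, normc (pderives w f x) * (1 + enorm x) ^+ k <= e * a k w) ->
    exists2 g, bounded_by a g & f = e%:C *: g.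
  move=> e0 fe; exists ((e^-1)%:C *: f).
    move=> k w x; rewrite pderives_scale normcM normcR ger0_norm ?invr_ge0 ?(ltW e0)//.
    by rewrite -mulrA ler_pdivrMl.
  by rewrite scalerA -rmorphM divff ?gt_eqF// scale1r.
split=> //; [exact: bounded_by_small|split=> //].
  move=> f lf f0; apply: schwartz_eq => x; apply: eq0_normc; apply/eqP.
  rewrite eq_le normc_ge0 andbT; apply/ler_addgt0Pr => e e0; rewrite add0r.
  have [||g ag fE] := @gauge_lt _ _ (bounded_by a) f (e / (a 0%N [::] + 1)) dT => //.
    by rewrite f0 divr_gt0// ltr_wpDl.
  have e'0 : 0 <= e / (a 0%N [::] + 1) by rewrite divr_ge0 ?addr_ge0 ?(ltW e0).
  have := @scale (e / (a 0%N [::] + 1)) f 0%N [::] x e'0 (ex_intro2 _ _ g ag fE).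
  rewrite expr0 mulr1 => /le_trans; apply.
  rewrite mulrAC ler_pdivrMr ?ltr_wpDl// ler_wpM2l ?(ltW e0)//.
  by rewrite lerDl.
move=> u lu uc.
have uce (e : R) : 0 < e -> exists N, forall m m', (N <= m)%N -> (N <= m')%N ->
    forall k w x, normc (pderives w (u m - u m') x) * (1 + enorm x) ^+ k <= e * a k w.
  move=> e0; have [N Ne] := uc _ e0; exists N => m m' Nm Nm' k w x.
  apply: scale; first exact: ltW.
  apply: gauge_lt => //; last exact: Ne.
  by apply: lspanD => //; rewrite -scaleN1r; exact: lspanZ.
have uG w x : exists l, ctends (fun j => pderives w (u j) x) l.
  apply: ccauchy => e e0.
  have [|N Ne] := uce (e / (a 0%N w + 1)); first by rewrite divr_gt0// ltr_wpDl.
  exists N => j k Nj Nk; rewrite -pderivesB.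
  have := Ne j k Nj Nk 0%N w x; rewrite expr0 mulr1 => /le_trans; apply.
  rewrite mulrAC ler_pdivrMr ?ltr_wpDl// ler_wpM2l ?(ltW e0)//.
  by rewrite lerDl.
pose G w x := sval (cid (uG w x)).
have GP w x : ctends (fun j => pderives w (u j) x) (G w x).
  by rewrite /G; case: cid.
have [N0 uN0] := uce 1 ltr01.
have [r r0 [g ag uN0E]] := lspan_disk dT (lu N0).
(* The constant r comes from [u N0], the 1 from the Cauchy estimate beyond [N0]. *)
have ub j : bounded_by (fun k w => (r + 1) * a k w) (u (N0 + j)%N).
  move=> k w x; rewrite -[u (N0 + j)%N](subrK (u N0)) -[X in X + _]scale1r.
  rewrite pderives_linear mul1r.
  apply: le_trans (ler_wpM2r (weight_ge0 k x) (le_normcD _ _)) _.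
  rewrite mulrDl addrC [(r + 1) * _]mulrDl lerD//.
    by apply: scale; [exact: ltW|exists g].
  by apply: uN0; rewrite ?leq_addr.
have [|F FG] := @schwartz_limit (fun j => u (N0 + j)%N) _ G ub.
  move=> w x e e0; have [N Ne] := GP w x e e0; exists N => j Nj.
  by apply: Ne; exact: leq_trans (leq_addl _ _).
(* The Cauchy estimate for [u m - u j] is kept in the pointwise limit over j. *)
have uF (e : R) : 0 < e -> exists N, forall m, (N <= m)%N ->
    forall k w x, normc (pderives w (u m - F) x) * (1 + enorm x) ^+ k <= e * a k w.
  move=> e0; have [N Ne] := uce _ e0; exists N => m Nm k w x.
  rewrite -[(1 + _) ^+ _]ger0_norm ?weight_ge0// -normcR -normcM mulrC.
  apply: (ctends_le (z := fun j => ((1 + enorm x) ^+ k)%:C * (pderives w (u m) x +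
    (-1) * pderives w (u j) x))).
    rewrite pderivesB FG -[- G w x]mulN1r.
    apply/ctendsM/ctendsD; last exact/ctendsM/GP.
    by move=> d d0; exists 0%N => j _; rewrite subrr normc0 ltW.
  exists N => j Nj; rewrite mulN1r -pderivesB normcM normcR ger0_norm ?weight_ge0//.
  by rewrite mulrC; exact: Ne.
exists F.
  have [N uN] := uF 1 ltr01; rewrite -[F](subrK (u N)); apply: lspanD => //.
  have [g' ag' E] := unscale _ _ ltr01 (uN N (leqnn _)).
  by rewrite -opprB E -scaleN1r; apply/lspanZ/lspanZ/lspan1.
apply/cvgrPdist_le => e e0; have [N uN] := uF _ e0; exists N => // m /= Nm.
rewrite sub0r normrN ger0_norm ?gauge_ge0//.
by have [g' ag' E] := unscale _ _ e0 (uN m Nm); exact: (gauge_le e0 ag' E).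
Qed.

End Fixed.
End SchwartzLimits.

(** * Composition with proper affine maps *)

Section Substitutions.
Context {R : realType}.

Section Directional.
Variable n : nat.
Implicit Types (f g : schwartz R n) (x v : 'rV[R]_n).
Local Notation d_ i := (delta_mx 0 i : 'rV[R]_n).

Definition sdir v f : schwartz R n := \sum_i (v 0 i)%:C *: sderive [:: i] f.

Lemma sdirE v f x : sdir v f x = \sum_i (v 0 i)%:C * pderives [:: i] f x.
Proof. by rewrite schwartz_sumE. Qed.

Lemma sderive_linear w : linear (@sderive R n w).
Proof. by have /asboolP[l _] := @sderive_bhom R n w. Qed.

Lemma sderive_bounded w : bounded_map (@sderive R n w).
Proof. by have /asboolP[_ b] := @sderive_bhom R n w. Qed.

Lemma small_sum (I : Type) (r : seq I) (X : bornType R) (F : I -> set X) :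
  (forall i, small (F i)) ->
  small [set x | exists2 z : I -> X, forall i, F i (z i) & x = \sum_(i <- r) z i].
Proof.
move=> sF; elim: r => [|i r IH].
  by apply: smallS (small1 0) => _ [z _ ->]; rewrite big_nil.
apply: smallS (smallD (sF i) IH) => _ [z Fz ->].
rewrite big_cons; exists (z i); first exact: Fz.
by exists (\sum_(j <- r) z j) => //; exists z.
Qed.

Lemma sdir_bounded v : bounded_map (sdir v).
Proof.
move=> A sA.
apply: smallS (small_sum (index_enum 'I_n) (fun i => smallZ (v 0 i)%:C
  (sderive_bounded [:: i] sA))).
move=> _ [f Af <-]; exists (fun i => (v 0 i)%:C *: sderive [:: i] f) => // i.
by exists (sderive [:: i] f) => //; exists f.
Qed.

(** Coordinates of [v] are added one at a time. Each addition displaces the point at which the other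
    first-order terms are evaluated; Lipschitz bounds of the first derivatives make this error
    O(h^2). *)
Lemma sdir_taylor f v : exists2 C : R, 0 <= C & forall x (h : R),
  normc (f (x + h *: v) - f x - h%:C * sdir v f x) <= C * h ^+ 2.
Proof.
suff aux (r : seq 'I_n) : exists2 C : R, 0 <= C & forall x (h : R),
    normc (f (x + h *: (\sum_(i <- r) v 0 i *: d_ i)) - f x -
      h%:C * (\sum_(i <- r) (v 0 i)%:C * pderives [:: i] f x)) <= C * h ^+ 2.
  have [C C0 fC] := aux (index_enum 'I_n); exists C => // x h.
  by rewrite sdirE {1}(row_sum_delta v); exact: fC.
elim: r => [|j r [C C0 fC]].
  exists 0 => // x h; rewrite !big_nil scaler0 addr0 subrr mulr0 subr0 normc0.
  by rewrite mul0r.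
have [Ct Ct0 ft] := schwartz_taylor_le f [::] j.
have Cl i := schwartz_lip f [:: i] j.
pose D i := s2val (cid2 (Cl i)).
have D0 i : 0 <= D i by rewrite /D; case: cid2.
have DP i x (h : R) : normc (pderives [:: i] f (x + h *: d_ j) - pderives [:: i] f x) <=
    D i * `|h| by rewrite /D; case: cid2.
exists (C + Ct * (v 0 j) ^+ 2 + \sum_(i <- r) `|v 0 i| * D i * `|v 0 j|) => [|x h].
  apply: addr_ge0; first by apply: addr_ge0 => //; rewrite mulr_ge0// sqr_ge0.
  apply: sumr_ge0 => i _.
  by rewrite !mulr_ge0.
rewrite !big_cons scalerDr addrA; set y := x + h *: (v 0 j *: d_ j).
set s := \sum_(i <- r) _ *: _.
have -> : f (y + h *: s) - f x - h%:C * ((v 0 j)%:C * pderives [:: j] f x +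
      \sum_(i <- r) (v 0 i)%:C * pderives [:: i] f x) =
    (f (y + h *: s) - f y - h%:C * \sum_(i <- r) (v 0 i)%:C * pderives [:: i] f y) +
    (f y - f x - (h * v 0 j)%:C * pderives [:: j] f x) +
    h%:C * \sum_(i <- r) (v 0 i)%:C * (pderives [:: i] f y - pderives [:: i] f x).
  under [X in _ = _ + _ * X]eq_bigr do rewrite mulrBr.
  rewrite sumrB rmorphM; ring.
rewrite mulrDl mulrDl; apply: le_trans (le_normcD _ _) _; apply: lerD.
  apply: le_trans (le_normcD _ _) _; apply: lerD; first exact: fC.
  by rewrite /y scalerA -mulrA -exprMn [v 0 j * h]mulrC; exact: ft.
rewrite normcM normcR -(real_normK (num_real h)) expr2 mulrCA ler_wpM2l//.
apply: le_trans (normc_sum _ _) _; rewrite mulr_suml; apply: ler_sum => i _.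
rewrite normcM normcR -!mulrA ler_wpM2l// /y scalerA (le_trans (DP _ _ _))//.
by rewrite normrM [`|h| * _]mulrC.
Qed.

End Directional.

Section Composition.
Variables p q : nat.
Implicit Types (f : schwartz R q) (T : 'rV[R]_p -> 'rV[R]_q) (v : 'I_p -> 'rV[R]_q).

(** [v] lists the images of the basis vectors under the linear part; the bound with [K] keeps decay
    under composition. One pair (v, K) can serve a family, such as the maps y |-> (x, y) for all
    x. *)
Definition proper_affine v (K : R) T :=
  (forall x i (h : R), T (x + h *: delta_mx 0 i) = T x + h *: v i) /\
  (forall x, 1 + enorm x <= K * (1 + enorm (T x))).

(** Chosen with default 0; [compose_derivatives] shows that the composite exists in the Schwartz
    space when [T] is proper affine. *)
Definition compose T f : schwartz R p := xget 0 [set F : schwartz R p | forall x, F x = f (T x)].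

Definition word_dir v (w : seq 'I_p) f := foldr (fun i => sdir (v i)) f w.

Lemma word_dir_small v w A : small A -> small (word_dir v w @` A).
Proof.
move=> sA; elim: w => [|i w IH]; first by rewrite image_id.
apply: smallS (sdir_bounded (v i) IH) => _ [f Af <-].
by exists (word_dir v w f) => //; exists f.
Qed.

Lemma proper_affine_ge0 v K T : proper_affine v K T -> 0 <= K.
Proof.
move=> [_ /(_ 0)] TK; have t0 : 0 < 1 + enorm (T 0) by rewrite ltr_wpDr// enorm_ge0.
rewrite -(pmulr_lge0 _ t0); apply: le_trans TK.
by rewrite addr_ge0 ?enorm_ge0.
Qed.

Lemma proper_affine_weight v K T k x : proper_affine v K T ->
  (1 + enorm x) ^+ k <= K ^+ k * (1 + enorm (T x)) ^+ k.
Proof.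
move=> TA; have K0 := proper_affine_ge0 TA; have [_ TK] := TA.
by rewrite -exprMn lerXn2r ?nnegrE ?mulr_ge0 ?addr_ge0 ?enorm_ge0.
Qed.

(** The chain rule is the expansion of [word_dir v w f] in the direction [v i], read at T x. *)
Lemma compose_derivatives v K T f : proper_affine v K T ->
  forall w x, pderives w (compose T f) x = word_dir v w f (T x).
Proof.
move=> TA; have K0 := proper_affine_ge0 TA; have [TE _] := TA.
have Cw w i := sdir_taylor (word_dir v w f) (v i).
have [||F FE] := @schwartz_family R p (fun w x => word_dir v w f (T x))
    (fun w i => s2val (cid2 (Cw w i))).
- move=> k w; have [M fM] := schwartz_bound (word_dir v w f) k [::].
  exists (M * K ^+ k) => x; apply: (@le_trans _ _ (normc (word_dir v w f (T x)) *
    (K ^+ k * (1 + enorm (T x)) ^+ k))).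
    by rewrite ler_wpM2l ?normc_ge0//; exact: (proper_affine_weight k x TA).
  by rewrite mulrCA mulrC ler_wpM2r ?exprn_ge0//; exact: fM.
- by move=> w i x h; rewrite TE; case: cid2 => C C0 /= /(_ (T x) h).
have {}FE0 : forall x, F x = f (T x) by move=> x; exact: (FE [::]).
suff -> : compose T f = F by [].
have := @xgetPex _ (0 : schwartz R p) [set F : schwartz R p | forall x, F x = f (T x)].
move=> /(_ (ex_intro _ F FE0)) GE.
by apply: schwartz_eq => x; rewrite FE0; exact: GE.
Qed.

Lemma composeE v K T f x : proper_affine v K T -> compose T f x = f (T x).
Proof. by move=> TA; exact: (compose_derivatives f TA [::]). Qed.

Lemma compose_bound v K (A : set (schwartz R q)) : 0 <= K -> small A -> exists2 a : nat -> seq 'I_p -> R,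
  (forall k w, 0 <= a k w) &
  forall T, proper_affine v K T -> forall f, A f -> forall k w x,
    normc (pderives w (compose T f) x) * (1 + enorm (T x)) ^+ k <= a k w.
Proof.
move=> K0 sA.
have aw w := cid2 (small_bounded_by (word_dir_small v w sA)).
exists (fun k w => s2val (aw w) k [::]).
  by move=> k w; case: (aw w).
move=> T TA f Af k w x; rewrite (compose_derivatives f TA).
case: (aw w) => a /= a0 Aa; apply: (Aa _ _ k [::] (T x)); by exists f.
Qed.

Lemma compose_small v K (A : set (schwartz R q)) : 0 <= K -> small A ->
  small [set compose T f | T in proper_affine v K & f in A].
Proof.
move=> K0 sA; have [a a0 Aa] := compose_bound v K0 sA.
apply/schwartz_smallP; exists (fun k w => K ^+ k * a k w).
move=> k w _ x [T TA [f Af <-]].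
apply: (@le_trans _ _ (normc (pderives w (compose T f) x) *
    (K ^+ k * (1 + enorm (T x)) ^+ k))).
  by rewrite ler_wpM2l ?normc_ge0//; exact: (proper_affine_weight k x TA).
by rewrite mulrCA ler_wpM2l ?exprn_ge0//; exact: Aa.
Qed.

Lemma compose_bhom v K T : proper_affine v K T -> is_bhom (compose T).
Proof.
move=> TA; apply/asboolP; split=> [a f g|A sA].
  apply: schwartz_eq => x; rewrite (composeE _ _ TA).
  by rewrite -[RHS]/(a * compose T f x + compose T g x) !(composeE _ _ TA).
apply: smallS (compose_small v (proper_affine_ge0 TA) sA) => _ [f Af <-].
by exists T => //; exists f.
Qed.

End Composition.

Lemma enorm_le_sum n (x : 'rV[R]_n) : enorm x <= \sum_i `|x 0 i|.
Proof.
rewrite -[X in _ <= X]ger0_norm ?sumr_ge0// -sqrtr_sqr ler_wsqrtr//.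
elim: (index_enum _) => [|i r IH]; first by rewrite !big_nil expr0n.
rewrite !big_cons sqrrD real_normK ?num_real// addrAC -addrA lerD2l.
rewrite (le_trans IH)// lerDl mulrn_wge0// mulr_ge0//.
exact: sumr_ge0.
Qed.

Lemma enorm_coord n (x : 'rV[R]_n) i : `|x 0 i| <= enorm x.
Proof.
rewrite -sqrtr_sqr ler_wsqrtr// (bigD1 i)//= lerDl sumr_ge0// => j _.
exact: sqr_ge0.
Qed.

Lemma linear_proper p q (L : 'rV[R]_p -> 'rV[R]_q) (M : 'rV[R]_q -> 'rV[R]_p) :
  linear L -> linear M -> cancel L M ->
  exists2 K : R, 0 <= K & proper_affine (fun i => L (delta_mx 0 i)) K L.
Proof.
move=> lL lM LM.
pose Mf : {linear 'rV[R]_q -> 'rV[R]_p} := HB.pack M (GRing.isLinear.Build _ _ _ _ M lM).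
(* The sum of the absolute values of the matrix entries of [M], hence a Lipschitz constant for
   [M]. *)
pose D := \sum_i \sum_j `|M (delta_mx 0 j) 0 i|.
have D0 : 0 <= D by apply: sumr_ge0 => i _; exact: sumr_ge0.
exists (1 + D); first exact: addr_ge0.
split=> [x i h|x]; first by rewrite addrC lL addrC.
suff xL : enorm x <= D * enorm (L x) by have := enorm_ge0 (L x); move: xL D0; nra.
rewrite -{1}(LM x); apply: le_trans (enorm_le_sum _) _.
rewrite /D mulr_suml; apply: ler_sum => i _.
rewrite [L x]row_sum_delta -[M _]/(Mf _) linear_sum summxE.
apply: le_trans (ler_norm_sum _ _ _) _; rewrite mulr_suml; apply: ler_sum => j _.
rewrite linearZ mxE normrM mulrC ler_wpM2l//.
by rewrite -row_sum_delta enorm_coord.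
Qed.

End Substitutions.

(** * Slices: a functional applied in the second group of variables *)

Section Slices.
Context {R : realType}.

Lemma sdir_delta n (i : 'I_n) : sdir (delta_mx 0 i) =1 (sderive [:: i] : schwartz R n -> _).
Proof.
move=> f; apply: schwartz_eq => x; rewrite sdirE (bigD1 i)//= big1.
  by rewrite !mxE !eqxx mul1r addr0.
by move=> j ji; rewrite !mxE (negbTE ji) andbF mul0r.
Qed.

Lemma word_dir_delta p q (s : 'I_p -> 'I_q) w (f : schwartz R q) :
  word_dir (fun i => delta_mx 0 (s i)) w f = sderive (map s w) f.
Proof.
elim: w => [|i w IH]; first exact: schwartz_eq.
by rewrite /word_dir/= -/(word_dir _ w f) IH sdir_delta; exact: schwartz_eq.
Qed.

Lemma enorm_row m n (x : 'rV[R]_m) (y : 'rV[R]_n) :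
  enorm (row_mx x y) = Num.sqrt (enorm x ^+ 2 + enorm y ^+ 2).
Proof.
rewrite /enorm big_split_ord/= !sqr_sqrtr ?sumr_ge0//; try by move=> i _; rewrite sqr_ge0.
by congr (Num.sqrt (_ + _)); apply: eq_bigr => i _; rewrite ?row_mxEl ?row_mxEr.
Qed.

Lemma enorm_rowl m n (x : 'rV[R]_m) (y : 'rV[R]_n) : enorm x <= enorm (row_mx x y).
Proof.
rewrite enorm_row -[X in X <= _]ger0_norm ?enorm_ge0// -sqrtr_sqr ler_wsqrtr//.
by rewrite lerDl sqr_ge0.
Qed.

Lemma enorm_rowr m n (x : 'rV[R]_m) (y : 'rV[R]_n) : enorm y <= enorm (row_mx x y).
Proof.
rewrite enorm_row -[X in X <= _]ger0_norm ?enorm_ge0// -sqrtr_sqr ler_wsqrtr//.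
by rewrite lerDr sqr_ge0.
Qed.

Lemma weight_rowl m n k (x : 'rV[R]_m) (y : 'rV[R]_n) :
  (1 + enorm x) ^+ k <= (1 + enorm (row_mx x y)) ^+ k.
Proof. by rewrite lerXn2r ?nnegrE ?addr_ge0 ?enorm_ge0// lerD2l enorm_rowl. Qed.

Lemma weight_rowr m n k (x : 'rV[R]_m) (y : 'rV[R]_n) :
  (1 + enorm y) ^+ k <= (1 + enorm (row_mx x y)) ^+ k.
Proof. by rewrite lerXn2r ?nnegrE ?addr_ge0 ?enorm_ge0// lerD2l enorm_rowr. Qed.

Section LinearFunctional.
Variables (V : lmodType R[i]) (l : V -> R[i]^o).
Hypothesis ll : linear l.

Lemma functionalZ c f : l (c *: f) = c * l f. Proof. exact: linmapZ. Qed.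
Lemma functionalD f g : l (f + g) = l f + l g. Proof. exact: linmapD. Qed.
Lemma functionalB f g : l (f - g) = l f - l g. Proof. exact: linmapB. Qed.
Lemma functional_sum (I : Type) (r : seq I) (F : I -> V) :
  l (\sum_(i <- r) F i) = \sum_(i <- r) l (F i).
Proof. exact: linmap_sum. Qed.

End LinearFunctional.

Section Fixed.
Variables m n : nat.
Implicit Types (F : schwartz R (m + n)) (x : 'rV[R]_m) (y : 'rV[R]_n).

Definition restr x F : schwartz R n := compose (fun y => row_mx x y) F.

Lemma row_mx_shiftl x y (h : R) i : row_mx (x + h *: delta_mx 0 i) y =
  row_mx x y + h *: delta_mx 0 (lshift n i).
Proof.
by rewrite delta_mx_lshift scale_row_mx add_row_mx scaler0 addr0.
Qed.

Lemma restr_proper x :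
  proper_affine (fun i => delta_mx 0 (rshift m i)) 1 (fun y => row_mx x y).
Proof.
split=> [y i h|y]; last by rewrite mul1r lerD2l enorm_rowr.
by rewrite delta_mx_rshift scale_row_mx add_row_mx scaler0 addr0.
Qed.

Lemma restrE x F y : restr x F y = F (row_mx x y).
Proof. exact: (composeE _ _ (restr_proper x)). Qed.

Lemma pderives_restr w x F y :
  pderives w (restr x F) y = pderives (map (@rshift m n) w) F (row_mx x y).
Proof. by rewrite (compose_derivatives _ (restr_proper x)) word_dir_delta. Qed.

Lemma restr_linear x : linear (restr x).
Proof. by have /asboolP[l _] := compose_bhom (restr_proper x). Qed.

Lemma pderives_restr_sderive w v x F y :
  pderives w (restr x (sderive (map (@lshift m n) v) F)) y =
  pderives (map (@rshift m n) w ++ map (@lshift m n) v) F (row_mx x y).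
Proof. by rewrite pderives_restr pderives_sderive. Qed.

(** The joint weight to the power k + j pays for both the weight in [x] and the weight in [y]: x |->
    F(x, .) decreases rapidly as a map into the Schwartz space. *)
Lemma restr_small k w (A : set (schwartz R (m + n))) : small A ->
  small [set ((1 + enorm x) ^+ k)%:C *: restr x (sderive (map (@lshift m n) w) F) |
    x in setT & F in A].
Proof.
move=> /small_bounded_by[a a0 Aa]; apply/schwartz_smallP.
exists (fun j v => a (k + j)%N (map (@rshift m n) v ++ map (@lshift m n) w)).
move=> j v _ y [x _ [F AF <-]]; rewrite pderives_scale pderives_restr_sderive.
rewrite normcM normcR ger0_norm ?weight_ge0//.
apply: le_trans (Aa F AF (k + j)%N _ (row_mx x y)).
rewrite [X in X * _]mulrC -mulrA ler_wpM2l ?normc_ge0// exprD ler_pM ?weight_ge0//.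
  exact: weight_rowl.
exact: weight_rowr.
Qed.

(** This is (id (x) l)(F), with default 0 if that function is not Schwartz; [sliceE] settles the
    case of a bounded linear [l]. *)
Definition slice (l : schwartz R n -> R[i]) F : schwartz R m :=
  xget 0 [set G : schwartz R m | forall x, G x = l (restr x F)].

(** Differentiability of the vector-valued map x |-> F(x, .), with a remainder of h^2 times a small
    set; a bounded functional turns it into a scalar Taylor bound. *)
Lemma restr_taylor F i : exists2 B : set (schwartz R n), small B & forall x (h : R),
  exists2 z, B z & restr (x + h *: delta_mx 0 i) F - restr x F -
    h%:C *: restr x (sderive [:: lshift n i] F) = (h ^+ 2)%:C *: z.
Proof.
have [a a0 /(_ F erefl) Fa] := small_bounded_by (small1 F).
pose b k v := a k (lshift n i :: lshift n i :: map (@rshift m n) v).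
exists (bounded_by (fun k v => b k v + b k v)); first exact: bounded_by_small.
move=> x h; have [->|h0] := eqVneq h 0.
  exists 0; last by rewrite scale0r addr0 subrr scale0r subr0 scaler0.
  by have [] := bounded_by_disk (fun k v => addr_ge0 (a0 _ _) (a0 _ _) : 0 <= b k v + b k v).
set Q := _ - _; have h2 : (h ^+ 2)%:C != 0 :> R[i] by rewrite fmorph_eq0 expf_neq0.
exists (((h ^+ 2)%:C)^-1 *: Q); last by rewrite scalerA divff// scale1r.
move=> k v y; rewrite pderives_scale -fmorphV normcM normcR.
rewrite ger0_norm ?invr_ge0 ?sqr_ge0// -mulrA ler_pdivrMl ?exprn_even_gt0//.
rewrite /Q !pderivesB pderives_scale (pderives_restr_sderive v [:: i]) !pderives_restr.
rewrite cats1 -schwartz_rot row_mx_shiftl.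
set W := (1 + enorm y) ^+ k; have W0 : 0 < W by rewrite exprn_gt0// ltr_wpDr// enorm_ge0.
rewrite -ler_pdivlMr// [h ^+ 2 * _]mulrC mulrAC; rewrite mulrDl.
apply: schwartz_taylor => s; rewrite ler_pdivlMr//.
apply: le_trans (Fa k _ (row_mx x y + s *: delta_mx 0 (lshift n i))).
rewrite ler_wpM2l ?normc_ge0// -row_mx_shiftl; exact: weight_rowr.
Qed.

Section Functional.
Variable l : schwartz R n -> R[i]^o.
Hypothesis ll : linear l.
Hypothesis lb : bounded_map l.

Lemma functional_bound A : small A -> exists M : R, forall f, A f -> normc (l f) <= M.
Proof. by move=> /lb[M lM]; exists M => f Af; apply: lM; exists f. Qed.

Lemma pderives_slice F w x :
  pderives w (slice l F) x = l (restr x (sderive (map (@lshift m n) w) F)).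
Proof.
have Tw w i := cid2 (restr_taylor (sderive (map (@lshift m n) w) F) i).
have Mw v i : exists M : R, forall f, s2val (Tw v i) f -> normc (l f) <= M.
  by apply: functional_bound; case: (Tw v i).
have [||G GE] := @schwartz_family R m
    (fun w x => l (restr x (sderive (map (@lshift m n) w) F)))
    (fun w i => sval (cid (Mw w i))).
- move=> k v; have [M lM] := functional_bound (restr_small k v (small1 F)).
  exists M => z; rewrite -[(1 + _) ^+ k]ger0_norm ?weight_ge0// -normcR mulrC -normcM.
  rewrite -functionalZ//; apply: lM.
  by exists z => //; exists F.
- move=> v i z h; move: (Mw v i); case: (Tw v i) => B /= sB BE Mv.
  have [y By yE] := BE z h; case: cid => M /= /(_ _ By) yM.
  rewrite -functionalZ// -!functionalB//.
  set f := (X in l X); have -> : f = (h ^+ 2)%:C *: y.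
    by rewrite -yE; congr (_ - _ *: restr _ _); exact: schwartz_eq.
  rewrite functionalZ// normcM normcR ger0_norm ?sqr_ge0//.
  by rewrite mulrC ler_wpM2r// sqr_ge0.
have GE0 z : G z = l (restr z F).
  by rewrite -[LHS]/(pderives [::] G z) GE; congr (l (restr _ _)); exact: schwartz_eq.
suff -> : slice l F = G by [].
have := @xgetPex _ (0 : schwartz R m) [set G : schwartz R m | forall x, G x = l (restr x F)].
move=> /(_ (ex_intro _ G GE0)) HE.
by apply: schwartz_eq => z; rewrite GE0; exact: HE.
Qed.

Lemma sliceE F x : slice l F x = l (restr x F).
Proof.
rewrite -[LHS]/(pderives [::] (slice l F) x) pderives_slice.
by congr (l (restr _ _)); exact: schwartz_eq.
Qed.

Lemma slice_linear : linear (slice l).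
Proof.
move=> a F G; apply: schwartz_eq => x.
rewrite -[RHS]/(a * slice l F x + slice l G x) !sliceE restr_linear.
exact: ll.
Qed.

End Functional.

(** The functional varies together with [F]: this is needed for weighted coefficients and for
    rescaled errors of partial sums. *)
Lemma slice_small (I : Type) (l : I -> schwartz R n -> R[i]^o) A :
  (forall i, linear (l i)) ->
  (forall B, small B -> exists M : R, forall i f, B f -> normc (l i f) <= M) ->
  small A -> small [set slice (l i) F | i in setT & F in A].
Proof.
move=> ll lb sA; have b i : bounded_map (l i).
  by move=> B /lb[M lM]; exists M => _ [f Bf <-]; exact: lM.
apply/schwartz_smallP.
have Mw k w := cid (lb _ (restr_small k w sA)).
exists (fun k w => sval (Mw k w)) => k w _ x [i _ [F AF <-]].
rewrite pderives_slice//; case: (Mw k w) => M /= lM.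
rewrite -[(1 + _) ^+ k]ger0_norm ?weight_ge0// -normcR mulrC -normcM.
rewrite -functionalZ//.
by apply: lM; exists x => //; exists F.
Qed.

End Fixed.
End Slices.

(** * The integral of one-dimensional Schwartz functions *)

Section ImproperIntegral.
Context {R : realType}.
Notation mu := (@lebesgue_measure R).

(** P tends to 0 at minus infinity and to [I] at plus infinity. Integrals are compared and
    translated through primitives with this property. *)
Definition tails (P : R -> R) (I : R) := forall e : R, 0 < e -> exists B : R,
  (forall x, x <= - B -> `|P x| <= e) /\ (forall x, B <= x -> `|I - P x| <= e).

Lemma integral_oneDsqrV : (\int[mu]_x ((oneDsqr x)^-1)%:E = pi%:E)%E.
Proof.
rewrite ge0_symfun_integralT.
- rewrite -set_itvcy integral0y_oneDsqr -EFinM; congr (_%:E).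
  by rewrite mulrCA divff ?mulr1.
- by move=> x; rewrite invr_ge0.
- exact: continuous_oneDsqrV.
- by move=> x /=; rewrite /oneDsqr sqrrN.
Qed.

Lemma integrable_oneDsqrV (D : set (measurableTypeR R)) : measurable D ->
  mu.-integrable D (EFin \o (fun x => (oneDsqr x)^-1)).
Proof.
move=> mD; apply: (@integrableS _ _ _ mu setT) => //.
have m1 : measurable_fun [set: R] (fun x => (oneDsqr x)^-1).
  by apply: continuous_measurable_fun; exact: continuous_oneDsqrV.
apply/integrableP; split; first exact/measurable_EFinP.
under eq_integral do rewrite /= ger0_norm ?invr_ge0//.
by rewrite integral_oneDsqrV ltry.
Qed.

Lemma derive_const (P : R -> R) : (forall x : R, is_derive x 1 P 0) -> forall x y, P x = P y.
Proof. by move=> dP x y; exact: is_derive_0_is_cst. Qed.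

Section Primitive.
Variables (p : R -> R) (M : R).
Hypothesis cp : continuous p.
Hypothesis pM : forall x, `|p x| <= M * (oneDsqr x)^-1.

Let M0 : 0 <= M.
Proof.
have := pM 0; rewrite /oneDsqr expr0n addr0 invr1 mulr1; apply: le_trans.
exact: normr_ge0.
Qed.

Lemma integrable_dominated (D : set (measurableTypeR R)) : measurable D -> mu.-integrable D (EFin \o p).
Proof.
move=> mD.
have H := integrableZl mD M (integrable_oneDsqrV mD).
apply: (le_integrable mD _ _ H).
- by apply/measurable_EFinP/measurable_funTS; exact: continuous_measurable_fun.
- by move=> x _; rewrite /= lee_fin (le_trans (pM x))// ler_norm.
Qed.

Let prim x := (\int[mu]_(t in `]-oo, x]) p t)%R.

Lemma derive_prim (x : R) : is_derive x 1 prim (p x).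
Proof.
have xx1 : x < x + 1 by rewrite ltrDl.
have ip : mu.-integrable `]-oo, x + 1] (EFin \o p) by exact: integrable_dominated.
have [d e] := continuous_FTC1 xx1 ip (ltNyr x) (@cp x).
split; first exact: d.
by rewrite -derive1E; exact: e.
Qed.

Lemma norm_prim (D : set (measurableTypeR R)) : measurable D ->
  `|(\int[mu]_(t in D) p t)%R| <= M * (\int[mu]_(t in D) (oneDsqr t)^-1)%R.
Proof.
move=> mD; rewrite -RintegralZl//; last exact: integrable_oneDsqrV.
have H := le_normr_Rintegral mD (integrable_dominated mD).
apply: (le_trans H).
apply: le_Rintegral => //.
- by have /integrable_abse := integrable_dominated mD.
- exact: (integrableZl mD M (integrable_oneDsqrV mD)).
Qed.

Lemma prim_split x : (\int[mu]_t p t)%R - prim x = (\int[mu]_(t in `]x, +oo[) p t)%R.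
Proof.
have := @Rintegral_setU _ _ _ mu `]-oo, x] `]x, +oo[ p.
rewrite (_ : `]-oo, x] `|` `]x, +oo[ = setT); last by rewrite -setCitvl setUv.
move=> -> //; first by rewrite addrAC subrr add0r.
- exact: integrable_dominated.
- by rewrite -setCitvl; exact/disj_setPCl.
Qed.

End Primitive.

Lemma atan_large (e : R) : 0 < e -> exists B : R, forall x, B <= x -> pi / 2 - e <= atan x.
Proof.
move=> e0; have /cvgrPdist_le/(_ _ e0)[B [_ Be]] := @cvgy_atan R.
exists (B + 1) => x Bx; have /Be : B < x by rewrite (lt_le_trans _ Bx)// ltrDl.
by move=> /(le_trans (ler_norm _)); rewrite /= lerBlDr addrC -lerBlDr.
Qed.

(** The two sides differ by a constant. It is bounded above at plus infinity, where the integral is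
    at most pi, and below at minus infinity, where the integral is nonnegative. *)
Lemma arctan_prim (x : R) :
  (\int[mu]_(t in `]-oo, x]) (oneDsqr t)^-1)%R = atan x + pi / 2.
Proof.
pose p (t : R) := (oneDsqr t)^-1; pose A y := (\int[mu]_(t in `]-oo, y]) p t)%R.
have cp : continuous p by exact: continuous_oneDsqrV.
have p1 y : `|p y| <= 1 * (oneDsqr y)^-1 by rewrite mul1r ger0_norm ?invr_ge0.
have AE : forall y, A y - atan y = A x - atan x.
  move=> y; apply: (@derive_const (A - atan)) => z.
  have d1 := derive_prim cp p1 z.
  have d2 : is_derive z 1 atan (p z) by exact: is_derive1_atan.
  by apply: is_derive_eq; rewrite subrr.
have pT : (\int[mu]_t p t)%R = pi by rewrite /Rintegral integral_oneDsqrV.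
have A0 y : 0 <= A y by apply: Rintegral_ge0 => t _; rewrite invr_ge0.
have A1 y : A y <= pi.
  rewrite -subr_ge0 -pT (prim_split cp p1); apply: Rintegral_ge0 => t _.
  by rewrite invr_ge0.
apply/eqP; rewrite -[X in X == _]/(A x) addrC -subr_eq; apply/eqP.
apply/eqP; rewrite eq_le; apply/andP; split; apply/ler_addgt0Pr => e e0.
  have [B /(_ _ (lexx B)) Be] := atan_large e0.
  have := AE B; have := A1 B; move: Be; lra.
have [B /(_ _ (lexx B)) Be] := atan_large e0.
have := AE (- B); rewrite atanN; have := A0 (- B); move: Be; lra.
Qed.

(** The tails of the integral are at most M times those of 1 / (1 + x^2), which arctan makes
    explicit. *)
Lemma primitive_exists (p : R -> R) (M : R) : continuous p ->
  (forall x, `|p x| <= M * (oneDsqr x)^-1) ->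
  exists P : R -> R, (forall x : R, is_derive x 1 P (p x)) /\ tails P (\int[mu]_t p t)%R.
Proof.
move=> cp pM; exists (fun x => (\int[mu]_(t in `]-oo, x]) p t)%R).
split=> [x|e e0]; first exact: (derive_prim cp pM).
have M0 : 0 <= M.
  have := pM 0; rewrite /oneDsqr expr0n addr0 invr1 mulr1; apply: le_trans.
  exact: normr_ge0.
have p1 y : `|(oneDsqr y)^-1| <= 1 * (oneDsqr y)^-1 :> R.
  by rewrite mul1r ger0_norm ?invr_ge0.
have e1 : 0 < e / (M + 1) by rewrite divr_gt0// ltr_wpDl.
have Me : M * (e / (M + 1)) <= e.
  by rewrite mulrA ler_pdivrMr ?ltr_wpDl// mulrC ler_wpM2l ?(ltW e0)// lerDl.
have [B Be] := atan_large e1; exists B; split=> x xB.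
  apply: le_trans (norm_prim cp pM _) _ => //; rewrite arctan_prim.
  apply: le_trans Me; rewrite ler_wpM2l//.
  have := Be (- x); rewrite lerNr => /(_ xB); rewrite atanN; lra.
rewrite (prim_split cp pM); apply: le_trans (norm_prim cp pM _) _ => //.
rewrite -(prim_split (@continuous_oneDsqrV R) p1) arctan_prim /Rintegral integral_oneDsqrV/=.
apply: le_trans Me; rewrite ler_wpM2l//; have := Be x xB; lra.
Qed.

End ImproperIntegral.

(** * Products with slowly increasing functions, and conjugation *)

Section Multiplication.
Context {R : realType}.
Variable n : nat.
Implicit Types (f g : schwartz R n) (x : 'rV[R]_n).

Lemma schwartz_mulE f g x : (f ** g) x = f x * g x. Proof. by []. Qed.

Lemma schwartz_mulC f g : f ** g = g ** f.
Proof. by apply: schwartz_eq => x; rewrite !schwartz_mulE mulrC. Qed.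

(** One exponent [N] serves all derivatives, which covers coordinates and cut-off errors; [b] is
    explicit so that its dependence on a parameter can be followed. *)
Definition slow (q : 'rV[R]_n -> R[i]) (N : nat) (b : seq 'I_n -> R) :=
  smooth q /\ forall v x, normc (pderives v q x) <= b v * (1 + enorm x) ^+ N.

Lemma slow_bound q N b f a : slow q N b -> bounded_by a f -> forall k w x,
  normc (pderives w (fun x => q x * f x) x) * (1 + enorm x) ^+ k <=
  \sum_(p <- splits w) b p.1 * a (k + N)%N p.2.
Proof.
move=> [sq qb] fa k w x; have W0 j : 0 < (1 + enorm x) ^+ j.
  by rewrite exprn_gt0// ltr_wpDr// enorm_ge0.
rewrite -[X in _ * X <= _](_ : ((1 + enorm x) ^+ N)^-1 * (1 + enorm x) ^+ (k + N) = _).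
  apply: (Leibniz_bound w sq (schwartz_smooth f)).
  - by rewrite invr_ge0 ltW.
  - exact: weight_ge0.
  - by move=> u; rewrite ler_pdivrMr.
  - by move=> u; exact: fa.
by rewrite exprD mulrC mulfK// gt_eqF.
Qed.

Fact slow_mul_subproof q N b f : slow q N b -> is_schwartz (fun x => q x * f x : R[i]^o).
Proof.
move=> sq; have [a a0 /(_ f erefl) fa] := small_bounded_by (small1 f).
apply/asboolP; split; first exact: (smoothM sq.1 (schwartz_smooth f)).
move=> k w; apply/seminorm_ltP; eexists; apply/seminorm_leP => x.
exact: (slow_bound sq fa).
Qed.

Definition coord i x : R[i] := (x 0 i)%:C.

Lemma derive_coord i j x :
  is_derive x (delta_mx 0 j) (fun y : 'rV[R]_n => Re (coord i y)) (j == i)%:R.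
Proof.
apply: (@taylor_derive _ _ _ _ _ _ 0) => h; rewrite /coord /= !mxE eqxx /= eq_sym.
set a := x 0 i; set b := h * _; rewrite (_ : a + b - a - b = 0); last by ring.
by rewrite normr0 mul0r.
Qed.

Lemma derive_coord_Im i j x :
  is_derive x (delta_mx 0 j) (fun y : 'rV[R]_n => Im (coord i y)) 0.
Proof.
by apply: (@taylor_derive _ _ _ _ _ _ 0) => h; rewrite /= mulr0 !subr0 normr0 mul0r.
Qed.

Lemma pderive_coord i j : pderive j (coord i) = fun=> (j == i)%:R%:C.
Proof.
apply/funext => x; rewrite /pderive (derive_val (is_derive := derive_coord i j x)).
by rewrite (derive_val (is_derive := derive_coord_Im i j x)).
Qed.

Lemma coord_slow i : slow (coord i) 1 (fun=> 1).
Proof.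
have d2 w : (1 < size w)%N -> pderives w (coord i) = fun=> 0.
  case/lastP: w => // w j; rewrite size_rcons ltnS => w0.
  rewrite /pderives foldr_rcons -/(pderives w _) pderive_coord.
  case: w w0 => // k w _; elim: w k => [|l w IH] k /=; first exact: pderive_cst.
  by rewrite [pderive l _]IH pderive_cst.
split=> [w|w x].
  case: w => [|j [|k w]]; last by rewrite d2//; exact: partially_C1_cst.
    split=> [||j x|j x].
    - by apply: coord_continuous.
    - exact: cst_continuous.
    - exact: (ex_derive (is_derive := derive_coord i j x)).
    - exact: (ex_derive (is_derive := derive_coord_Im i j x)).
  by rewrite /= pderive_coord; exact: partially_C1_cst.
rewrite mul1r expr1; case: w => [|j [|k w]]; last by rewrite d2// normc0 addr_ge0// enorm_ge0.
  by rewrite -[normc _]/(normc (x 0 i)%:C) normcR (le_trans (enorm_coord _ _))// lerDr.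
rewrite -[pderives _ _]/(pderive j (coord i)) pderive_coord normcR.
rewrite (le_trans _ (weight_ge1 1 x))//.
by case: (j == i); rewrite ?normr1 ?normr0.
Qed.

Definition smulX i f : schwartz R n := Schwartz (slow_mul_subproof f (coord_slow i)).

Lemma smulXE i f x : smulX i f x = (x 0 i)%:C * f x. Proof. by []. Qed.

Lemma smulX_bhom i : is_bhom (smulX i).
Proof.
apply/asboolP; split=> [a f g|A /small_bounded_by[a a0 Aa]].
  apply: schwartz_eq => x; rewrite -[RHS]/(a * smulX i f x + smulX i g x) !smulXE.
  by rewrite schwartzDE schwartzZE; ring.
apply/schwartz_smallP; exists (fun k w => \sum_(p <- splits w) 1 * a (k + 1)%N p.2).
move=> k w _ x [f /Aa fa <-]; exact: (slow_bound (coord_slow i) fa).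
Qed.

Definition conj (z : R[i]) : R[i] := Re z -i* Im z.

Lemma normc_conj z : normc (conj z) = normc z.
Proof. by case: z => a b /=; rewrite sqrrN. Qed.
Lemma conjB z w : conj (z - w) = conj z - conj w.
Proof. by apply: complexP; rewrite /= ?ReB ?ImB//= opprD opprK addrC. Qed.
Lemma conjM z w : conj (z * w) = conj z * conj w.
Proof.
by case: z w => a b [c d]; apply: complexP => /=; ring.
Qed.

Fact sconj_subproof f : exists g : schwartz R n, forall w x, pderives w g x = conj (pderives w f x).
Proof.
have c w i := schwartz_taylor_le f w i.
apply: (schwartz_family (c := fun w i => s2val (cid2 (c w i)))) => [k w|w i x h].
  by have [M fM] := schwartz_bound f k w; exists M => x; rewrite normc_conj.
have -> : h%:C * conj (pderives (i :: w) f x) = conj (h%:C * pderives (i :: w) f x).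
  by rewrite conjM; congr (_ * _); apply: complexP; rewrite //= oppr0.
by rewrite -!conjB normc_conj; case: cid2 => C _ /=; exact.
Qed.

Definition sconj f : schwartz R n := sval (cid (sconj_subproof f)).

Lemma pderives_sconj w f x : pderives w (sconj f) x = conj (pderives w f x).
Proof. by rewrite /sconj; case: cid. Qed.

Lemma sconjE f x : sconj f x = conj (f x).
Proof. exact: (pderives_sconj [::]). Qed.

Lemma pderives_mul w f g x : pderives w (f ** g) x =
  \sum_(p <- splits w) pderives p.1 f x * pderives p.2 g x.
Proof.
by rewrite -[LHS]/(pderives w (fun x => f x * g x) x) pderivesM//; exact: schwartz_smooth.
Qed.

Lemma pderive1_mul i f g x : pderives [:: i] (f ** g) x =
  pderives [:: i] f x * g x + f x * pderives [:: i] g x.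
Proof. by rewrite pderives_mul !big_cons big_nil addr0. Qed.

Lemma pderive1_smulX i j f x : pderives [:: i] (smulX j f) x =
  (i == j)%:R * f x + (x 0 j)%:C * pderives [:: i] f x.
Proof.
rewrite -[LHS]/(pderives [:: i] (fun x => coord j x * f x) x).
rewrite pderivesM; [|by case: (coord_slow j)|exact: schwartz_smooth].
rewrite !big_cons big_nil addr0; congr (_ * _ + _).
by rewrite /= pderive_coord; case: eqP.
Qed.

End Multiplication.

(** * The integral on S(R) and the Sobolev inequality *)

Section Line.
Context {R : realType}.
Notation mu := (@lebesgue_measure R).
Implicit Types (f g : schwartz R 1) (x y h : R).

Definition pt x : 'rV[R]_1 := x%:M.

Lemma pt00 x : pt x 0 0 = x. Proof. by rewrite mxE eqxx. Qed.
Lemma ptK (v : 'rV[R]_1) : pt (v 0 0) = v.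
Proof. by apply/rowP => i; rewrite (ord1 i) pt00. Qed.
Lemma ptE x : pt x = 0 + x *: delta_mx 0 0.
Proof. by rewrite add0r; apply/rowP => i; rewrite (ord1 i) pt00 !mxE eqxx mulr1. Qed.
Lemma enorm_pt x : enorm (pt x) = `|x|.
Proof. by rewrite /enorm big_ord1 pt00 sqrtr_sqr. Qed.

Lemma word1 (w : seq 'I_1) : w = nseq (size w) ord0.
Proof. by elim: w => //= i w {1}->; rewrite (ord1 i). Qed.

Lemma eq_pt f g : (forall x, f (pt x) = g (pt x)) -> f = g.
Proof. by move=> fg; apply: schwartz_eq => v; rewrite -(ptK v). Qed.

Lemma derive_ptR f w x : is_derive x 1 (fun t => Re (pderives w f (pt t)))
  (Re (pderives (ord0 :: w) f (pt x))).
Proof.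
have [+ _] := schwartz_derivable f w ord0 (0 + x *: delta_mx 0 0).
move=> /(is_derive_along (g := fun v : 'rV[R]_1 => Re (pderives w f v))).
by under eq_fun do rewrite -ptE; rewrite -ptE.
Qed.

Lemma derive_ptI f w x : is_derive x 1 (fun t => Im (pderives w f (pt t)))
  (Im (pderives (ord0 :: w) f (pt x))).
Proof.
have [_ +] := schwartz_derivable f w ord0 (0 + x *: delta_mx 0 0).
move=> /(is_derive_along (g := fun v : 'rV[R]_1 => Im (pderives w f v))).
by under eq_fun do rewrite -ptE; rewrite -ptE.
Qed.

(** In one variable genuine derivatives may be given: the bound on [g k.+2] supplies the quadratic
    expansion of [g k]. *)
Lemma schwartz_family1 (g : nat -> R -> R[i]) :
  (forall k x, is_derive x 1 (fun t => Re (g k t)) (Re (g k.+1 x))) ->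
  (forall k x, is_derive x 1 (fun t => Im (g k t)) (Im (g k.+1 x))) ->
  (forall j k, exists M : R, forall x, normc (g k x) * (1 + `|x|) ^+ j <= M) ->
  exists F : schwartz R 1, forall w x, pderives w F (pt x) = g (size w) x.
Proof.
move=> gR gI gM.
have gB k : exists M : R, forall x, normc (g k x) <= M.
  by have [M Mg] := gM 0%N k; exists M => x; have := Mg x; rewrite expr0 mulr1.
pose B k := sval (cid (gB k)).
have BP k x : normc (g k x) <= B k by rewrite /B; case: cid.
have shiftD (u : R -> R) (du : R -> R) x : (forall t : R, is_derive t 1 u (du t)) ->
    forall s : R, is_derive s 1 (fun t => u (x + t)) (du (x + s)).
  move=> ud s; have := is_derive1_comp (ud (x + s)) (_ : is_derive s 1 (fun t => x + t) 1).
  rewrite mulr1; apply; have -> : (fun t => x + t) = cst x + id by apply/funext.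
  by apply: is_derive_eq; rewrite add0r.
have [||F FE] := @schwartz_family R 1 (fun w (y : 'rV[R]_1) => g (size w) (y 0 0))
    (fun w i => B (size w).+2 + B (size w).+2).
- move=> k w; have [M Mg] := gM k (size w); exists M => y.
  by rewrite -{2}(ptK y) enorm_pt; exact: Mg.
- move=> w i y h; rewrite (ord1 i) !mxE eqxx mulr1 /=; move: (y 0 0) (size w) => x k.
  apply: le_trans (normc_ReIm _) _; rewrite mulrDl !ReB !ImB ReRM ImRM.
  apply: lerD.
    have := @taylor1 R (fun s => Re (g k (x + s))) (fun s => Re (g k.+1 (x + s)))
      (fun s => Re (g k.+2 (x + s))) (B k.+2).
    rewrite addr0; apply.
    - by apply: (shiftD (fun t => Re (g k t)) (fun t => Re (g k.+1 t))).
    - by apply: (shiftD (fun t => Re (g k.+1 t)) (fun t => Re (g k.+2 t))).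
    - by move=> s; exact: (le_trans (normc_Re _) (BP _ _)).
  have := @taylor1 R (fun s => Im (g k (x + s))) (fun s => Im (g k.+1 (x + s)))
    (fun s => Im (g k.+2 (x + s))) (B k.+2).
  rewrite addr0; apply.
  - by apply: (shiftD (fun t => Im (g k t)) (fun t => Im (g k.+1 t))).
  - by apply: (shiftD (fun t => Im (g k.+1 t)) (fun t => Im (g k.+2 t))).
  - by move=> s; exact: (le_trans (normc_Im _) (BP _ _)).
by exists F => w x; rewrite FE pt00.
Qed.

Definition I1 f : R[i]^o :=
  (\int[mu]_x Re (f (pt x)))%R +i* (\int[mu]_x Im (f (pt x)))%R.

(** Since (1 + |x|)^2 >= 1 + x^2, one seminorm of weight 2 dominates by a multiple of the integrable
    1 / (1 + x^2). *)
Lemma dominated_pt (A : set (schwartz R 1)) : small A -> exists2 M : R, 0 <= M &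
  forall f, A f -> forall x, normc (f (pt x)) <= M * (oneDsqr x)^-1.
Proof.
move=> /small_bounded_by[a a0 Aa]; exists (a 2%N [::]) => // f /Aa fa x.
rewrite ler_pdivlMr ?(lt_le_trans ltr01 (oneDsqr_ge1 x))//.
apply: le_trans (fa 2%N [::] (pt x)); rewrite ler_wpM2l ?normc_ge0// enorm_pt.
rewrite /oneDsqr sqrrD expr1n real_normK ?num_real// addrAC lerDl.
by rewrite mulrn_wge0// mul1r.
Qed.

Lemma continuous_ptR f : continuous (fun x => Re (f (pt x))).
Proof.
move=> x; apply/differentiable_continuous/derivable1_diffP.
exact: (ex_derive (is_derive := derive_ptR f [::] x)).
Qed.

Lemma continuous_ptI f : continuous (fun x => Im (f (pt x))).
Proof.
move=> x; apply/differentiable_continuous/derivable1_diffP.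
exact: (ex_derive (is_derive := derive_ptI f [::] x)).
Qed.

Lemma dominated_ptR f : exists M : R, forall x, `|Re (f (pt x))| <= M * (oneDsqr x)^-1.
Proof.
have [M _ /(_ f erefl) fM] := dominated_pt (small1 f).
by exists M => x; exact: (le_trans (normc_Re _) (fM x)).
Qed.

Lemma dominated_ptI f : exists M : R, forall x, `|Im (f (pt x))| <= M * (oneDsqr x)^-1.
Proof.
have [M _ /(_ f erefl) fM] := dominated_pt (small1 f).
by exists M => x; exact: (le_trans (normc_Im _) (fM x)).
Qed.

Lemma primR f : exists P : R -> R, (forall x, is_derive x 1 P (Re (f (pt x)))) /\
  tails P (Re (I1 f)).
Proof. by have [M fM] := dominated_ptR f; exact: (primitive_exists (@continuous_ptR f) fM). Qed.

Lemma primI f : exists P : R -> R, (forall x, is_derive x 1 P (Im (f (pt x)))) /\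
  tails P (Im (I1 f)).
Proof. by have [M fM] := dominated_ptI f; exact: (primitive_exists (@continuous_ptI f) fM). Qed.

Lemma integrableR f : mu.-integrable setT (EFin \o (fun x => Re (f (pt x)))).
Proof.
by have [M fM] := dominated_ptR f; exact: (integrable_dominated (@continuous_ptR f) fM).
Qed.

Lemma integrableI f : mu.-integrable setT (EFin \o (fun x => Im (f (pt x)))).
Proof.
by have [M fM] := dominated_ptI f; exact: (integrable_dominated (@continuous_ptI f) fM).
Qed.

Lemma Rintegral_comb (u v : R -> R) (a b : R) :
  mu.-integrable setT (EFin \o u) -> mu.-integrable setT (EFin \o v) ->
  (\int[mu]_x (a * u x + b * v x))%R = a * (\int[mu]_x u x)%R + b * (\int[mu]_x v x)%R.
Proof.
move=> iu iv; have mT : measurable [set: measurableTypeR R] by exact: measurableT.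
have iau := integrableZl mT a iu; have ibv := integrableZl mT b iv.
by rewrite -(RintegralZl a mT iu) -(RintegralZl b mT iv) -(RintegralD mT iau ibv).
Qed.

Lemma I1_linear : linear I1.
Proof.
move=> a f g; apply: complexP.
- rewrite -[RHS]/(Re (a * I1 f + I1 g)) Defs.ReD Defs.ReM /=.
  transitivity (\int[mu]_x (1 * (Re a * Re (f (pt x)) + (- Im a) * Im (f (pt x))) +
    1 * Re (g (pt x))))%R.
    by apply: eq_Rintegral => x _; transitivity (Re (a * f (pt x) + g (pt x))) => //; rewrite Defs.ReD Defs.ReM !mul1r mulNr.
  rewrite (Rintegral_comb _ _ _ (integrableR g)).
    by rewrite Rintegral_comb ?mul1r ?mulNr//; [exact: integrableR|exact: integrableI].
  have := integrableR (a *: f); congr (integrable _ _ _); apply/funext => x.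
  congr (_%:E); transitivity (Re (a * f (pt x))) => //; by rewrite Defs.ReM mulNr.
- rewrite -[RHS]/(Im (a * I1 f + I1 g)) Defs.ImD Defs.ImM /=.
  transitivity (\int[mu]_x (1 * (Re a * Im (f (pt x)) + Im a * Re (f (pt x))) +
    1 * Im (g (pt x))))%R.
    by apply: eq_Rintegral => x _; transitivity (Im (a * f (pt x) + g (pt x))) => //; rewrite Defs.ImD Defs.ImM !mul1r.
  rewrite (Rintegral_comb _ _ _ (integrableI g)).
    by rewrite Rintegral_comb ?mul1r//; [exact: integrableI|exact: integrableR].
  have := integrableI (a *: f); congr (integrable _ _ _); apply/funext => x.
  congr (_%:E); transitivity (Im (a * f (pt x))) => //; by rewrite Defs.ImM.
Qed.

Lemma I1_bound f (M : R) : (forall x, normc (f (pt x)) <= M * (oneDsqr x)^-1) ->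
  normc (I1 f) <= (M + M) * pi.
Proof.
move=> fM; have mT := @measurableT _ (measurableTypeR R).
apply: le_trans (normc_ReIm _) _; rewrite mulrDl.
have -> : pi = (\int[mu]_x (oneDsqr x)^-1)%R :> R by rewrite /Rintegral integral_oneDsqrV.
apply: lerD.
  apply: (norm_prim (@continuous_ptR f) _ mT) => x.
  exact: (le_trans (normc_Re _) (fM x)).
apply: (norm_prim (@continuous_ptI f) _ mT) => x.
exact: (le_trans (normc_Im _) (fM x)).
Qed.

Lemma I1_bounded : bounded_map I1.
Proof.
move=> A /dominated_pt[M M0 AM]; exists ((M + M) * pi) => _ [f /AM fM <-].
exact: I1_bound.
Qed.

Lemma tails_unique (P Q p : R -> R) (I J : R) :
  (forall x, is_derive x 1 P (p x)) -> (forall x, is_derive x 1 Q (p x)) ->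
  tails P I -> tails Q J -> I = J.
Proof.
move=> dP dQ tP tQ.
have cPQ x y : P x - Q x = P y - Q y.
  apply: (@derive_const _ (P - Q)) => z; have := dP z; have := dQ z => dQz dPz.
  by apply: is_derive_eq; rewrite subrr.
apply/eqP; rewrite -subr_eq0 -normr_le0; apply/ler_addgt0Pr => e e0; rewrite add0r.
have e4 : 0 < e / 4 by rewrite divr_gt0.
have [B [B1 B2]] := tP _ e4; have [C [C1 C2]] := tQ _ e4.
pose x := Num.max B C.
have := B1 (- x); rewrite lerN2 le_max lexx => /(_ isT) b1.
have := C1 (- x); rewrite lerN2 le_max lexx orbT => /(_ isT) c1.
have := B2 x; rewrite le_max lexx => /(_ isT) b2.
have := C2 x; rewrite le_max lexx orbT => /(_ isT) c2.
move: b1 b2 c1 c2 (cPQ x (- x)); rewrite !ler_norml => /andP[? ?] /andP[? ?] /andP[? ?] /andP[? ?] ?.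
by apply/andP; split; lra.
Qed.

Lemma decay_tails (f : schwartz R 1) e : 0 < e -> exists B : R, forall x, B <= `|x| ->
  normc (f (pt x)) <= e.
Proof.
move=> e0; have [M fM] := schwartz_bound f 1 [::]; exists (M / e) => x Mx.
have := fM (pt x); rewrite enorm_pt expr1 => fx.
have x0 : 0 < 1 + `|x| by rewrite ltr_wpDr.
rewrite -(ler_pM2r x0) (le_trans fx)//.
rewrite mulrDr mulr1 -[M](@divfK _ e) ?gt_eqF// mulrC.
by rewrite (@le_trans _ _ (e * `|x|)) ?lerDr ?(ltW e0)// ler_pM2l.
Qed.

(** [f] is a primitive of its derivative and vanishes at both ends. *)
Lemma I1_derive f : I1 (sderive [:: ord0] f) = 0.
Proof.
have tR : tails (fun x => Re (f (pt x))) 0.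
  move=> e /(decay_tails f)[B fB]; exists `|B|; split=> x xB.
    apply: le_trans (normc_Re _) (fB _ _); rewrite -normrN (le_trans (ler_norm B))//.
    by rewrite ler_normr lerNr xB.
  rewrite sub0r normrN; apply: le_trans (normc_Re _) (fB _ _).
  by rewrite (le_trans (ler_norm B))// ler_normr xB.
have tI : tails (fun x => Im (f (pt x))) 0.
  move=> e /(decay_tails f)[B fB]; exists `|B|; split=> x xB.
    apply: le_trans (normc_Im _) (fB _ _); rewrite -normrN (le_trans (ler_norm B))//.
    by rewrite ler_normr lerNr xB.
  rewrite sub0r normrN; apply: le_trans (normc_Im _) (fB _ _).
  by rewrite (le_trans (ler_norm B))// ler_normr xB.
have [P [dP tP]] := primR (sderive [:: ord0] f).
have [Q [dQ tQ]] := primI (sderive [:: ord0] f).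
apply: complexP.
  exact: (tails_unique dP (derive_ptR f [::]) tP tR).
exact: (tails_unique dQ (derive_ptI f [::]) tQ tI).
Qed.

Lemma I1_ge0 f : (forall x, 0 <= Re (f (pt x))) -> 0 <= Re (I1 f).
Proof. by move=> f0; apply: Rintegral_ge0. Qed.

Lemma decreasing_of (F dF : R -> R) a : (forall x, a <= x -> is_derive x 1 F (dF x)) ->
  (forall x, a <= x -> dF x <= 0) -> forall x y, a <= x -> x <= y -> F y <= F x.
Proof.
move=> FD dF0 x y ax xy.
have [||c cxy E] := @MVT_segment R F dF x y xy.
- by move=> z; rewrite in_itv => /andP[xz _]; apply: FD; exact: le_trans ax (ltW xz).
- apply: derivable_within_continuous => z; rewrite in_itv => /andP[xz _].
  exact: (ex_derive (is_derive := FD z (le_trans ax xz))).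
move: cxy; rewrite in_itv => /andP[xc _].
by rewrite -subr_le0 E mulr_le0_ge0 ?subr_ge0// dF0// (le_trans ax).
Qed.

Lemma ge0_at_infinity (F dF : R -> R) a : (forall x, a <= x -> is_derive x 1 F (dF x)) ->
  (forall x, a <= x -> dF x <= 0) ->
  (forall e, 0 < e -> exists B : R, forall x, B <= x -> `|F x| <= e) ->
  forall x, a <= x -> 0 <= F x.
Proof.
move=> FD dF0 F0 x ax; apply/ler_addgt0Pr => e /F0[B FB].
have := FB _ (_ : B <= Num.max B x); rewrite le_max lexx => /(_ isT).
have := @decreasing_of F dF a FD dF0 x (Num.max B x) ax; rewrite le_max lexx orbT => /(_ isT).
by rewrite ler_norml => h1 /andP[h2 _]; move: h1 h2; lra.
Qed.

Lemma derive_reflect (P p : R -> R) x : is_derive (- x) 1 P (p (- x)) ->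
  is_derive x 1 (fun t => P (- t)) (- p (- x)).
Proof.
move=> dP; have := is_derive1_comp dP (_ : is_derive x 1 -%R (-1)).
by rewrite mulrN1; apply; exact: is_deriveNid.
Qed.

(** P x and I - P x are the integrals over the two half-lines at x; each difference of primitives is
    monotone and tends to 0 at the relevant end. *)
Lemma prim_le (P Q p q : R -> R) (I J : R) :
  (forall x, is_derive x 1 P (p x)) -> (forall x, is_derive x 1 Q (q x)) ->
  tails P I -> tails Q J -> (forall x, p x <= q x) ->
  forall x, P x <= Q x /\ I - P x <= J - Q x.
Proof.
move=> dP dQ tP tQ pq x; split.
  have := @ge0_at_infinity (fun t => Q (- t) - P (- t)) (fun t => - q (- t) + p (- t)) (- x).
  move=> /(_ _ _ _ (- x) (lexx _)); rewrite opprK subr_ge0; apply.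
  - move=> t _; have d1 := derive_reflect (dQ (- t)); have d2 := derive_reflect (dP (- t)).
    by apply: is_derive_eq; rewrite opprK.
  - by move=> t _; rewrite addrC subr_le0.
  - move=> e e0; have e2 : 0 < e / 2 by rewrite divr_gt0.
    have [B [B1 _]] := tP _ e2; have [C [C1 _]] := tQ _ e2.
    exists (Num.max B C) => t; rewrite ge_max -lerN2 => /andP[tB]; rewrite -lerN2 => tC.
    rewrite (le_trans (ler_normB _ _))// [leRHS]splitr lerD//; first exact: C1.
    exact: B1.
rewrite -subr_ge0 [X in _ <= X](_ : _ = (J - Q x) - (I - P x)); last by ring.
apply: (@ge0_at_infinity (fun t => (J - Q t) - (I - P t)) (fun t => - q t + p t) x) => //.
- move=> t _; have d1 := dQ t; have d2 := dP t.
  have -> : (fun t => J - Q t - (I - P t)) = (cst J - Q) - (cst I - P) by apply/funext.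
  by apply: is_derive_eq; ring.
- by move=> t _; rewrite addrC subr_le0.
- move=> e e0; have e2 : 0 < e / 2 by rewrite divr_gt0.
  have [B [_ B1]] := tP _ e2; have [C [_ C1]] := tQ _ e2.
  exists (Num.max B C) => t; rewrite ge_max => /andP[tB tC].
  rewrite (le_trans (ler_normB _ _))// [leRHS]splitr lerD//; first exact: C1.
  exact: B1.
Qed.

(** Comparison with the zero primitive gives P >= 0 and 0 - P >= 0, so P = 0 and its derivative
    vanishes everywhere, not just almost everywhere. *)
Lemma I1_eq0 f : (forall x, 0 <= Re (f (pt x))) -> Re (I1 f) = 0 ->
  forall x, Re (f (pt x)) = 0.
Proof.
move=> f0 If0; have [P [dP tP]] := primR f; rewrite If0 in tP.
have t0 : tails (cst 0) (0 : R).
  by move=> e e0; exists 0; split=> x _; rewrite ?subr0 normr0 ltW.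
have d0 (x : R) : is_derive x 1 (cst 0 : R -> R) 0 by exact: is_derive_cst.
have P0 x : P x = 0.
  have [h1 h2] := prim_le d0 dP t0 tP f0 x.
  by apply/eqP; rewrite eq_le h1 andbT; move: h2; rewrite /= !sub0r lerN2.
move=> x; rewrite -(derive_val (is_derive := dP x)).
have -> : P = cst 0 by apply/funext.
exact: derive_val.
Qed.

Lemma I1_conj f : I1 (sconj f) = conj (I1 f).
Proof.
apply: complexP => /=; first by apply: eq_Rintegral => x _; rewrite sconjE.
rewrite -mulN1r -(RintegralZl (-1) (@measurableT _ (measurableTypeR R)) (integrableI f)).
by apply: eq_Rintegral => x _; rewrite sconjE mulN1r.
Qed.

(* Sobolev: |g|^2 is the primitive of 2 Re (g' conj g) <= |g|^2 + |g'|^2. *)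
Lemma sobolev g x : normc (g (pt x)) ^+ 2 <= Re (I1 (g ** sconj g)) +
  Re (I1 (sderive [:: ord0] g ** sconj (sderive [:: ord0] g))).
Proof.
set d := sderive [:: ord0] g; pose k := g ** sconj g + d ** sconj d.
rewrite -Defs.ReD -[_ + _](functionalD I1_linear) -/k.
have [P [dP tP]] := primR k; pose p := g ** sconj g.
have normE (f : schwartz R 1) (t : R) : Re ((f ** sconj f) (pt t)) = normc (f (pt t)) ^+ 2.
  rewrite schwartz_mulE sconjE Defs.ReM /=; case: (f _) => a b /=.
  by rewrite sqr_sqrtr ?addr_ge0 ?sqr_ge0// mulrN opprK.
have kE t : Re (k (pt t)) = normc (g (pt t)) ^+ 2 + normc (d (pt t)) ^+ 2.
  by rewrite /k schwartzDE Defs.ReD !normE.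
have tp : tails (fun t => Re (p (pt t))) 0.
  move=> e /(decay_tails p)[B fB]; exists `|B|; split=> t tB.
    apply: le_trans (normc_Re _) (fB _ _); rewrite (le_trans (ler_norm B))//.
    by rewrite ler_normr orbC lerNr tB.
  rewrite sub0r normrN; apply: le_trans (normc_Re _) (fB _ _).
  by rewrite (le_trans (ler_norm B))// ler_normr tB.
have [|h1 _] := prim_le (derive_ptR p [::]) dP tp tP _ x.
  move=> t; rewrite kE -/(pderives [:: ord0] p (pt t)) pderive1_mul pderives_sconj.
  rewrite (_ : pderives [:: ord0] g (pt t) = d (pt t))// sconjE Defs.ReD !Defs.ReM.
  case: (g _) (d _) => a b [a' b'] /=.
  rewrite !sqr_sqrtr ?addr_ge0 ?sqr_ge0//.
  have := sqr_ge0 (a - a'); have := sqr_ge0 (b - b'); nra.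
rewrite -normE; apply: le_trans h1 _.
have t0 : tails (cst 0) (0 : R).
  by move=> e e0; exists 0; split=> t _; rewrite ?subr0 normr0 ltW.
have d0 (t : R) : is_derive t 1 (cst 0 : R -> R) 0 by exact: is_derive_cst.
have [|_] := prim_le d0 dP t0 tP _ x; last by rewrite /= subr0 subr_ge0.
by move=> t; rewrite kE addr_ge0// sqr_ge0.
Qed.

End Line.

(** * Hermite expansions *)

Section Gaussian.
Context {R : realType}.
Implicit Types (f g : schwartz R 1) (x h : R).

Definition gauss x : R := expR (- (x ^+ 2 / 2)).

Lemma gauss_gt0 x : 0 < gauss x. Proof. exact: expR_gt0. Qed.

Lemma derive_gauss x : is_derive x 1 gauss (- x * gauss x).
Proof.
have d : is_derive x 1 (fun t : R => - (t ^+ 2 / 2)) (- x).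
  have -> : (fun t : R => - (t ^+ 2 / 2)) = - (2^-1 *: (id ^+ 2)).
    by apply/funext => t; rewrite -[RHS]/(- (2^-1 * t ^+ 2)) [2^-1 * _]mulrC.
  apply: is_derive_eq; rewrite -[_ *: _]/(_ * _) /=.
  by rewrite expr1 -[_ *: _]/(_ * _); field.
have := @is_derive1_comp _ expR (fun t : R => - (t ^+ 2 / 2)) x _ _ (is_derive_expR _) d.
by rewrite mulrC.
Qed.

Lemma gauss_decay k : exists2 M : R, 0 <= M & forall x, (1 + `|x|) ^+ k * gauss x <= M.
Proof.
(* With y = (1 + x^2) / 2: 1 + |x| <= 4 y, y^k <= k! exp y, and exp y times the Gaussian is exp (1 /
   2). *)
exists (4 ^+ k * k`!%:R * expR (1 / 2)).
  by rewrite !mulr_ge0 ?expR_ge0// exprn_ge0.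
move=> x; have x0 : 0 <= 1 + `|x| by rewrite addr_ge0.
have y0 : 0 <= (1 + x ^+ 2) / 2 by rewrite divr_ge0 ?addr_ge0 ?sqr_ge0.
have h0 : 1 + `|x| <= 4 * ((1 + x ^+ 2) / 2).
  by have := sqr_ge0 (1 - `|x|); rewrite -(real_normK (num_real x)); nra.
have h1 : (1 + `|x|) ^+ k <= 4 ^+ k * ((1 + x ^+ 2) / 2) ^+ k.
  by rewrite -exprMn lerXn2r// nnegrE mulr_ge0.
have h2 : ((1 + x ^+ 2) / 2) ^+ k <= k`!%:R * expR ((1 + x ^+ 2) / 2).
  rewrite -ler_pdivrMl ?ltr0n ?fact_gt0// mulrC.
  case: k {h1} => [|k]; first by rewrite expr0 fact0 divr1 (le_trans _ (expR_ge1Dx _))// lerDl.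
  by apply: le_trans (expR_ge1Dxn k y0); rewrite lerDr.
apply: (@le_trans _ _ (4 ^+ k * (k`!%:R * expR ((1 + x ^+ 2) / 2)) * gauss x)).
  rewrite ler_wpM2r ?(ltW (gauss_gt0 x))// (le_trans h1)// ler_wpM2l//.
rewrite /gauss -!mulrA -expRD [X in expR X](_ : _ = 1 / 2)//; by field.
Qed.

Lemma poly_growth (p : {poly R}) : exists2 M : R, 0 <= M &
  forall x, `|p.[x]| <= M * (1 + `|x|) ^+ size p.
Proof.
exists (\sum_(i < size p) `|p`_i|); first exact: sumr_ge0.
move=> x; rewrite horner_coef (le_trans (ler_norm_sum _ _ _))// mulr_suml.
apply: ler_sum => i _; rewrite normrM ler_wpM2l// normrX.
apply: (@le_trans _ _ ((1 + `|x|) ^+ i)).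
  by rewrite lerXn2r ?nnegrE ?addr_ge0// lerDr.
by rewrite ler_weXn2l ?lerDl// ltnW.
Qed.

(** The polynomial factor of the k-th derivative of the Gaussian: up to the sign (-1)^k, a
    probabilists' Hermite polynomial. *)
Fixpoint gauss_poly k : {poly R} :=
  if k is k.+1 then (gauss_poly k)^`() - 'X * gauss_poly k else 1.

Lemma gauss_exists : exists F : schwartz R 1, forall x, F (pt x) = (gauss x)%:C.
Proof.
have [|||F FE] := @schwartz_family1 R (fun k x => ((gauss_poly k).[x] * gauss x)%:C).
- move=> k x; have dp := is_derive_poly (gauss_poly k) x; have dg := derive_gauss x.
  have -> : (fun t => Re ((gauss_poly k).[t] * gauss t)%:C) =
    (horner (gauss_poly k) * gauss) by apply/funext.
  apply: is_derive_eq; rewrite /= !hornerE -![_ *: _]/(_ * _); ring.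
- by move=> k x; exact: is_derive_cst.
- move=> j k; have [M M0 pM] := poly_growth (gauss_poly k).
  have [C C0 gC] := gauss_decay (size (gauss_poly k) + j); exists (M * C) => x.
  rewrite normcR normrM (ger0_norm (ltW (gauss_gt0 x))) -mulrA.
  apply: (@le_trans _ _ ((M * (1 + `|x|) ^+ size (gauss_poly k)) *
      (gauss x * (1 + `|x|) ^+ j))).
    by rewrite ler_wpM2r ?mulr_ge0 ?(ltW (gauss_gt0 x)) ?exprn_ge0 ?addr_ge0.
  rewrite -mulrA ler_wpM2l//; apply: le_trans (gC x).
  by rewrite [gauss x * _]mulrC mulrA -exprD.
by exists F => x; rewrite -[LHS]/(pderives [::] F (pt x)) FE /= hornerE mul1r.
Qed.

Definition gauss1 : schwartz R 1 := sval (cid gauss_exists).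
Lemma gauss1E x : gauss1 (pt x) = (gauss x)%:C.
Proof. by rewrite /gauss1; case: cid. Qed.

(* The barrier M (1 + x)^-k exp(-x^2/2) decreases at least as fast as P can vary. *)
Lemma gauss_tail (P q : R -> R) (M : R) k : (0 < k)%N ->
  (forall x, is_derive x 1 P (q x)) ->
  (forall x, 0 <= x -> `|q x| <= M * (1 + x) ^- k * gauss x) ->
  (forall e, 0 < e -> exists B : R, forall x, B <= x -> `|P x| <= e) ->
  forall x, 0 <= x -> `|P x| <= M * (1 + x) ^- k * gauss x.
Proof.
move=> k0 dP qM P0.
have M0 : 0 <= M.
  have := le_trans (normr_ge0 _) (qM 0 (lexx _)).
  by rewrite addr0 expr1n invr1 mulr1 pmulr_lge0 ?gauss_gt0.
pose psi x := M * (1 + x) ^- k * gauss x.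
pose dpsi x := - (M * (1 + x) ^- k * gauss x * (x + k%:R / (1 + x))).
have dpsiP x : 0 <= x -> is_derive x 1 psi (dpsi x).
  move=> x0; have x1 : 1 + x != 0 by rewrite gt_eqF// ltr_wpDr.
  have d1 : is_derive x 1 (fun t : R => 1 + t) 1.
    have -> : (fun t : R => 1 + t) = cst 1 + id by apply/funext.
    by apply: is_derive_eq; rewrite add0r.
  have d2 : is_derive x 1 (fun t : R => (1 + t) ^+ k) (k%:R * (1 + x) ^+ k.-1).
    have -> : (fun t : R => (1 + t) ^+ k) = (fun t : R => 1 + t) ^+ k.
      by apply/funext => t; elim: (k) => //= j IH; rewrite !exprS IH.
    by apply: is_derive_eq; rewrite -![_ *: _]/(_ * _) mulr1 mulr_natl.
  have xk : (1 + x) ^+ k != 0 by rewrite expf_neq0.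
  have d3 := @is_deriveV _ (fun t : R => (1 + t) ^+ k) _ _ _ xk d2; have dg := derive_gauss x.
  have -> : psi = (M *: (fun t : R => ((1 + t) ^+ k)^-1)) * gauss by apply/funext.
  apply: is_derive_eq; rewrite /dpsi /GRing.scale/=.
  rewrite -[M *: _]/(M * ((1 + x) ^+ k)^-1).
  have -> : (1 + x) ^+ k = (1 + x) ^+ k.-1 * (1 + x) by rewrite -exprSr prednK.
  by field; rewrite x1 expf_neq0.
(* x + k / (1 + x) >= 1 for x >= 0 because k >= 1; hence the barrier falls at a rate of at least
   [psi x]. *)
have key x : 0 <= x -> `|q x| <= - dpsi x.
  move=> x0; apply: le_trans (qM x x0) _; rewrite /dpsi opprK.
  rewrite ler_peMr//.
    by rewrite !mulr_ge0 ?(ltW (gauss_gt0 x)) ?invr_ge0 ?exprn_ge0 ?addr_ge0.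
  have x1 : 0 < 1 + x by rewrite ltr_wpDr.
  rewrite -(ler_pM2r x1) mul1r mulrDl divfK ?gt_eqF//.
  have : 1 <= k%:R :> R by rewrite ler1n.
  by nra.
have psi0 e : 0 < e -> exists B : R, forall x, B <= x -> 0 <= x -> `|psi x| <= e.
  move=> e0; have [C C0 gC] := gauss_decay 1; exists (M * C / e) => x xB x0.
  have x1 : 0 < 1 + x by rewrite ltr_wpDr.
  rewrite ger0_norm; last first.
    by rewrite !mulr_ge0 ?(ltW (gauss_gt0 x)) ?invr_ge0 ?exprn_ge0 ?addr_ge0.
  apply: (@le_trans _ _ (M * gauss x)).
    rewrite ler_wpM2r ?(ltW (gauss_gt0 x))// ler_piMr// invf_le1 ?exprn_gt0//.
    by rewrite exprn_ege1// lerDl.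
  rewrite -(ler_pM2r x1) -mulrA; apply: (@le_trans _ _ (M * C)).
    by rewrite ler_wpM2l// mulrC; have := gC x; rewrite expr1 ger0_norm.
  rewrite -[M * C](@divfK _ e) ?gt_eqF// mulrC ler_pM2l// (le_trans xB)//.
  by rewrite lerDr.
(* psi - s P is decreasing and tends to 0, so it is nonnegative; s = 1 and s = -1 together bound
   |P|. *)
have side (s : R) : `|s| = 1 -> forall x, 0 <= x -> 0 <= psi x - s * P x.
  move=> s1; apply: (@ge0_at_infinity _ (fun x => psi x - s * P x) (fun x => dpsi x - s * q x) 0).
  - move=> x x0; have d1 := dpsiP x x0; have d2 := dP x.
    have -> : (fun x => psi x - s * P x) = psi - (s *: P) by apply/funext.
    exact: is_derive_eq.
  - move=> x /key; rewrite lerNr => h; rewrite subr_le0 (le_trans h)//.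
    by rewrite lerNl (le_trans (ler_norm _))// normrN normrM s1 mul1r.
  - move=> e e0; have e2 : 0 < e / 2 by rewrite divr_gt0.
    have [B PB] := P0 _ e2; have [C psiC] := psi0 _ e2.
    exists (Num.max 0 (Num.max B C)) => x; rewrite !ge_max => /and3P[x0 xB xC].
    rewrite (le_trans (ler_normB _ _))// [leRHS]splitr lerD//; first exact: psiC.
    by rewrite normrM s1 mul1r PB.
move=> x x0; rewrite ler_norml -/(psi x).
have := side 1 (normr1 _) x x0; have := side (-1) _ x x0.
by rewrite normrN1 => /(_ erefl); rewrite mulN1r mul1r => h1 h2; apply/andP; split; lra.
Qed.

Lemma derive_recursion (a b c : R -> R) (da db dc k x : R) :
  is_derive x 1 a da -> is_derive x 1 b db -> is_derive x 1 c dc ->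
  is_derive x 1 (fun t => t * a t + k * b t - c t) (a x + x * da + k * db - dc).
Proof.
move=> d1 d2 d3; have -> : (fun t => t * a t + k * b t - c t) = id * a + k *: b - c.
  by apply/funext.
have h := is_deriveB (is_deriveD (is_deriveM (is_derive_id x 1) d1) (is_deriveZ k d2)) d3.
apply: (is_derive_eq h); rewrite /GRing.scale/=.
by rewrite mulr1 [_ + a x]addrC.
Qed.

(* u(x) = - exp(x^2/2) * (the integral of f(s) exp(-s^2/2) over s <= x). *)
Lemma solve_creation f : I1 (f ** gauss1) = 0 -> exists u : schwartz R 1,
  smulX ord0 u - sderive [:: ord0] u = f.
Proof.
move=> If0; have [P [dP tP]] := primR (f ** gauss1); have [Q [dQ tQ]] := primI (f ** gauss1).
rewrite If0 in tP tQ.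
pose E (x : R) := (gauss x)^-1.
have gn x : gauss x != 0 by rewrite gt_eqF ?gauss_gt0.
have dE x : is_derive x 1 E (x * E x).
  have d := @is_deriveV _ gauss _ _ _ (gn x) (derive_gauss x).
  apply: is_derive_eq; rewrite /E -[_ *: _]/(_ * _); field; exact: gn.
pose v x : R[i] := (- (E x * P x)) +i* (- (E x * Q x)).
have vR x : is_derive x 1 (fun t => Re (v t)) (Re (x%:C * v x - f (pt x))).
  have d1 := dE x; have d2 := dP x.
  have -> : (fun t => Re (v t)) = - (E * P) by apply/funext.
  apply: is_derive_eq; rewrite -![_ *: _]/(_ * _) ReB ReRM schwartz_mulE gauss1E.
  rewrite Defs.ReM /= mulr0 subr0 /E; field; exact: gn.
have vI x : is_derive x 1 (fun t => Im (v t)) (Im (x%:C * v x - f (pt x))).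
  have d1 := dE x; have d2 := dQ x.
  have -> : (fun t => Im (v t)) = - (E * Q) by apply/funext.
  apply: is_derive_eq; rewrite -![_ *: _]/(_ * _) ImB ImRM schwartz_mulE gauss1E.
  rewrite Defs.ImM /= mulr0 add0r /E; field; exact: gn.
(* The integral of f times the Gaussian is 0, so its primitive vanishes at both ends and
   [gauss_tail] applies on each half-line, after a reflection on the left. *)
have tail_both (P0 q : R -> R) (M : R) k : (0 < k)%N -> (forall x, is_derive x 1 P0 (q x)) ->
    (forall x, `|q x| <= M * (1 + `|x|) ^- k * gauss x) -> tails P0 0 ->
    forall x, `|P0 x| <= M * (1 + `|x|) ^- k * gauss x.
  move=> k0 dP0 qM tP0 x; case: (leP 0 x) => [x0|/ltW x0].
    have := @gauss_tail P0 q M k k0 dP0; rewrite (ger0_norm x0); apply => //.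
      by move=> t t0; have := qM t; rewrite (ger0_norm t0).
    move=> e /tP0[B [_ PB]]; exists B => t /PB.
    by rewrite sub0r normrN.
  have := @gauss_tail (fun t => P0 (- t)) (fun t => - q (- t)) M k k0.
  have -> : gauss x = gauss (- x) by rewrite /gauss sqrrN.
  have x0' : 0 <= - x by rewrite oppr_ge0.
  move=> /(_ _ _ _ (- x) x0'); rewrite opprK (ler0_norm x0); apply.
  - by move=> t; exact: derive_reflect.
  - move=> t t0; have := qM (- t); rewrite normrN normrN (ger0_norm t0).
    by rewrite /gauss sqrrN.
  - by move=> e /tP0[B [PB _]]; exists B => t; rewrite -lerN2 => /PB.
(* [gauss_tail] demands a positive exponent, hence j + 1; the factor [E] cancels the Gaussian and
   the decay of f remains. *)
have vdecay j : exists M : R, forall x, normc (v x) * (1 + `|x|) ^+ j <= M.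
  have [M fM] := schwartz_bound f j.+1 [::].
  have W0 x : 0 < 1 + `|x| by rewrite ltr_wpDr.
  have fg x : normc ((f ** gauss1) (pt x)) <= M * (1 + `|x|) ^- j.+1 * gauss x.
    rewrite schwartz_mulE normcM gauss1E normcR (ger0_norm (ltW (gauss_gt0 x))).
    rewrite ler_wpM2r ?(ltW (gauss_gt0 x))// ler_pdivlMr ?exprn_gt0//.
    by have := fM (pt x); rewrite enorm_pt.
  have PM := tail_both P _ M j.+1 isT dP (fun x => le_trans (normc_Re _) (fg x)) tP.
  have QM := tail_both Q _ M j.+1 isT dQ (fun x => le_trans (normc_Im _) (fg x)) tQ.
  have M0 : 0 <= M.
    by apply: le_trans (fM 0); rewrite mulr_ge0 ?normc_ge0 ?weight_ge0.
  exists (M + M) => x; apply: (@le_trans _ _ ((M + M) * (1 + `|x|) ^- j.+1 * (1 + `|x|) ^+ j)).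
    rewrite ler_wpM2r ?exprn_ge0 ?(ltW (W0 x))// (le_trans (normc_ReIm _))//= !normrN.
    rewrite !normrM (ger0_norm (_ : 0 <= E x)); last by rewrite invr_ge0 ltW ?gauss_gt0.
    rewrite !mulrDl; apply: lerD; rewrite /E ler_pdivrMl ?gauss_gt0// mulrC.
      exact: PM.
    exact: QM.
  rewrite exprS -mulrA ler_piMr ?addr_ge0// invfM -mulrA mulVf ?mulr1; last first.
    by rewrite expf_neq0// gt_eqF.
  by rewrite invf_le1// lerDl.
pose fd k x := pderives (nseq k ord0) f (pt x).
(* Differentiating u' = x u - f gives u^(k+1) = x u^(k) + k u^(k-1) - f^(k). The recursion has two
   steps, so [g2 k] carries the candidates for u^(k) and u^(k+1). *)
pose g2 := fix g2 k : (R -> R[i]) * (R -> R[i]) := if k is k'.+1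
  then ((g2 k').2, fun x => x%:C * (g2 k').2 x + (k'.+1)%:R * (g2 k').1 x - fd k'.+1 x)
  else (v, fun x => x%:C * v x - f (pt x)).
pose g k := (g2 k).1.
have gS k : g k.+1 = fun x => x%:C * g k x + k%:R * g k.-1 x - fd k x.
  by case: k => [|k] //=; apply/funext => x; rewrite mul0r addr0.
have g0 : g 0%N = v by [].
have g1 : g 1%N = fun x => x%:C * v x - f (pt x) by [].
clearbody g.
have gD k : ((forall x, is_derive x 1 (fun t => Re (g k t)) (Re (g k.+1 x))) /\
     (forall x, is_derive x 1 (fun t => Im (g k t)) (Im (g k.+1 x)))) /\
    ((forall x, is_derive x 1 (fun t => Re (g k.-1 t)) (Re (g k.-1.+1 x))) /\
     (forall x, is_derive x 1 (fun t => Im (g k.-1 t)) (Im (g k.-1.+1 x)))).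
  elim: k => [|k [[IR II] [JR JI]]] /=; first by rewrite g1 g0.
  have kE x : k%:R * g k.-1.+1 x = k%:R * g k x by case: (k) => //; rewrite !mul0r.
  have kR : k%:R = (k%:R : R)%:C by rewrite rmorph_nat.
  split=> //; split=> x.
  - have -> : (fun t => Re (g k.+1 t)) = (fun t => t * Re (g k t) + k%:R * Re (g k.-1 t) -
        Re (fd k t)) by apply/funext => t; rewrite gS ReB Defs.ReD kR !ReRM.
    apply: (is_derive_eq (derive_recursion k%:R (IR x) (JR x) (derive_ptR f (nseq k ord0) x))).
    rewrite (gS k.+1) ReB; congr (_ - _).
    rewrite (_ : (k.+1)%:R * g k.+1.-1 x = g k x + k%:R * g k.-1.+1 x); last first.
      by rewrite kE /= -natr1; ring.
    by rewrite !Defs.ReD kR !ReRM; ring.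
  - have -> : (fun t => Im (g k.+1 t)) = (fun t => t * Im (g k t) + k%:R * Im (g k.-1 t) -
        Im (fd k t)) by apply/funext => t; rewrite gS ImB Defs.ImD kR !ImRM.
    apply: (is_derive_eq (derive_recursion k%:R (II x) (JI x) (derive_ptI f (nseq k ord0) x))).
    rewrite (gS k.+1) ImB; congr (_ - _).
    rewrite (_ : (k.+1)%:R * g k.+1.-1 x = g k x + k%:R * g k.-1.+1 x); last first.
      by rewrite kE /= -natr1; ring.
    by rewrite !Defs.ImD kR !ImRM; ring.
have gM k : (forall j, exists M : R, forall x, normc (g k x) * (1 + `|x|) ^+ j <= M) /\
    (forall j, exists M : R, forall x, normc (g k.-1 x) * (1 + `|x|) ^+ j <= M).
  elim: k => [|k [IH JH]] /=; first by rewrite g0.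
  split=> // j; have [M1 h1] := IH j.+1; have [M2 h2] := JH j.
  have [M3 h3] := schwartz_bound f j (nseq k ord0).
  exists (M1 + k%:R * M2 + M3) => x; rewrite gS.
  have W0 : 0 <= (1 + `|x|) ^+ j by rewrite exprn_ge0// addr_ge0.
  apply: le_trans (ler_wpM2r W0 (le_normcD _ _)) _; rewrite mulrDl lerD//; last first.
    by rewrite normcN; have := h3 (pt x); rewrite enorm_pt.
  apply: le_trans (ler_wpM2r W0 (le_normcD _ _)) _; rewrite mulrDl lerD//.
    rewrite normcM normcR; apply: le_trans (h1 x); rewrite exprS mulrCA -mulrA mulrCA.
    by rewrite [leRHS]mulrCA ler_wpM2r ?mulr_ge0 ?normc_ge0// lerDr.
  rewrite normcM (_ : k%:R = (k%:R : R)%:C); last by rewrite rmorph_nat.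
  by rewrite normcR ger0_norm// -mulrA ler_wpM2l.
have [|||u uE] := @schwartz_family1 R g.
- by move=> k; have [[]] := gD k.
- by move=> k; have [[]] := gD k.
- by move=> j k; have [] := gM k.
exists u; apply: eq_pt => x; rewrite schwartzBE smulXE pt00.
rewrite -[sderive _ _ _]/(pderives [:: ord0] u (pt x)) uE.
rewrite -[u (pt x)]/(pderives [::] u (pt x)) uE /= g1 g0; ring.
Qed.

End Gaussian.

(** * Ladder operators, Hermite functions and the spectral gap *)

Section Hermite.
Context {R : realType}.
Implicit Types (f g r : schwartz R 1) (x : R).

Local Notation sX := (@smulX R 1 ord0).
Local Notation sD := (@sderive R 1 [:: ord0]).

Lemma sX_linear : linear sX.
Proof. by have /asboolP[l _] := @smulX_bhom R 1 ord0. Qed.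
Lemma sX_bounded : bounded_map sX.
Proof. by have /asboolP[_ b] := @smulX_bhom R 1 ord0. Qed.

(** The annihilation operator x + d/dx; [raise] is the creation operator. Without the usual factors
    1 / sqrt 2 their commutator is 2. *)
Definition lower f := sX f + sD f.
Definition raise f := sX f - sD f.

Lemma sXE f x : sX f (pt x) = x%:C * f (pt x).
Proof. by rewrite smulXE pt00. Qed.
Lemma sDE f v : sD f v = pderives [:: ord0] f v. Proof. by []. Qed.

Lemma lowerE f v : lower f v = sX f v + sD f v. Proof. by []. Qed.
Lemma raiseE f v : raise f v = sX f v - sD f v. Proof. by []. Qed.

Lemma lower_linear : linear lower.
Proof.
by move=> a f g; rewrite /lower sX_linear sderive_linear scalerDr addrACA.
Qed.
Lemma raise_linear : linear raise.
Proof.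
by move=> a f g; rewrite /raise sX_linear sderive_linear scalerBr opprD addrACA.
Qed.

Lemma sXB f g : sX (f - g) = sX f - sX g.
Proof. by rewrite addrC -scaleN1r sX_linear scaleN1r addrC. Qed.
Lemma sXD f g : sX (f + g) = sX f + sX g.
Proof. by rewrite -[f]scale1r sX_linear !scale1r. Qed.
Lemma sDB f g : sD (f - g) = sD f - sD g.
Proof. by rewrite addrC -scaleN1r sderive_linear scaleN1r addrC. Qed.
Lemma sDD f g : sD (f + g) = sD f + sD g.
Proof. by rewrite -[f]scale1r sderive_linear !scale1r. Qed.

Lemma sDX f : sD (sX f) = f + sX (sD f).
Proof.
by apply: schwartz_eq => v; rewrite sDE pderive1_smulX mul1r schwartzDE smulXE.
Qed.

Lemma lower_raise f : lower (raise f) = raise (lower f) + (2 : R)%:C *: f.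
Proof.
rewrite /lower /raise sXB sDB sXD sDD sDX; apply: schwartz_eq => v.
move: (sX (sX f)) (sX (sD f)) (sD (sD f)) => p q s.
rewrite !(schwartzDE, schwartzNE, schwartzZE) rmorph_nat.
by move: (p v) (q v) (s v) (f v) => *; ring.
Qed.

(** Bilinear, without conjugation, so that coefficients are complex linear; the Hermite functions
    are real by [sconj_herm]. *)
Definition pairing f g : R[i]^o := I1 (f ** g).
Local Notation B := pairing.

Lemma pairing_linear g : linear (B^~ g).
Proof. by move=> a f h; rewrite /pairing amul_linearl I1_linear. Qed.

Lemma pairingC f g : B f g = B g f. Proof. by rewrite /pairing schwartz_mulC. Qed.

Lemma pairing_X f g : B (sX f) g = B f (sX g).
Proof.
rewrite /pairing; congr I1; apply: schwartz_eq => v.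
by rewrite !schwartz_mulE !smulXE; ring.
Qed.

Lemma pairing_D f g : B (sD f) g = - B f (sD g).
Proof.
apply/eqP; rewrite -addr_eq0 -[_ + _](functionalD I1_linear) -(I1_derive (f ** g)).
by apply/eqP; congr I1; apply: schwartz_eq => v; rewrite sDE pderive1_mul.
Qed.

Lemma pairing_raise f g : B (raise f) g = B f (lower g).
Proof.
rewrite /raise /lower (functionalB (pairing_linear g)) pairing_X pairing_D opprK.
by rewrite !(pairingC f) (functionalD (pairing_linear f)).
Qed.

Lemma pairing_lower f g : B (lower f) g = B f (raise g).
Proof. by rewrite pairingC -pairing_raise pairingC. Qed.

Lemma sconj_raise g : sconj (raise g) = raise (sconj g).
Proof.
apply: eq_pt => x; rewrite sconjE !raiseE conjB !sXE !sDE pderives_sconj conjM sconjE.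
by congr (_ * _ - _); apply: complexP; rewrite //= oppr0.
Qed.

Lemma sconj_lower g : sconj (lower g) = lower (sconj g).
Proof.
apply: eq_pt => x; rewrite sconjE !lowerE -[X in conj (_ + X)]opprK conjB !sXE !sDE.
rewrite pderives_sconj conjM sconjE -[X in _ = _ + X]opprK.
by congr (_ * _ - _); apply: complexP; rewrite //= ?oppr0.
Qed.

(** The real part of the Hermitian inner product: a real inner product, which is what the norm
    estimates use. *)
Definition ip f g : R := Re (B f (sconj g)).

Lemma ip_raise f g : ip (raise f) g = ip f (lower g).
Proof. by rewrite /ip pairing_raise sconj_lower. Qed.

Lemma ipD f g h : ip (f + g) h = ip f h + ip g h.
Proof. by rewrite /ip (functionalD (pairing_linear _)) Defs.ReD. Qed.
Lemma ipZ (t : R) f h : ip (t%:C *: f) h = t * ip f h.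
Proof. by rewrite /ip (functionalZ (pairing_linear _)) ReRM. Qed.

Lemma sconjK f : sconj (sconj f) = f.
Proof.
apply: schwartz_eq => v; rewrite !sconjE; apply: complexP => //=.
by rewrite opprK.
Qed.

Lemma sconj_mul f g : sconj (f ** g) = sconj f ** sconj g.
Proof. by apply: schwartz_eq => v; rewrite schwartz_mulE !sconjE conjM. Qed.

Lemma pairing_conj f g : B (sconj f) (sconj g) = conj (B f g).
Proof. by rewrite /pairing -sconj_mul I1_conj. Qed.

Lemma ipC f g : ip f g = ip g f.
Proof. by rewrite /ip -{1}(sconjK f) pairing_conj pairingC. Qed.

Lemma ip_density f v : Re ((f ** sconj f) v) = normc (f v) ^+ 2.
Proof.
rewrite schwartz_mulE sconjE Defs.ReM /=; case: (f _) => a b /=.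
by rewrite sqr_sqrtr ?addr_ge0 ?sqr_ge0// mulrN opprK.
Qed.

Lemma ip_ge0 f : 0 <= ip f f.
Proof. by apply: I1_ge0 => x; rewrite ip_density sqr_ge0. Qed.

Lemma ip_square (t : R) f g : ip (f + t%:C *: g) (f + t%:C *: g) =
  ip f f + 2 * t * ip f g + t ^+ 2 * ip g g.
Proof.
rewrite ipD ipZ (ipC f (f + _)) (ipC g (f + _)) !ipD !ipZ (ipC g f).
by move: (ip f f) (ip f g) (ip g g) => *; ring.
Qed.

Lemma cauchy_schwarz f g : ip f g ^+ 2 <= ip f f * ip g g.
Proof.
have H (t : R) : 0 <= ip f f + 2 * t * ip f g + t ^+ 2 * ip g g.
  by rewrite -ip_square ip_ge0.
have [g0|g0] := eqVneq (ip g g) 0.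
  rewrite g0 mulr0; suff -> : ip f g = 0 by rewrite expr0n.
  (* If ||g|| = 0 the quadratic is affine in t, and for a nonzero [ip f g] this t gives it the value
     -1. *)
  have := H (- (ip f f + 1) / (2 * ip f g)); rewrite g0 mulr0 addr0.
  have [->//|fg0] := eqVneq (ip f g) 0.
  rewrite (_ : 2 * _ * _ = - (ip f f + 1)); last by field; rewrite fg0.
  by rewrite opprD addrA subrr add0r oppr_ge0 ler10.
have gp : 0 < ip g g by rewrite lt_neqAle eq_sym g0 ip_ge0.
have := H (- ip f g / ip g g).
rewrite (_ : _ + _ = (ip f f * ip g g - ip f g ^+ 2) / ip g g); last by field.
by rewrite pmulr_lge0 ?invr_gt0// subr_ge0.
Qed.

Lemma derive_gauss1 : sD gauss1 = - sX gauss1.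
Proof.
apply: eq_pt => x; rewrite schwartzNE sXE sDE.
have gR : (fun t => Re (gauss1 (pt t))) = @gauss R by apply/funext => t; rewrite gauss1E.
have gI : (fun t => Im (gauss1 (pt t))) = cst (0 : R) by apply/funext => t; rewrite gauss1E.
have dR := derive_ptR gauss1 [::] x; have dI := derive_ptI gauss1 [::] x.
apply: complexP.
  rewrite -(derive_val (is_derive := dR)) [X in 'D__ X _]gR gauss1E.
  by rewrite (derive_val (is_derive := derive_gauss x)) /= mul0r subr0 mulNr.
rewrite -(derive_val (is_derive := dI)) [X in 'D__ X _]gI derive_val gauss1E.
by rewrite /= mulr0 mul0r addr0 oppr0.
Qed.

Lemma lower_gauss : lower gauss1 = 0.
Proof. by rewrite /lower derive_gauss1 subrr. Qed.

Lemma sconj_gauss : sconj (@gauss1 R) = gauss1.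
Proof. by apply: eq_pt => x; rewrite sconjE gauss1E; apply: complexP; rewrite //= oppr0. Qed.

Definition mass : R := ip gauss1 gauss1.

Lemma mass_gt0 : 0 < mass.
Proof.
rewrite lt_neqAle ip_ge0 andbT eq_sym; apply/eqP => m0.
have := @I1_eq0 R (gauss1 ** sconj gauss1) _ m0 0; rewrite ip_density => H.
have /H/eqP : forall x, 0 <= Re ((gauss1 ** sconj gauss1) (@pt R x)).
  by move=> x; rewrite ip_density sqr_ge0.
by rewrite sqrf_eq0 gauss1E normcR normr_eq0 gt_eqF// gauss_gt0.
Qed.

Lemma pairing_gauss : B gauss1 gauss1 = mass%:C.
Proof.
have E : conj (B gauss1 gauss1) = B gauss1 gauss1 by rewrite -pairing_conj sconj_gauss.
apply: complexP; first by rewrite /mass /ip sconj_gauss.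
by have := congr1 (@complex.Im R) E; case: (B _ _) => a b /=; lra.
Qed.

(** Its square 2 (k + 1) is the eigenvalue of lower o raise on the k-th Hermite function. *)
Definition rung k : R := Num.sqrt (2 * k.+1%:R).
Lemma rung_gt0 k : 0 < rung k. Proof. by rewrite sqrtr_gt0 mulr_gt0. Qed.
Lemma rung_sqr k : rung k ^+ 2 = 2 * k.+1%:R. Proof. by rewrite sqr_sqrtr ?mulr_ge0. Qed.
Lemma rung_neq0 k : (rung k)%:C != 0 :> R[i].
Proof. by rewrite fmorph_eq0 gt_eqF// rung_gt0. Qed.

(** Dividing by [rung k] keeps the squared norm equal to [mass], that of the Gaussian; [coef]
    divides by [mass] accordingly. *)
Fixpoint herm k : schwartz R 1 :=
  if k is k.+1 then ((rung k)^-1)%:C *: raise (herm k) else gauss1.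

Lemma raise_herm k : raise (herm k) = (rung k)%:C *: herm k.+1.
Proof. by rewrite /= scalerA -rmorphM divff ?gt_eqF ?rung_gt0// scale1r. Qed.

Lemma lower_herm k : lower (herm k.+1) = (rung k)%:C *: herm k.
Proof.
have step : raise (lower (herm k)) = (2 * k%:R)%:C *: herm k.
  elim: k => [|k IH]; first by rewrite lower_gauss mulr0 scale0r (linmap0 raise_linear).
  have lk : lower (herm k.+1) = (rung k)%:C *: herm k.
    rewrite /= (linmapZ lower_linear) lower_raise IH.
    rewrite -scalerDl -rmorphD scalerA.
    rewrite -rmorphM; congr (_%:C *: _).
    rewrite -[X in _ * (_ + X)]mulr1 -mulrDr natr1 -rung_sqr expr2 mulKf//.
    by rewrite gt_eqF ?rung_gt0.
  by rewrite lk (linmapZ raise_linear) raise_herm scalerA -rmorphM -expr2 rung_sqr.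
rewrite /= (linmapZ lower_linear) lower_raise step.
rewrite -scalerDl -rmorphD scalerA.
rewrite -rmorphM; congr (_%:C *: _).
rewrite -[X in _ * (_ + X)]mulr1 -mulrDr natr1 -rung_sqr expr2 mulKf//.
by rewrite gt_eqF ?rung_gt0.
Qed.

Lemma number_herm k : raise (lower (herm k)) = (2 * k%:R)%:C *: herm k.
Proof.
case: k => [|k]; first by rewrite lower_gauss mulr0 scale0r (linmap0 raise_linear).
by rewrite lower_herm (linmapZ raise_linear) raise_herm scalerA -rmorphM -expr2 rung_sqr.
Qed.

Lemma sconj_herm k : sconj (herm k) = herm k.
Proof.
elim: k => [|k IH] /=; first exact: sconj_gauss.
apply: eq_pt => x; rewrite sconjE !schwartzZE conjM -sconjE sconj_raise IH.
by congr (_ * _); apply: complexP; rewrite //= oppr0.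
Qed.

Lemma pairing_herm j k : B (herm j) (herm k) = ((j == k)%:R * mass)%:C.
Proof.
have lin0 (g : schwartz R 1) : B 0 g = 0 by exact: (linmap0 (pairing_linear g)).
elim: j k => [|j IH] [|k].
- by rewrite mul1r pairing_gauss.
- rewrite mul0r /= pairingC (functionalZ (pairing_linear _)) pairing_raise.
  by rewrite lower_gauss pairingC lin0 mulr0.
- rewrite mul0r /= (functionalZ (pairing_linear _)) pairing_raise.
  by rewrite lower_gauss pairingC lin0 mulr0.
rewrite [herm j.+1]/= (functionalZ (pairing_linear _)) pairing_raise lower_herm pairingC.
rewrite (functionalZ (pairing_linear _)) pairingC IH eqSS -!rmorphM; congr (_%:C).
have [->|] := eqVneq j k; last by rewrite mul0r !mulr0.
by rewrite mulKf// gt_eqF ?rung_gt0.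
Qed.

Definition coef k f : R[i]^o := (mass^-1)%:C * B f (herm k).

Lemma coef_linear k : linear (coef k).
Proof.
move=> a f g; rewrite /coef pairing_linear mulrDr.
by congr (_ + _); rewrite -[_ *: _]/(_ * _) mulrCA.
Qed.

Definition remainder N f := f - \sum_(k < N) coef k f *: herm k.

Lemma remainder_ortho N f k : (k < N)%N -> B (remainder N f) (herm k) = 0.
Proof.
move=> kN; rewrite (functionalB (pairing_linear _)) (functional_sum (pairing_linear _)).
rewrite (bigD1 (Ordinal kN))//= (functionalZ (pairing_linear _)) pairing_herm eqxx mul1r.
rewrite big1 => [|j jk].
  by rewrite addr0 /coef mulrAC -rmorphM mulVf ?gt_eqF ?mass_gt0// mul1r subrr.
rewrite (functionalZ (pairing_linear _)) pairing_herm.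
by rewrite (negbTE (_ : nat_of_ord j != k)) ?mul0r ?mulr0.
Qed.

(** In [gap], a, b, c, d are the squared norms of r, lower r, u, lower u. From a >= 2 (N + 1) c and
    a^2 <= b c follows 2 (N + 1) a^2 <= b a; divide by a. *)
Let gap_arith (N : nat) (a b c d : R) : 0 <= a -> 0 <= b -> 2 * N%:R * c <= d ->
  a = d + 2 * c -> a ^+ 2 <= b * c -> 2 * N.+1%:R * a <= b.
Proof.
move=> a0 b0 cd ad ab.
have key : 2 * N.+1%:R * c <= a by rewrite ad -natr1; lra.
have [->|an] := eqVneq a 0; first by rewrite mulr0.
have ap : 0 < a by rewrite lt_neqAle eq_sym an.
rewrite -(ler_pM2r ap) (_ : _ * a * a = 2 * N.+1%:R * a ^+ 2); last by ring.
apply: (@le_trans _ _ (2 * N.+1%:R * (b * c))); first by rewrite ler_wpM2l// mulr_ge0.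
by rewrite mulrCA ler_wpM2l.
Qed.

(* If r is orthogonal to the first N Hermite functions then r = raise u with u
   orthogonal to the first N - 1. *)
Lemma gap N r : (forall k, (k < N)%N -> B r (herm k) = 0) ->
  2 * N%:R * ip r r <= ip (lower r) (lower r).
Proof.
elim: N r => [|N IH] r rN; first by rewrite mulr0 mul0r ip_ge0.
have [u uE] := solve_creation (rN 0%N isT); rewrite -/(raise u) in uE.
have uN k : (k < N)%N -> B u (herm k) = 0.
  move=> kN; have := rN k.+1; rewrite ltnS => /(_ kN); rewrite -uE pairing_raise lower_herm.
  rewrite pairingC (functionalZ (pairing_linear _)) pairingC => /eqP.
  by rewrite mulf_eq0 (negbTE (rung_neq0 k)) => /eqP.
have {}IH := IH u uN.
(* [raise] and [lower] are adjoint with commutator 2, so ||raise u||^2 = ||lower u||^2 + 2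
   ||u||^2. *)
have rr : ip r r = ip (lower u) (lower u) + 2 * ip u u.
  rewrite -{1}uE ip_raise -uE lower_raise ipC ipD ip_raise.
  by rewrite ipZ.
have cs : ip r r ^+ 2 <= ip (lower r) (lower r) * ip u u.
  have -> : ip r r = ip u (lower r) by rewrite -{1}uE ip_raise.
  by rewrite mulrC cauchy_schwarz.
exact: (gap_arith (ip_ge0 r) (ip_ge0 (lower r)) IH rr cs).
Qed.

Lemma ip_herm_remainder N f k (c : R[i]) : (k < N)%N -> ip (c *: herm k) (remainder N f) = 0.
Proof.
move=> kN; rewrite /ip (functionalZ (pairing_linear _)) -(sconj_herm k) pairing_conj.
by rewrite pairingC remainder_ortho// /conj /= oppr0 mulr0.
Qed.

Lemma lower_remainder N f : raise (lower (remainder N f)) =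
  raise (lower f) - \sum_(k < N) (coef k f * (2 * k%:R)%:C) *: herm k.
Proof.
have lin : linear (raise \o lower) by move=> a g h /=; rewrite lower_linear raise_linear.
rewrite -[LHS]/((raise \o lower) _) (linmapB lin) (linmap_sum lin); congr (_ - _).
by apply: eq_bigr => k _; rewrite (linmapZ lin) /= number_herm scalerA.
Qed.

(** raise o lower is diagonal on Hermite functions, so the part subtracted from f stays orthogonal
    to the remainder. *)
Lemma remainder_energy N f :
  ip (lower (remainder N f)) (lower (remainder N f)) = ip (raise (lower f)) (remainder N f).
Proof.
set r := remainder N f; rewrite -ip_raise lower_remainder.
have linr : forall g h, ip (g - h) r = ip g r - ip h r.
  by move=> g h; rewrite -scaleN1r ipD -[-1](rmorphN1 (real_complex R)) ipZ mulN1r.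
rewrite linr; suff -> : ip (\sum_(k < N) (coef k f * (2 * k%:R)%:C) *: herm k) r = 0.
  by rewrite subr0.
elim/big_ind: _ => [|g h gr hr|k _].
- by have := ipZ 0 0 r; rewrite scaler0 mul0r.
- by rewrite ipD gr hr addr0.
- exact: ip_herm_remainder.
Qed.

(** In [remainder_bound], a, b, h are the squared norms of lower r, r and raise (lower f): the gap
    bounds b by a, Cauchy-Schwarz bounds a^2 by h b. *)
Let energy_arith (N : nat) (a b h : R) : 0 <= a -> 0 <= b -> (0 < N)%N ->
  2 * N%:R * b <= a -> a ^+ 2 <= h * b -> 0 <= h -> a <= h / N%:R /\ b <= h / N%:R.
Proof.
move=> a0 b0 N0 ba ah h0.
have n1 : 1 <= N%:R :> R by rewrite ler1n.
have np : 0 < N%:R :> R by rewrite (lt_le_trans ltr01).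
have aN : a <= h / N%:R.
  rewrite ler_pdivlMr//; have [->|an] := eqVneq a 0; first by rewrite mul0r.
  have ap : 0 < a by rewrite lt_neqAle eq_sym an.
  rewrite -(ler_pM2l ap) mulrA -expr2; apply: (@le_trans _ _ (h * b * N%:R)).
    by rewrite ler_wpM2r// ltW.
  rewrite -mulrA [leRHS]mulrC ler_wpM2l// (le_trans _ ba)// mulrC.
  by rewrite ler_wpM2r// ler_peMl// ?ler1n// ltW.
split=> //; apply: le_trans aN; apply: le_trans ba; rewrite ler_peMl//.
by nra.
Qed.

Lemma ip_derive f : ip (sD f) (sD f) <= ip (lower f) (lower f) + ip (raise f) (raise f).
Proof.
have E : (2 : R)%:C *: sD f = lower f - raise f.
  apply: schwartz_eq => v; rewrite /lower /raise; move: (sX f) (sD f) => p q.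
  rewrite !(schwartzDE, schwartzNE, schwartzZE) rmorph_nat.
  by move: (p v) (q v) => *; ring.
have E2 : (2 : R)%:C *: sD f = lower f + (-1 : R)%:C *: raise f.
  by rewrite E (rmorphN1 (real_complex R)) scaleN1r.
have h1 : 4 * ip (sD f) (sD f) = ip (lower f) (lower f) + 2 * (-1) * ip (lower f) (raise f) +
    (-1) ^+ 2 * ip (raise f) (raise f).
  rewrite -ip_square -E2 ipZ ipC ipZ mulrA; congr (_ * _); ring.
have h2 := ip_ge0 (lower f + (1 : R)%:C *: raise f); rewrite ip_square in h2.
have := ip_ge0 (lower f); have := ip_ge0 (raise f); move: h1 h2.
move: (ip (sD f) (sD f)) (ip (lower f) (lower f)) (ip (raise f) (raise f)) (ip (lower f) (raise f)).
by move=> a b c d; lra.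
Qed.

Lemma ip_raise_self f : ip (raise f) (raise f) = ip (lower f) (lower f) + 2 * ip f f.
Proof. by rewrite ip_raise lower_raise ipC ipD ip_raise ipZ. Qed.

Lemma remainder_bound f : exists2 C : R, 0 <= C & forall N x, (0 < N)%N ->
  normc (remainder N f (pt x)) ^+ 2 <= C / N%:R.
Proof.
pose h := ip (raise (lower f)) (raise (lower f)).
(* Sobolev, [ip_derive] and [ip_raise_self] give ||r||^2 + 2 ||lower r||^2 + 2 ||r||^2, and each of
   these five squares is at most h / N. *)
exists (5 * h) => [|N x N0]; first by rewrite mulr_ge0 ?ip_ge0.
apply: le_trans (sobolev _ x) _; set r := remainder N f.
rewrite -[Re (I1 (r ** _))]/(ip r r) -[Re _]/(ip (sD r) (sD r)).
have cs : ip (lower r) (lower r) ^+ 2 <= h * ip r r.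
  by rewrite remainder_energy cauchy_schwarz.
have [aN bN] := energy_arith (ip_ge0 (lower r)) (ip_ge0 r) N0
  (gap (fun k => @remainder_ortho N f k)) cs (ip_ge0 _).
have := ip_derive r; rewrite ip_raise_self.
move: aN bN; rewrite -mulrA; move: (ip r r) (ip (lower r) (lower r)) (ip (sD r) (sD r)) (h / N%:R).
by move=> a b c d; lra.
Qed.

End Hermite.

(** * Growth of Hermite functions and decay of coefficients *)

Section HermiteBounds.
Context {R : realType}.
Implicit Types (f g : schwartz R 1) (x : R).

Local Notation sX := (@smulX R 1 ord0).
Local Notation sD := (@sderive R 1 [:: ord0]).

Lemma ip_herm k : ip (herm k) (herm k) = mass :> R.
Proof. by rewrite /ip sconj_herm pairing_herm eqxx mul1r. Qed.

Lemma ip_derive_herm k : ip (sD (herm k)) (sD (herm k)) <= (4 * k%:R + 2) * mass :> R.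
Proof.
apply: le_trans (ip_derive _) _; rewrite ip_raise_self.
have -> : ip (lower (herm k)) (lower (herm k)) = 2 * k%:R * mass :> R.
  by rewrite -ip_raise number_herm ipZ ip_herm.
rewrite ip_herm le_eqVlt; apply/orP; left; apply/eqP.
by move: (k%:R : R) (@mass R) => *; ring.
Qed.

(** Weakens a square-root bound to a linear one, so that all growth in k is polynomial with natural
    exponents. *)
Let square_le (m a s : R) : 0 <= m -> 1 <= a -> 0 <= s -> s ^+ 2 <= 4 * a * m ->
  s <= (1 + 4 * m) * a.
Proof.
move=> m0 a1 s0 sq; have b0 : 0 <= (1 + 4 * m) * a.
  by rewrite mulr_ge0 ?addr_ge0 ?mulr_ge0// (le_trans _ a1).
rewrite -(ler_pXn2r (ltn0Sn 1)) ?nnegrE//; apply: le_trans sq _; rewrite exprMn.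
apply: (@le_trans _ _ ((1 + 4 * m) ^+ 2 * a)).
  rewrite mulrAC ler_wpM2r ?(le_trans _ a1)//.
  by have := sqr_ge0 m; rewrite sqrrD; nra.
by rewrite ler_wpM2l ?sqr_ge0// expr2 ler_peMl// (le_trans _ a1).
Qed.

Lemma herm_sup : exists2 C : R, 0 <= C & forall k x, normc (herm k (pt x)) <= C * k.+1%:R.
Proof.
have m0 := @mass_gt0 R; exists (1 + 4 * mass) => [|k x].
  by rewrite addr_ge0 ?mulr_ge0// ltW.
apply: square_le; rewrite ?(ltW m0) ?ler1n ?normc_ge0//.
apply: (le_trans (sobolev (herm k) x)).
rewrite -[Re (I1 (herm k ** _))]/(ip _ _) -[Re _]/(ip _ _) ip_herm.
apply: (le_trans (lerD (lexx _) (ip_derive_herm k))); rewrite -[k.+1%:R]natr1.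
rewrite -subr_ge0; have -> : 4 * (k%:R + 1) * mass - (mass + (4 * k%:R + 2) * mass) = mass :> R.
  by move: (k%:R : R) (@mass R) => *; ring.
exact: ltW.
Qed.

(** The number operator plus 1: its eigenvalue on [herm k] is k + 1, the weight used for
    coefficients. *)
Definition number f : schwartz R 1 := (2^-1 : R)%:C *: raise (lower f) + f.

Lemma lower_bounded : bounded_map (@lower R).
Proof.
move=> A sA; apply: smallS (smallD (sX_bounded sA) (sderive_bounded [:: ord0] sA)).
by move=> _ [f Af <-]; exists (sX f); [exists f|exists (sD f) => //; exists f].
Qed.

Lemma raise_bounded : bounded_map (@raise R).
Proof.
move=> A sA; apply: smallS (smallD (sX_bounded sA) (smallZ (-1) (sderive_bounded [:: ord0] sA))).
move=> _ [f Af <-]; exists (sX f); first by exists f.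
exists (- sD f) => //; exists (sD f); first by exists f.
by rewrite scaleN1r.
Qed.

Lemma number_bounded : bounded_map number.
Proof.
move=> A sA; have s := smallZ (2^-1 : R)%:C (raise_bounded (lower_bounded sA)).
apply: smallS (smallD s sA) => _ [f Af <-]; exists ((2^-1 : R)%:C *: raise (lower f)).
  by exists (raise (lower f)) => //; exists (lower f) => //; exists f.
by exists f.
Qed.

Lemma coef_number k f : coef k (number f) = (k.+1%:R : R)%:C * coef k f.
Proof.
rewrite /coef /number (functionalD (pairing_linear _)) (functionalZ (pairing_linear _)).
rewrite pairing_raise pairing_lower number_herm pairingC (functionalZ (pairing_linear _)).
rewrite [pairing (herm k) f]pairingC -[k.+1%:R]natr1 rmorphD mulrA -rmorphM mulKf//.
by rewrite [_ + _ in LHS](_ : _ = (k%:R%:C + 1%:C) * pairing f (herm k)) 1?mulrCA// mulrDl mul1r.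
Qed.

Lemma coef_iter k L f : coef k (iter L number f) = (k.+1%:R ^+ L : R)%:C * coef k f.
Proof.
elim: L => [|L IH] /=; first by rewrite expr0 mul1r.
by rewrite coef_number IH mulrA -rmorphM exprS.
Qed.

Lemma coef_bound (A : set (schwartz R 1)) : small A -> exists C : R, forall f, A f ->
  forall k, normc (coef k f) <= C * k.+1%:R.
Proof.
move=> /dominated_pt[M M0 AM]; have [S S0 hS] := herm_sup; have m0 := @mass_gt0 R.
exists (mass^-1 * ((M * S + M * S) * pi)) => f /AM fM k.
rewrite /coef normcM normcR ger0_norm ?invr_ge0 ?(ltW m0)//.
rewrite -mulrA ler_wpM2l ?invr_ge0 ?(ltW m0)//.
have -> : (M * S + M * S) * pi * k.+1%:R = (M * (S * k.+1%:R) + M * (S * k.+1%:R)) * pi.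
  by ring.
apply: I1_bound => x; rewrite schwartz_mulE normcM [M * _ * _]mulrAC.
by rewrite ler_pM ?normc_ge0.
Qed.

Lemma coef_decay (A : set (schwartz R 1)) L : small A -> exists C : R, forall f, A f ->
  forall k, normc (coef k f) * k.+1%:R ^+ L <= C.
Proof.
(* One iteration beyond L absorbs the linear growth allowed by [coef_bound]. *)
move=> sA; have sI : small (iter L.+1 number @` A).
  elim: L.+1 => [|j IH]; first by rewrite image_id.
  apply: smallS (number_bounded IH) => _ [f Af <-]; exists (iter j number f) => //.
have [C CP] := coef_bound sI; exists C => f Af k.
have := CP _ (ex_intro2 _ _ f Af erefl) k; rewrite coef_iter normcM normcR.
rewrite ger0_norm ?exprn_ge0// exprSr mulrAC [_ ^+ L * _]mulrC.
by rewrite ler_pM2r.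
Qed.

Definition growth (T : schwartz R 1 -> schwartz R 1) j := exists C M, forall k x,
  normc (T (herm k) (pt x)) * (1 + `|x|) ^+ j <= C * k.+1%:R ^+ M.

Lemma growth_ge0 (T : schwartz R 1 -> schwartz R 1) (j : nat) (C : R) (M : nat) : (forall k x,
  normc (T (@herm R k) (pt x)) * (1 + `|x|) ^+ j <= C * k.+1%:R ^+ M) -> 0 <= C.
Proof.
move=> /(_ 0%N 0); rewrite normr0 addr0 !expr1n !mulr1; apply: le_trans.
exact: normc_ge0.
Qed.

Lemma rung_le k : rung k <= 2 * k.+1%:R :> R.
Proof.
have k1 : 1 <= k.+1%:R :> R by rewrite ler1n.
rewrite -(ler_pXn2r (ltn0Sn 1)) ?nnegrE ?(ltW (rung_gt0 _))// ?mulr_ge0// rung_sqr.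
by rewrite expr2; nra.
Qed.

Let natpow k M : k.+2%:R ^+ M <= 2 ^+ M * k.+1%:R ^+ M :> R.
Proof.
rewrite -exprMn lerXn2r ?nnegrE ?mulr_ge0// -!natr1.
by have : 0 <= k%:R :> R := ler0n _ _; lra.
Qed.

(** Ladder operators shift the index of [herm] at the cost of a factor [rung], so composing on the
    right preserves polynomial growth; x and d/dx are half the sum and half the difference of the
    two operators. *)
Lemma growth_raise T : linear T -> growth T 0 -> growth (T \o @raise R) 0.
Proof.
move=> lT [C [M TC]]; have C0 := growth_ge0 TC.
exists (2 * (C * 2 ^+ M)), M.+1 => k x.
rewrite expr0 mulr1 /= raise_herm (linmapZ lT) schwartzZE normcM normcR.
rewrite (ger0_norm (ltW (rung_gt0 _))) exprS.
have := TC k.+1 x; rewrite expr0 mulr1 => Tk.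
rewrite mulrACA -[C * _ * _]mulrA.
rewrite ler_pM ?normc_ge0 ?(ltW (rung_gt0 _)) ?rung_le// (le_trans Tk)//.
by rewrite ler_wpM2l// natpow.
Qed.

Lemma growth_lower T : linear T -> growth T 0 -> growth (T \o @lower R) 0.
Proof.
move=> lT [C [M TC]]; have C0 := growth_ge0 TC; exists (2 * C), M.+1 => k x.
rewrite expr0 mulr1 /=; case: k => [|k].
  by rewrite lower_gauss (linmap0 lT) schwartz0E normc0 !mulr_ge0// exprn_ge0.
rewrite lower_herm (linmapZ lT) schwartzZE normcM normcR.
rewrite (ger0_norm (ltW (rung_gt0 _))) exprS.
have := TC k x; rewrite expr0 mulr1 => Tk.
have kk : k.+1%:R <= k.+2%:R :> R by rewrite ler_nat.
rewrite mulrACA ler_pM ?normc_ge0 ?(ltW (rung_gt0 _))//.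
  by rewrite (le_trans (rung_le _))// ler_wpM2l.
by rewrite (le_trans Tk)// ler_wpM2l// lerXn2r ?nnegrE.
Qed.

Lemma growth_comb T (a b : R[i]) (S S' : schwartz R 1 -> schwartz R 1) : linear T ->
  growth (T \o S) 0 -> growth (T \o S') 0 -> growth (T \o (fun f => a *: S f + b *: S' f)) 0.
Proof.
move=> lT [C [M TC]] [C' [M' TC']].
exists (normc a * C + normc b * C'), (M + M')%N => k x.
have C0 := growth_ge0 TC; have C0' := growth_ge0 TC'.
have k1 : 1 <= k.+1%:R :> R by rewrite ler1n.
have := TC k x; have := TC' k x; rewrite expr0 !mulr1 /= => h' h.
rewrite lT (linmapZ lT) schwartzDE !schwartzZE (le_trans (le_normcD _ _))// !normcM.
rewrite mulrDl -!mulrA lerD// ler_wpM2l ?normc_ge0//.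
  by rewrite (le_trans h)// ler_wpM2l// ler_weXn2l// leq_addr.
by rewrite (le_trans h')// ler_wpM2l// ler_weXn2l// leq_addl.
Qed.

Let half : (2^-1 : R)%:C + (2^-1 : R)%:C = 1.
Proof. by rewrite -rmorphD -[X in X + X]mul1r -splitr. Qed.

Lemma growth_X T : linear T -> growth T 0 -> growth (T \o sX) 0.
Proof.
move=> lT gT.
have := growth_comb (2^-1 : R)%:C (2^-1 : R)%:C lT (growth_lower lT gT) (growth_raise lT gT).
congr growth; apply/funext => f; congr T; apply: schwartz_eq => v.
rewrite /lower /raise; move: (sX f) (sD f) => p q.
rewrite !(schwartzDE, schwartzZE, schwartzNE) -[p v in RHS]mul1r -half.
by move: (p v) (q v) (_%:C) => *; ring.
Qed.

Lemma growth_D T : linear T -> growth T 0 -> growth (T \o sD) 0.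
Proof.
move=> lT gT.
have := growth_comb (2^-1 : R)%:C (- (2^-1 : R)%:C) lT (growth_lower lT gT) (growth_raise lT gT).
congr growth; apply/funext => f; congr T; apply: schwartz_eq => v.
rewrite /lower /raise; move: (sX f) (sD f) => p q.
rewrite !(schwartzDE, schwartzZE, schwartzNE) -[q v in RHS]mul1r -half.
by move: (p v) (q v) (_%:C) => *; ring.
Qed.

Let sX_iter_linear a : linear (iter a sX).
Proof. by elim: a => [|a IH] c f g //=; rewrite IH sX_linear. Qed.

Let sXD_linear a b : linear (fun f => iter a sX (iter b sD f)).
Proof.
elim: b => [|b IH] c f g; first exact: sX_iter_linear.
by rewrite !iterSr sderive_linear IH.
Qed.

(** Weights become multiplications by x: (1 + |x|) |u| = |u| + |x u|, which is why the induction on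
    [j] runs over all [a]. *)
Lemma growth_XD a b j : growth (fun f => iter a sX (iter b sD f)) j.
Proof.
elim: j a => [|j IH] a.
  elim: b => [|b IHb].
    elim: a => [|a IHa].
      have [C C0 hC] := herm_sup; exists C, 1%N => k x.
      by rewrite expr0 mulr1 expr1; exact: hC.
    have := growth_X (sX_iter_linear a) IHa; congr growth; apply/funext => f.
    exact: esym (iterSr _ _ _).
  have := growth_D (sXD_linear a b) IHb; congr growth; apply/funext => f.
  by rewrite [in RHS]iterSr.
have [C [M TC]] := IH a; have [C' [M' TC']] := IH a.+1.
exists (C + C'), (M + M')%N => k x; have k1 : 1 <= k.+1%:R :> R by rewrite ler1n.
have C0 := @growth_ge0 (fun f => iter a sX (iter b sD f)) _ _ _ TC.
have C0' := @growth_ge0 (fun f => iter a.+1 sX (iter b sD f)) _ _ _ TC'.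
rewrite exprS mulrCA mulrDl mul1r mulrDl lerD//.
  by rewrite (le_trans (TC k x))// ler_wpM2l// ler_weXn2l// leq_addr.
rewrite mulrA; have := TC' k x; rewrite iterS sXE normcM normcR -mulrA => /le_trans; apply.
by rewrite ler_wpM2l// ler_weXn2l// leq_addl.
Qed.

Lemma herm_growth j w : exists (C : R) (M : nat), 0 <= C /\ forall k v,
  normc (pderives w (@herm R k) v) * (1 + enorm v) ^+ j <= C * k.+1%:R ^+ M.
Proof.
have [C [M TC]] := growth_XD 0 (size w) j; exists C, M; split=> [|k v].
  exact: (@growth_ge0 (fun f => iter 0 sX (iter (size w) sD f)) _ _ _ TC).
have := TC k (v 0 0); rewrite ptK.
have -> : `|v 0 0| = enorm v by rewrite -{2}(ptK v) enorm_pt.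
suff -> : iter (size w) sD (herm k) v = pderives w (herm k) v by move=> ->.
rewrite [in RHS](word1 w); elim: (size w) v => //= l IH v.
have E : iter l sD (herm k) = sderive (nseq l ord0) (herm k) by apply: schwartz_eq.
by rewrite E.
Qed.

Lemma remainder_pointwise f x :
  ctends (fun N => \sum_(k < N) coef k f * herm k (pt x)) (f (pt x)).
Proof.
have [C C0 fC] := remainder_bound f; move=> e e0.
have e2 : 0 < e ^+ 2 by rewrite exprn_gt0.
exists (Num.bound (C / e ^+ 2)).+1 => N NB.
have N0 : (0 < N)%N by apply: leq_trans NB.
have np : 0 < N%:R :> R by rewrite ltr0n.
have -> : \sum_(k < N) coef k f * herm k (pt x) - f (pt x) = - remainder N f (pt x).
  rewrite /remainder schwartzBE opprB schwartz_sumE; congr (_ - _).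
rewrite normcN -(ler_pXn2r (ltn0Sn 1)) ?nnegrE ?normc_ge0 ?(ltW e0)//.
apply: le_trans (fC N x N0) _; rewrite ler_pdivrMr// mulrC -ler_pdivrMr//.
apply: (@le_trans _ _ (Num.bound (C / e ^+ 2))%:R); last by rewrite ler_nat ltnW.
by apply/ltW/archi_boundP; rewrite divr_ge0// ltW.
Qed.

End HermiteBounds.

(** * Series expansions and the completed tensor product *)

Section Harmonic.
Context {R : realType}.
Implicit Types (X : bornType R).

(** Convergence to 0 at the fixed rate 1 / (N + 1), with [T] named so that one small set can serve a
    whole family. *)
Definition vanishes X (T : set X) (u : nat -> X) :=
  forall N, exists2 y, T y & u N = (N.+1%:R^-1)%:C *: y.

Lemma vanishes_bcvg X (T : set X) u x : small T -> vanishes T (fun N => u N - x) -> bcvg u x.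
Proof. by move=> sT uT; apply: bcvgI; exists T. Qed.

Lemma ctends_unique (z : nat -> R[i]) l l' : ctends z l -> ctends z l' -> l = l'.
Proof.
move=> zl zl'; apply/eqP; rewrite -subr_eq0; apply/eqP/eq0_normc/eqP.
rewrite eq_le normc_ge0 andbT -mulN1r.
apply: (ctends_le (ctendsD zl (ctendsM (-1) zl'))); exists 0%N => j _.
by rewrite mulN1r subrr normc0.
Qed.

Lemma vanishes_ctends n (T : set (schwartz R n)) u f x : small T ->
  vanishes T (fun N => u N - f) -> ctends (fun N => u N x) (f x).
Proof.
move=> /small_bounded_by[a a0 Ta] uT e e0.
have [N NP] : exists N, forall j, (N <= j)%N -> j.+1%:R^-1 * a 0%N [::] <= e.
  exists (Num.bound (a 0%N [::] / e)) => j Nj.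
  rewrite ler_pdivrMl// -ler_pdivrMr//.
  apply: (@le_trans _ _ (Num.bound (a 0%N [::] / e))%:R); last by rewrite ler_nat leqW.
  by apply/ltW/archi_boundP; rewrite divr_ge0// ltW.
exists N => j /NP; apply: le_trans; rewrite -schwartzBE; have [y Ty ->] := uT j.
rewrite schwartzZE normcM normcR ger0_norm// ler_wpM2l//.
by have := Ta y Ty 0%N [::] x; rewrite expr0 mulr1.
Qed.

End Harmonic.

Section Rapid.
Context {R : realType}.
Variables (I : Type) (W : I -> R).

(** One [C] bounds all powers of the weight, uniformly in the index: the multiples z e_a with (a, z)
    of this kind form a small set, by the frame axiom [vec_rapid]. *)
Definition rapid (C : nat -> R) a (z : R[i]) := forall L, normc z * W a ^+ L <= C L.

End Rapid.

Section RapidSplit.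
Context {R : realType} {I J : Type} (W : I -> R) (W' : J -> R).
Hypotheses (W1 : forall a, 1 <= W a) (W1' : forall a, 1 <= W' a).

Let sqrt_rapid (K : Type) (U V : K -> R) C a (z : R[i]) : (forall a, 0 <= U a) ->
  (forall a, U a <= V a) -> rapid V C a z ->
  forall L, Num.sqrt (normc z) * U a ^+ L <= Num.sqrt (C (2 * L)%N).
Proof.
move=> U0 UV zC L; rewrite -[_ * _]ger0_norm ?mulr_ge0 ?exprn_ge0//.
rewrite -sqrtr_sqr ler_wsqrtr// exprMn sqr_sqrtr ?normc_ge0// -exprM mulnC.
apply: le_trans (zC _); rewrite ler_wpM2l ?normc_ge0// lerXn2r ?nnegrE//.
exact: le_trans (U0 a) _.
Qed.

(* z = sqrt|z| * (z / sqrt|z|). *)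
Lemma rapid_split C a b z : rapid (fun p => W p.1 * W' p.2) C (a, b) z ->
  exists z1 z2, [/\ z = z1 * z2, rapid W (fun L => Num.sqrt (C (2 * L)%N)) a z1 &
    rapid W' (fun L => Num.sqrt (C (2 * L)%N)) b z2].
Proof.
move=> zC; pose s := Num.sqrt (normc z); have s2 : s ^+ 2 = normc z.
  by rewrite sqr_sqrtr// normc_ge0.
have ns : normc s%:C = s by rewrite normcR ger0_norm// sqrtr_ge0.
exists s%:C, (z * (s%:C)^-1).
have E : z = s%:C * (z * (s%:C)^-1).
  have [s0|s0] := eqVneq s 0; last by rewrite mulrCA divff ?mulr1// fmorph_eq0.
  by rewrite s0 rmorph0 mul0r; apply: eq0_normc; rewrite -s2 s0 expr0n.
have nE : normc (z * (s%:C)^-1) = s.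
  have [s0|s0] := eqVneq s 0.
    have -> : z = 0 by apply: eq0_normc; rewrite -s2 s0 expr0n.
    by rewrite mul0r normc0.
  by apply: (mulfI s0); rewrite -{1}ns -normcM -E -s2 expr2.
split=> // L; rewrite ?ns ?nE.
  apply: (@sqrt_rapid _ (fun p => W p.1) _ _ (a, b) z _ _ zC) => [[c d]|[c d]] /=.
    exact: le_trans (W1 c).
  by rewrite ler_peMr// (le_trans _ (W1 c)).
apply: (@sqrt_rapid _ (fun p => W' p.2) _ _ (a, b) z _ _ zC) => [[c d]|[c d]] /=.
  exact: le_trans (W1' d).
by rewrite ler_peMl// (le_trans _ (W1' d)).
Qed.

End RapidSplit.

(** * Frames and uniform convergence of their series *)

Section Frames.
Context {R : realType}.

(* A frame plays the role of a basis, except that orthogonality of [vec] and [cf] is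
   never needed; [wt] measures the decay of coefficients. *)
Record frame n := Frame {
  fidx : eqType;
  wt : fidx -> R;
  box : nat -> seq fidx;
  vec : fidx -> schwartz R n;
  cf : fidx -> schwartz R n -> R[i]^o;
  wt_ge1 : forall a, 1 <= wt a;
  box0 : box 0 = [::];
  box_uniq : forall N, uniq (box N);
  box_sub : forall N M, (N <= M)%N -> {subset box N <= box M};
  box_wt : forall N M a, a \in box M -> a \notin box N -> N.+1%:R <= wt a;
  box_sum : exists K : R, forall N, \sum_(a <- box N) wt a ^- 2 <= K;
  cf_linear : forall a, linear (cf a);
  cf_rapid : forall A L, small A ->
    exists C : R, forall f, A f -> forall a, normc (cf a f) * wt a ^+ L <= C;
  vec_rapid : forall C, small [set f | exists a z, rapid wt C a z /\ f = z *: vec a];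
  frame_cvg : forall f x, ctends (fun N => \sum_(a <- box N) cf a f * vec a x) (f x)
}.

Section Series.
Variables (n : nat) (F : frame n).

Definition partial_sum (X : bornType R) (y : fidx F -> X) f N : X :=
  \sum_(a <- box F N) cf a f *: y a.

Lemma partial_sumB (X : bornType R) (y : fidx F -> X) f N M : (N <= M)%N ->
  partial_sum y f M - partial_sum y f N =
  \sum_(a <- box F M | a \notin box F N) cf a f *: y a.
Proof.
move=> NM; rewrite /partial_sum (bigID (mem (box F N)))/= addrC.
suff -> : \sum_(a <- box F M | a \in box F N) cf a f *: y a =
    \sum_(a <- box F N) cf a f *: y a by rewrite addrK.
rewrite -big_filter; apply/perm_big/uniq_perm => [||a].
- by rewrite filter_uniq// box_uniq.
- exact: box_uniq.
by rewrite mem_filter; apply: andb_idr; exact: box_sub.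
Qed.

(* Terms outside [box N] have weight at least N + 1, so writing a coefficient as
   wt^-2 times wt^-1 times a rapidly decreasing one yields the rate 1 / (N + 1). *)
Lemma frame_series (X : bornType R) (I : Type) (y : I -> fidx F -> X) A : complete X ->
  (forall C, small [set x | exists i a z, rapid (@wt _ F) C a z /\ x = z *: y i a]) ->
  small A -> exists2 T : set X, small T &
    forall i f, A f -> exists x, vanishes T (fun N => partial_sum (y i) f N - x).
Proof.
move=> cX ys sA; have [K KS] := box_sum F; have W1 := @wt_ge1 _ F.
have K0 : 0 <= K by have := KS 0%N; rewrite box0 big_nil.
have CL L := cid (cf_rapid F L sA).
(* Three extra powers of the weight: two for the summable factor wt^-2 and one to pay for N + 1. *)
pose S := disked_hull [set x | exists i a z,
  rapid (@wt _ F) (fun L => sval (CL (3 + L)%N)) a z /\ x = z *: y i a].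
have dS : disk S := disked_hullP _.
have sS : small S by apply: small_hull; exact: ys.
have [T sT hT] := complete_limit cX (smallZ K%:C sS); exists T => // i f Af.
apply: hT => N M NM; rewrite partial_sumB//.
have W0 (a : fidx F) : 0 < wt a by exact: lt_le_trans ltr01 (W1 a).
pose z a := if (a \in box F M) && (a \notin box F N) then
  (N.+1%:R * wt a ^+ 2 : R)%:C * cf a f *: y i a else 0.
have [|a||s Ss sE] := @disk_sum _ _ S _ (box F M) (fun a => a \notin box F N)
    (fun a => wt a ^- 2) z K dS.
- by move=> a; rewrite invr_ge0 exprn_ge0// ltW.
- rewrite /z; case: ifP => [/andP[aM aN]|_]; last by case: dS.
  apply: sub_disked_hull; exists i, a, ((N.+1%:R * wt a ^+ 2 : R)%:C * cf a f); split=> // L.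
  case: (CL (3 + L)%N) => C /= /(_ f Af a); apply: le_trans.
  rewrite normcM normcR ger0_norm ?mulr_ge0 ?exprn_ge0 ?(ltW (W0 _))//.
  rewrite mulrAC mulrC ler_wpM2l ?normc_ge0// addnC exprD mulrC.
  rewrite ler_wpM2l ?exprn_ge0 ?(ltW (W0 _))// exprS ler_wpM2r ?exprn_ge0 ?(ltW (W0 _))//.
    by rewrite mulr_ge0 ?exprn_ge0 ?(ltW (W0 _)).
  exact: box_wt aM aN.
- apply: le_trans (KS M); rewrite [leRHS](bigID (fun a => a \notin box F N))/= lerDl.
  by apply: sumr_ge0 => a _; rewrite invr_ge0 exprn_ge0// ltW.
exists (K%:C *: s); first by exists s.
rewrite -sE scaler_sumr big_seq_cond [RHS]big_seq_cond; apply: eq_bigr => a aMN.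
rewrite /z aMN !scalerA; congr (_ *: _).
rewrite mulrA -!rmorphM mulrCA -mulrA mulVf ?mulr1 ?mulVf ?expf_neq0 ?gt_eqF//.
by rewrite mulfV ?pnatr_eq0// mul1r.
Qed.

Lemma partial_sum_linear (X : bornType R) (y : fidx F -> X) N :
  linear (fun f => partial_sum y f N).
Proof.
move=> c f g; rewrite /partial_sum scaler_sumr -big_split; apply: eq_bigr => a _ /=.
by rewrite cf_linear scalerDl scalerA.
Qed.

Definition expansion N f : schwartz R n := partial_sum (@vec _ F) f N.

Lemma expansion_linear N : linear (expansion N).
Proof. exact: partial_sum_linear. Qed.

(** [frame_series] gives uniform convergence to some limit; the pointwise convergence in [frame_cvg]
    identifies it as f. *)
Lemma frame_approx A : small A -> exists2 T : set (schwartz R n), small T &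
  forall f, A f -> vanishes T (fun N => expansion N f - f).
Proof.
move=> sA; have [|T sT hT] := @frame_series _ unit (fun _ => @vec _ F) A
  (@schwartz_complete R n) _ sA.
  move=> C; apply: smallS (vec_rapid F C) => f [_ [a [z [zC ->]]]].
  by exists a, z.
exists T => // f Af; have [g gP] := hT tt f Af; have fg : g = f; last by rewrite fg in gP.
apply: schwartz_eq => x; apply: ctends_unique (vanishes_ctends x sT gP) _.
move=> e e0; have [N NP] := frame_cvg F f x e0; exists N => j /NP.
by rewrite /partial_sum schwartz_sumE.
Qed.

End Series.
End Frames.

Section Point.
Context {R : realType}.

Lemma eval_bound n (A : set (schwartz R n)) : small A ->
  exists M : R, forall f x, A f -> normc (f x) <= M.
Proof.
move=> /small_bounded_by[a _ Aa]; exists (a 0%N [::]) => f x Af.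
by have := Aa f Af 0%N [::] x; rewrite expr0 mulr1.
Qed.

Lemma eval_bounded n (x : 'rV[R]_n) : bounded_map (fun f : schwartz R n => f x : R[i]^o).
Proof. by move=> A /eval_bound[M AM]; exists M => _ [f Af <-]; exact: AM. Qed.

Lemma row0_eq (x : 'rV[R]_0) : x = 0.
Proof. by apply/rowP => -[]. Qed.

Lemma smooth0 (f : 'rV[R]_0 -> R[i]) : smooth f.
Proof.
have -> : f = fun=> f 0 by apply/funext => x; rewrite (row0_eq x).
exact: smooth_cst.
Qed.

Lemma schwartz0_small (A : set (schwartz R 0)) (M : R) :
  (forall f, A f -> normc (f 0) <= M) -> small A.
Proof.
move=> AM; apply/schwartz_smallP; exists (fun k w => M) => k w f x Af.
have -> : (1 + enorm x) ^+ k = 1.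
  by rewrite /enorm big_ord0 sqrtr0 addr0 expr1n.
by case: w => [|[]//]; rewrite mulr1 (row0_eq x); exact: AM.
Qed.

Fact one0_subproof : is_schwartz (fun _ : 'rV[R]_0 => 1 : R[i]).
Proof.
apply/asboolP; split=> [|k w]; first exact: smooth0.
apply/seminorm_ltP; exists 1; apply/seminorm_leP => x.
have -> : (1 + enorm x) ^+ k = 1.
  by rewrite /enorm big_ord0 sqrtr0 addr0 expr1n.
by case: w => [|[]//]; rewrite mulr1 /= expr1n expr0n addr0 sqrtr1.
Qed.
Definition one0 : schwartz R 0 := Schwartz one0_subproof.

Definition frame0 : @frame R 0.
Proof.
apply: (@Frame R 0 unit (fun=> 1) (fun N => if N is 0%N then [::] else [:: tt])
  (fun=> one0) (fun _ f => f 0)) => //.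
- by case.
- by move=> [|N] [|M].
- by move=> [|N] M [].
- exists 1 => -[|N]; first by rewrite big_nil.
  by rewrite big_seq1 expr1n invr1.
- move=> A L /eval_bound[M AM]; exists M => f Af _.
  by rewrite expr1n mulr1; exact: AM.
- move=> C; apply: (@schwartz0_small _ (C 0%N)) => f [_ [z [/(_ 0%N) zC ->]]].
  by move: zC; rewrite expr0 mulr1 schwartzZE mulr1.
- move=> f x e e0; exists 1%N => -[//|N] _.
  by rewrite big_seq1 mulr1 (row0_eq x) subrr normc0 ltW.
Defined.

Lemma sum_inv_square N : \sum_(k <- iota 0 N.+1) k.+1%:R ^- 2 <= 2 - N.+1%:R^-1 :> R.
Proof.
elim: N => [|N IH]; first by rewrite big_seq1 expr1n invr1 -subr_ge0; lra.
rewrite -addn1 iotaD big_cat/= big_seq1 add0n addn1.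
apply: le_trans (lerD IH (lexx _)) _; rewrite -subr_ge0.
have n0 : 0 < N.+1%:R :> R by [].
rewrite -[N.+2%:R]natr1; move: (N.+1%:R : R) n0 => a a0.
have a1 : 0 < a + 1 by rewrite ltr_wpDr.
have -> : 2 - (a + 1)^-1 - (2 - a^-1 + (a + 1) ^- 2) = (a * (a + 1) ^+ 2)^-1.
  by field; rewrite !gt_eqF.
by rewrite invr_ge0 mulr_ge0 ?exprn_ge0// ltW.
Qed.

Definition frame1 : @frame R 1.
Proof.
apply: (@Frame R 1 nat (fun k => k.+1%:R) (iota 0) (@herm R) (@coef R)) => //.
- by move=> k; rewrite ler1n.
- by move=> N; exact: iota_uniq.
- by move=> N M NM k; rewrite !mem_iota => /leq_trans; exact.
- by move=> N M k _; rewrite mem_iota -leqNgt ler_nat.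
- exists 2 => -[|N]; first by rewrite big_nil.
  by apply: le_trans (sum_inv_square N) _; rewrite gerBl.
- exact: coef_linear.
- by move=> A L; exact: coef_decay.
- move=> C; have G j w := cid (herm_growth (R := R) j w).
  have G' j w := cid (svalP (G j w)).
  apply/schwartz_smallP.
  exists (fun j w => sval (G j w) * C (sval (G' j w))) => j w f x [k [z [zC ->]]].
  rewrite pderives_scale normcM; case: (G' j w) => M /= [C0 hM].
  rewrite -mulrA (le_trans (ler_wpM2l (normc_ge0 _) (hM k x)))//.
  by rewrite mulrCA ler_wpM2l.
- move=> f x; rewrite -(ptK x) => e e0; have [N NP] := remainder_pointwise f (x 0 0) e0.
  exists N => j /NP; congr (normc (_ - _) <= _).
  by rewrite -(big_mkord xpredT (fun k => coef k f * herm k (pt (x 0 0)))) /index_iota subn0.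
Defined.

End Point.

Section Tensor.
Context {R : realType} {m n : nat}.

Lemma restr_tensor x (f : schwartz R m) (g : schwartz R n) :
  restr x (schwartz_tensor f g) = f x *: g.
Proof. by apply: schwartz_eq => y; rewrite restrE /= row_mxKl row_mxKr. Qed.

Lemma slice_tensor (l : schwartz R n -> R[i]^o) (f : schwartz R m) (g : schwartz R n) :
  linear l -> bounded_map l -> slice l (schwartz_tensor f g) = l g *: f.
Proof.
move=> ll lb; apply: schwartz_eq => x; rewrite sliceE// restr_tensor functionalZ//.
by rewrite schwartzZE mulrC.
Qed.

Lemma slice_sum (I : Type) (r : seq I) (c : I -> R[i]) (l : I -> schwartz R n -> R[i]^o)
    (H : schwartz R (m + n)) : (forall i, linear (l i)) -> (forall i, bounded_map (l i)) ->
  linear (fun h => \sum_(i <- r) c i * l i h : R[i]^o) ->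
  bounded_map (fun h => \sum_(i <- r) c i * l i h : R[i]^o) ->
  slice (fun h => \sum_(i <- r) c i * l i h) H = \sum_(i <- r) c i *: slice (l i) H.
Proof.
move=> ll lb sl sb; apply: schwartz_eq => x; rewrite sliceE// schwartz_sumE.
by apply: eq_bigr => i _; rewrite schwartzZE sliceE.
Qed.

Lemma schwartz_tensorE (f : schwartz R m) (g : schwartz R n) x :
  schwartz_tensor f g x = f (lsubmx x) * g (rsubmx x).
Proof. by []. Qed.

Lemma schwartz_tensor_bilinear : bounded_bilinear (@schwartz_tensor R m n).
Proof.
split=> [f|g|A B].
- move=> a g h; apply: schwartz_eq => x; rewrite schwartz_tensorE !schwartzDE !schwartzZE.
  by rewrite mulrDr mulrCA.
- move=> a f h; apply: schwartz_eq => x; rewrite schwartz_tensorE !schwartzDE !schwartzZE.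
  by rewrite mulrDl mulrA.
move=> /schwartz_smallP[a Aa] /schwartz_smallP[b Bb]; apply/schwartz_smallP.
exists (fun k w => \sum_(p <- splits w) subst_bound (@left_index m n) (a k) p.1 *
                         subst_bound (@right_index m n) (b k) p.2).
move=> k w _ x [f Af [g Bg <-]].
by apply: tensor_bound => [k' w' y|k' w' y]; [exact: Aa|exact: Bb].
Qed.

End Tensor.

(** * Products of frames *)

Section ProductFrame.
Context {R : realType}.
Variables (m n : nat) (F : @frame R m) (F' : @frame R n).

Lemma cf_bounded p (G : @frame R p) b : bounded_map (@cf _ _ G b).
Proof.
move=> A sA; have [C CP] := cf_rapid G 0 sA; exists C => _ [f Af <-].
by have := CP f Af b; rewrite expr0 mulr1.
Qed.

(** P_N f = (P_N f - f) + f, where the first term lies in a small set independent of N. *)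
Lemma expansion_small p (G : @frame R p) A : small A ->
  small [set expansion G N f | N in setT & f in A].
Proof.
move=> sA; have [T sT hT] := frame_approx G sA.
apply: smallS (smallD (small_hull sT) sA) => _ [N _ [f Af <-]].
have [y Ty E] := hT f Af N; exists (expansion G N f - f); last by exists f => //; rewrite subrK.
have [_ cT _] := disked_hullP T; rewrite E; apply: cT; last exact: sub_disked_hull.
by rewrite normcR ger0_norm// invf_le1// ler1n.
Qed.

Lemma expansion_bounded p (G : @frame R p) N : bounded_map (expansion G N).
Proof.
by move=> A /(expansion_small G); apply: smallS => _ [f Af <-]; exists N => //; exists f.
Qed.

Lemma expansion_linear_at p (G : @frame R p) N y :
  linear (fun h => expansion G N h y : R[i]^o).
Proof. by move=> c f g; rewrite expansion_linear. Qed.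

Lemma expansion_bounded_at p (G : @frame R p) N y :
  bounded_map (fun h => expansion G N h y : R[i]^o).
Proof. by move=> A /(@expansion_bounded _ G N)/(eval_bounded y); rewrite image_comp. Qed.

Definition prod_box N := [seq (a, b) | a <- box F N, b <- box F' N].

(** The double partial sum is the partial sum in [x] of a slice, taken with the functional h |->
    (P_N h)(y) in the second variable. *)
Lemma prod_expansion (H : schwartz R (m + n)) x y N :
  \sum_(p <- prod_box N) (cf p.1 (slice (cf p.2) H) : R[i]) *
    schwartz_tensor (vec p.1) (vec p.2) (row_mx x y) =
  expansion F N (slice (fun h => expansion F' N h y) H) x.
Proof.
have yE : (fun h => expansion F' N h y) =
    (fun h => \sum_(b <- box F' N) vec b y * cf b h).
  apply/funext => h; rewrite /expansion /partial_sum schwartz_sumE.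
  by apply: eq_bigr => b _; rewrite schwartzZE mulrC.
have l := @expansion_linear_at _ F' N y.
have b := @expansion_bounded_at _ F' N y.
rewrite big_allpairs {2}/expansion /partial_sum schwartz_sumE; apply: eq_bigr => a _.
rewrite schwartzZE yE slice_sum -?yE//; last exact: cf_bounded; last exact: cf_linear.
rewrite functional_sum; last exact: cf_linear.
rewrite mulr_suml; apply: eq_bigr => c _; rewrite (functionalZ (cf_linear a)).
rewrite schwartz_tensorE row_mxKl row_mxKr /=.
by move: (cf a _ : R[i]) (vec a x) (vec c y) => p q r; rewrite mulrC -mulrA mulrC -mulrA mulrCA; congr (_ * _); rewrite mulrC.
Qed.

(* With P_N the expansion in the first variable and G_N -> G = H(., y) the partial sums
   in the second one: P_N G_N - G = (P_N G - G) + P_N (G_N - G). *)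
Lemma prod_frame_cvg H v : ctends (fun N => \sum_(p <- prod_box N)
  (cf p.1 (slice (cf p.2) H) : R[i]) * schwartz_tensor (vec p.1) (vec p.2) v) (H v).
Proof.
rewrite -(hsubmxK v); set x := lsubmx v; set y := rsubmx v.
pose G : schwartz R m := slice (fun h : schwartz R n => h y) H.
(* The error of the second partial sum at [y], multiplied by N + 1; [frame_approx] makes these
   functionals equibounded, so their slices form a small set. *)
pose d N (h : schwartz R n) : R[i]^o := (N.+1%:R : R)%:C * (expansion F' N h y - h y).
have dl N : linear (d N).
  move=> c f g; rewrite /d expansion_linear.
  move: (expansion F' N f) (expansion F' N g) => p q; rewrite !schwartzDE !schwartzZE.
  by move: (_%:C) (p y) (q y) (f y) (g y) => *; rewrite -[c *: _]/(c * _); ring.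
have db B : small B -> exists M : R, forall N h, B h -> normc (d N h) <= M.
  move=> sB; have [T sT hT] := frame_approx F' sB; have [M TM] := eval_bound sT.
  exists M => N h Bh; have [z Tz E] := hT h Bh N.
  rewrite /d -schwartzBE E schwartzZE mulrA -rmorphM divff ?mul1r; first exact: TM.
  by rewrite pnatr_eq0.
have dN N : bounded_map (d N).
  by move=> B /db[M dM]; exists M => _ [f Bf <-]; exact: dM.
have el N := @expansion_linear_at _ F' N y.
have eb N := @expansion_bounded_at _ F' N y.
have sd := slice_small dl db (small1 H).
set D := [set _ | _ in _ & _ in _] in sd.
have [T sT hT] := frame_approx F (small1 G).
have GN N : slice (fun h => expansion F' N h y) H = G + (N.+1%:R^-1)%:C *: slice (d N) H.
  apply: schwartz_eq => z; rewrite schwartzDE schwartzZE sliceE// sliceE//.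
  rewrite sliceE//; last exact: eval_bounded.
  by rewrite mulrA -rmorphM mulVf ?mul1r ?pnatr_eq0// addrC subrK.
have Gx : G x = H (row_mx x y).
  by rewrite sliceE ?restrE//; exact: eval_bounded.
rewrite -Gx; have := @vanishes_ctends _ _ _ (fun N =>
  expansion F N (slice (fun h => expansion F' N h y) H)) G x
  (smallD sT (expansion_small F sd)).
have -> : (fun N => \sum_(p <- prod_box N) (cf p.1 (slice (cf p.2) H) : R[i]) *
    schwartz_tensor (vec p.1) (vec p.2) (row_mx x y)) =
    (fun N => expansion F N (slice (fun h => expansion F' N h y) H) x).
  by apply/funext => N; rewrite prod_expansion.
apply => N; have [z Tz zE] := hT G erefl N.
exists (z + expansion F N (slice (d N) H)).
  exists z => //; exists (expansion F N (slice (d N) H)) => //; exists N => //.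
  by exists (slice (d N) H) => //; exists N => //; exists H.
rewrite GN (linmapD (expansion_linear _ _)) (linmapZ (expansion_linear _ _)) scalerDr -zE.
by rewrite addrAC.
Qed.

Definition prod_frame : @frame R (m + n).
Proof.
apply: (@Frame R (m + n) (fidx F * fidx F')%type (fun p => wt p.1 * wt p.2) prod_box
  (fun p => schwartz_tensor (vec p.1) (vec p.2)) (fun p H => cf p.1 (slice (cf p.2) H))).
- by move=> [a b]; rewrite mulr_ege1// wt_ge1.
- by rewrite /prod_box !box0.
- by move=> N; rewrite allpairs_uniq ?box_uniq// => -[a b] [c d].
- move=> N M NM _ /allpairsP[[a b] [/= aN bN ->]].
  by apply/allpairsP; exists (a, b); split=> //=; apply: box_sub NM _ _.
(* An index outside the product box has a component outside its own box, and the other weight is at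
   least 1. *)
- move=> N M _ /allpairsP[[a b] [/= aM bM ->]] abN /=.
  have [aN|aN] := boolP (a \in box F N); last first.
    by rewrite (le_trans (box_wt aM aN))// ler_peMr ?wt_ge1// (le_trans ler01)// wt_ge1.
  have [bN|bN] := boolP (b \in box F' N); last first.
    by rewrite (le_trans (box_wt bM bN))// ler_peMl ?wt_ge1// (le_trans ler01)// wt_ge1.
  by case/negP: abN; apply/allpairsP; exists (a, b).
- have [K KP] := box_sum F; have [K' KP'] := box_sum F'; exists (K * K') => N.
  rewrite big_allpairs.
  have -> : \sum_(a <- box F N) \sum_(b <- box F' N) (wt (a, b).1 * wt (a, b).2) ^- 2 =
      (\sum_(a <- box F N) wt a ^- 2) * \sum_(b <- box F' N) wt b ^- 2.
    rewrite mulr_suml; apply: eq_bigr => a _; rewrite mulr_sumr; apply: eq_bigr => b _.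
    by rewrite /= exprMn invfM.
  by rewrite ler_pM// sumr_ge0// => a _; rewrite invr_ge0 exprn_even_ge0.
- move=> [a b] c f g /=; rewrite slice_linear ?cf_linear//; first exact: cf_linear.
  exact: cf_bounded.
- move=> A L sA.
  (* The weight of the second index is put into the functional; the family stays equibounded, so its
     slices are small and the decay for [F] applies to them uniformly in b. *)
  pose l (b : fidx F') (h : schwartz R n) : R[i]^o := (wt b ^+ L : R)%:C * cf b h.
  have W0 p (G : @frame R p) (a : fidx G) : 0 <= wt a ^+ L.
    by rewrite exprn_ge0// (le_trans ler01)// wt_ge1.
  have ll b : linear (l b).
    move=> c f g; rewrite /l cf_linear -[c *: _]/(c * _) -[c *: _ in RHS]/(c * _).
    by rewrite mulrDr mulrCA.
  have lb B : small B -> exists M : R, forall b f, B f -> normc (l b f) <= M.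
    move=> /(cf_rapid F' L)[C CP]; exists C => b f Bf.
    by rewrite normcM normcR ger0_norm// mulrC CP.
  have lb' b : bounded_map (l b).
    by move=> B /lb[M lM]; exists M => _ [f Bf <-]; exact: lM.
  have [C CP] := cf_rapid F L (slice_small ll lb sA); exists C => H AH [a b] /=.
  have lE : slice (l b) H = (wt b ^+ L)%:C *: slice (cf b) H.
    apply: schwartz_eq => x; rewrite schwartzZE !sliceE//; first exact: cf_linear.
    exact: cf_bounded.
  have := CP _ (ex_intro2 _ _ b I (ex_intro2 _ _ H AH erefl)) a; rewrite lE.
  rewrite (functionalZ (cf_linear a)) normcM normcR ger0_norm// exprMn [wt a ^+ L * _]mulrC mulrA.
  by rewrite [normc _ * _]mulrC.
- move=> C; have [_ _ b] := @schwartz_tensor_bilinear R m n.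
  pose C' L := Num.sqrt (C (2 * L)%N).
  apply: smallS (b _ _ (vec_rapid F C') (vec_rapid F' C')) => _ [[i j] [z [zC ->]]].
  have [z1 [z2 [-> r1 r2]]] := rapid_split (@wt_ge1 _ _ F) (@wt_ge1 _ _ F') zC.
  exists (z1 *: vec i); first by exists i, z1.
  exists (z2 *: vec j); first by exists j, z2.
  by apply: schwartz_eq => x; rewrite schwartzZE !schwartz_tensorE !schwartzZE mulrACA.
- exact: prod_frame_cvg.
Defined.

End ProductFrame.

(** * The universal property of the tensor product *)

Section Extension.
Context {R : realType}.

Lemma bhom_eq (V W : bornType R) (f g : bhom V W) : f =1 g -> f = g.
Proof. by move=> fg; apply: val_inj; apply/funext. Qed.

Lemma bhomP (V W : bornType R) (f : V -> W) : linear f -> bounded_map f ->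
  exists g : bhom V W, forall x, g x = f x.
Proof. move=> lf bf; have b : is_bhom f by apply/asboolP; split.
by exists (BHom b). Qed.

Fixpoint hermite_frame n : @frame R n :=
  if n is n'.+1 then prod_frame frame1 (hermite_frame n') else frame0.

Variables m n : nat.

Let F := hermite_frame m.
Let F' := hermite_frame n.
Let G := prod_frame F F'.

Section Target.
Variable X : bornType R.
Hypothesis cX : complete X.

Definition tensor_sum (b : schwartz R m -> schwartz R n -> X) H N : X :=
  partial_sum (F := G) (fun p => b (vec p.1) (vec p.2)) H N.

Definition tensor_lift (b : schwartz R m -> schwartz R n -> X) H : X :=
  xget 0 [set x | bcvg (tensor_sum b H) x].

Section Family.
Variables (I : Type) (b : I -> schwartz R m -> schwartz R n -> X).
Hypothesis bl : forall i f, linear (b i f).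
Hypothesis br : forall i g, linear ((b i)^~ g).
Hypothesis bb : forall A B, small A -> small B ->
  small [set x | exists i f g, [/\ A f, B g & x = b i f g]].

(** By [rapid_split], z b(e_a, e_c) = b(z1 e_a, z2 e_c) with both arguments in fixed small sets, so
    [frame_series] applies uniformly in [i]. *)
Lemma tensor_sum_vanishes A : small A -> exists2 T : set X, small T &
  forall i H, A H -> vanishes T (fun N => tensor_sum (b i) H N - tensor_lift (b i) H).
Proof.
move=> sA.
have [|T sT hT] := @frame_series _ _ G X I (fun i p => b i (vec p.1) (vec p.2)) A cX _ sA.
  move=> C; pose C' L := Num.sqrt (C (2 * L)%N).
  apply: smallS (bb (vec_rapid F C') (vec_rapid F' C')) => x [i [[a c] [z [zC ->]]]].
  have [z1 [z2 [-> r1 r2]]] := rapid_split (@wt_ge1 _ _ F) (@wt_ge1 _ _ F') zC.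
  exists i, (z1 *: vec a), (z2 *: vec c); split; first by exists a, z1.
    by exists c, z2.
  by rewrite (linmapZ (bl _ _)) (linmapZ (br _ _)) scalerA mulrC.
exists T => // i H AH; have [x xP] := hT i H AH.
suff -> : tensor_lift (b i) H = x by [].
have xb : bcvg (tensor_sum (b i) H) x by apply: vanishes_bcvg xP.
have xl := @xgetPex _ 0 [set x | bcvg (tensor_sum (b i) H) x] (ex_intro _ x xb).
exact: bcvg_unique (complete_separated cX) xl xb.
Qed.

Lemma tensor_lift_small A : small A ->
  small [set x | exists i H, A H /\ x = tensor_lift (b i) H].
Proof.
move=> /tensor_sum_vanishes[T sT hT]; apply: smallS (smallZ (-1) sT).
move=> _ [i [H [AH ->]]]; have [y Ty] := hT i H AH 0%N.
(* The partial sum at N = 0 is empty, so the rate estimate there bounds the limit itself. *)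
rewrite /tensor_sum /partial_sum box0 big_nil sub0r invr1 scale1r => E.
by exists y => //; rewrite scaleN1r -E opprK.
Qed.

Lemma tensor_lift_cvg i H : bcvg (tensor_sum (b i) H) (tensor_lift (b i) H).
Proof.
have [T sT hT] := tensor_sum_vanishes (small1 H).
exact: vanishes_bcvg sT (hT i H erefl).
Qed.

Lemma tensor_lift_linear i : linear (tensor_lift (b i)).
Proof.
move=> c H H'; apply: bcvg_unique (complete_separated cX) (tensor_lift_cvg _ _) _.
have [T sT hT] := tensor_sum_vanishes (small1 H).
have [T' sT' hT'] := tensor_sum_vanishes (small1 H').
apply: vanishes_bcvg (smallD (smallZ c sT) sT') _ => N.
have [y Ty yE] := hT i H erefl N; have [y' Ty' yE'] := hT' i H' erefl N.
exists (c *: y + y'); first by exists (c *: y); [exists y|exists y'].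
rewrite /tensor_sum partial_sum_linear opprD addrACA -scalerBr yE yE' scalerDr.
by rewrite !scalerA mulrC.
Qed.

Lemma tensor_lift_tensor i f g : tensor_lift (b i) (schwartz_tensor f g) = b i f g.
Proof.
apply: bcvg_unique (complete_separated cX) (tensor_lift_cvg _ _) _.
have -> : tensor_sum (b i) (schwartz_tensor f g) =
    fun N => b i (expansion F N f) (expansion F' N g).
  apply/funext => N; rewrite /tensor_sum /partial_sum big_allpairs /expansion /partial_sum.
  rewrite (linmap_sum (br _ _)); apply: eq_bigr => a _.
  rewrite (linmap_sum (bl _ _)); apply: eq_bigr => c _ /=.
  rewrite slice_tensor; [|exact: cf_linear|exact: cf_bounded].
  by rewrite (functionalZ (cf_linear a)) (linmapZ (bl _ _)) (linmapZ (br _ _)) scalerA.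
have [T sT hT] := frame_approx F (small1 f).
have [T' sT' hT'] := frame_approx F' (small1 g).
have s1 : small [set x | exists i f g0, [/\ T f,
    [set expansion F' N h | N in setT & h in [set g]] g0 & x = b i f g0]].
  exact: bb (expansion_small F' (small1 g)).
have s2 : small [set x | exists i f0 g, [/\ [set f] f0, T' g & x = b i f0 g]].
  exact: bb (small1 f) sT'.
apply: vanishes_bcvg (smallD s1 s2) _ => N.
have [y Ty yE] := hT f erefl N; have [y' Ty' yE'] := hT' g erefl N.
(* b(P f, P g) - b(f, g) = b(P f - f, P g) + b(f, P g - g), each with the factor 1 / (N + 1). *)
exists (b i y (expansion F' N g) + b i f y').
  exists (b i y (expansion F' N g)); last by exists (b i f y') => //; exists i, f, y'.
  by exists i, y, (expansion F' N g); split=> //; exists N => //; exists g.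
rewrite scalerDr -(linmapZ (br i _)) -yE -(linmapZ (bl i f)) -yE'.
by rewrite (linmapB (br i _)) (linmapB (bl i _)) addrA subrK.
Qed.

End Family.

Lemma tensor_extension (b : schwartz R m -> schwartz R n -> X) : bounded_bilinear b ->
  exists f : bhom (schwartz R (m + n)) X, forall v w, f (schwartz_tensor v w) = b v w.
Proof.
move=> [bl br bb].
have bb' A B : small A -> small B ->
    small [set x | exists (i : unit) f g, [/\ A f, B g & x = b f g]].
  move=> sA sB; apply: smallS (bb _ _ sA sB) => _ [_ [f [g [Af Bg ->]]]].
  by exists f => //; exists g.
have [|A sA|f fE] := @bhomP _ _ (tensor_lift b).
- exact: (@tensor_lift_linear unit (fun=> b) (fun=> bl) (fun=> br) bb' tt).
- apply: smallS (@tensor_lift_small unit (fun=> b) (fun=> bl) (fun=> br) bb' A sA).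
  by move=> _ [H AH <-]; exists tt, H.
exists f => v w; rewrite fE.
exact: (@tensor_lift_tensor unit (fun=> b) (fun=> bl) (fun=> br) bb' tt).
Qed.

End Target.

Definition tensors := [set H | exists f g, H = @schwartz_tensor R m n f g].

Lemma tensor_dense H : exists2 u : nat -> schwartz R (m + n),
  (forall N, lspan tensors (u N)) & bcvg u H.
Proof.
exists (fun N => expansion G N H) => [N|].
  apply: lspan_sum => p; apply/lspanZ/lspan1.
  by exists (vec p.1), (vec p.2).
have [T sT hT] := frame_approx G (small1 H).
exact: vanishes_bcvg sT (hT H erefl).
Qed.

(** The target need only be separated, so the density argument also applies to scalar-valued maps
    such as evaluations. *)
Lemma tensor_unique (X : bornType R) (f g : schwartz R (m + n) -> X) :
  bseparated X -> linear f -> bounded_map f -> linear g -> bounded_map g ->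
  (forall v w, f (schwartz_tensor v w) = g (schwartz_tensor v w)) -> f =1 g.
Proof.
move=> sX lf bf lg bg fg H; have [u uS uH] := tensor_dense H.
apply: bcvg_unique sX (bcvg_lin lf bf uH) _.
suff -> : f \o u = g \o u by exact: bcvg_lin.
apply/funext => N /=; have [k [c [v [vS ->]]]] := uS N.
rewrite !linmap_sum//; apply: eq_bigr => i _; rewrite !linmapZ//.
by have [a [d ->]] := vS i; rewrite fg.
Qed.

Theorem schwartz_ctensor : is_ctensor (@schwartz_tensor R m n).
Proof.
split; [exact: schwartz_complete|exact: schwartz_tensor_bilinear|].
move=> X cX b bb; have [f fE] := tensor_extension cX bb; exists f; split=> // g gE.
apply: bhom_eq; apply: tensor_unique; first exact: complete_separated.
- exact: bhom_linear.
- exact: bhom_bounded.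
- exact: bhom_linear.
- exact: bhom_bounded.
by move=> v w; rewrite fE gE.
Qed.

End Extension.

(** * The approximation property *)

Section Approximation.
Context {R : realType}.

Lemma small_bigcup (V : bornType R) (G : set (set V)) : finite_set G ->
  (forall U, G U -> small U) -> small (\bigcup_(U in G) U).
Proof.
move=> /finite_seqP[s ->]; elim: s => [|U s IH] sG.
  by apply: smallS (small1 (0 : V)) => x [U].
have s1 : small U by apply: sG; exact: mem_head.
have s2 : small (\bigcup_(U in [set` s]) U).
  by apply: IH => U' U's; apply: sG; rewrite /= inE U's orbT.
apply: smallS (smallU s1 s2) => x [U' /=].
by rewrite inE => /orP[/eqP ->|U's] U'x; [left|right; exists U'].
Qed.

(** The increasing sets [U k], where the gauge is below k, are open and cover [S]; a finite subcover
    bounds the gauge on [S]. *)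
Lemma compact_disk_small (V : bornType R) (S : set V) : compact_disk S -> small S.
Proof.
move=> [_ [T [sT [dT _ _] [ST Sc]]]].
pose U (k : R) : set V := [set x | exists2 r : R, 0 < r < k & exists2 y, T y & x = r%:C *: y].
have [_ [k _ <-]||G [fG GU SG]] := Sc (range U).
- move=> x _ [r /andP[r0 rk] [y Ty ->]]; have e0 : 0 < (k - r) / 2.
    by rewrite divr_gt0// subr_gt0.
  exists ((k - r) / 2) => // z lz zx.
  have [|w Tw wE] := gauge_lt dT _ zx.
    apply: lspanD => //; rewrite -scaleN1r; apply: lspanZ; apply: lspanZ; exact: lspan1.
  have [v Tv vE] := diskD dT (ltW r0) (ltW e0) Ty Tw.
  exists (r + (k - r) / 2); last by exists v => //; rewrite -vE -wE addrC subrK.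
  by apply/andP; split; lra.
- move=> x /ST lx; have [r r0 [y Ty xE]] := lspan_disk dT lx.
  exists (U (r + 1)); first by exists (r + 1).
  by exists r; [rewrite r0 ltrDl ltr01|exists y].
apply: smallS SG _; apply: small_bigcup => // _ /GU[k _ <-].
apply: smallS (smallZ k%:C sT) => x [r /andP[r0 rk] [y Ty ->]].
by have [z Tz ->] := diskZ dT (ltW r0) (ltW rk) Ty; exists z.
Qed.

Theorem schwartz_approximation n : approximation_property (schwartz R n).
Proof.
move=> S cS; have sS := small_hull (compact_disk_small cS).
pose F := @hermite_frame R n.
have [T sT hT] := frame_approx F sS.
have fP N := bhomP (expansion_linear F N) (@expansion_bounded _ _ F N).
pose f N := sval (cid (fP N)); have fE N x : f N x = expansion F N x.
  by rewrite /f; case: cid.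
have [|A [r r0 Ar]|j jE] := @bhomP _ (dspan S) (schwartz R n) (@dspan_val _ _ S).
- by [].
- apply: smallS (smallZ r%:C sS) => _ [x /Ar[y Sy yE] <-].
  by rewrite yE; exists y.
exists f, (fun N => bhom_comp (f N) j), j; split=> //.
- move=> N; exists [set` [seq vec a | a <- box F N]]; first exact: finite_seq.
  move=> _ [x _ <-]; rewrite fE /expansion /partial_sum big_seq.
  apply: (big_ind (lspan _)); [exact: lspan0|exact: lspanD|move=> a aN].
  by apply/lspanZ/lspan1/map_f.
- by move=> N x; rewrite -jE.
(* The errors P_N - id, rescaled by N + 1, are equibounded on <S>; this is convergence in Hom(<S>,
   V). *)
pose h N : bhom (dspan S) (schwartz R n) := (N.+1%:R : R)%:C *: (bhom_comp (f N) j - j).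
apply: bcvgI; exists (range h) => [A [r r0 Ar]|N]; last first.
  by exists (h N) => //; rewrite /h scalerA -rmorphM mulVf ?scale1r// pnatr_eq0.
apply: smallS (smallZ r%:C sT) => _ [_ [N _ <-] [x /Ar[y Sy yE] <-]].
have [z Tz zE] := hT y Sy N; exists z => //.
rewrite -[RHS]/((N.+1%:R : R)%:C *: (f N (j x) - j x)) fE jE yE.
have E : expansion F N (r%:C *: y) = r%:C *: expansion F N y.
  exact: linmapZ (expansion_linear F N) _ _.
rewrite E -scalerBr zE !scalerA -!rmorphM; congr (_%:C *: _).
by rewrite mulrAC mulfV ?mul1r// pnatr_eq0.
Qed.

End Approximation.

(** * Essential modules *)

Section LinearSubstitution.
Context {R : realType} {p q : nat}.
Variables (L : 'rV[R]_p -> 'rV[R]_q) (M : 'rV[R]_q -> 'rV[R]_p).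
Hypotheses (lL : linear L) (lM : linear M) (LM : cancel L M).

Lemma compose_linE f x : compose L f x = f (L x).
Proof. by have [K _ LK] := linear_proper lL lM LM; exact: composeE LK. Qed.

Lemma compose_lin_linear : linear (compose L).
Proof.
have [K _ LK] := linear_proper lL lM LM.
by have /asboolP[] := compose_bhom LK.
Qed.

Lemma compose_lin_bounded : bounded_map (compose L).
Proof.
have [K _ LK] := linear_proper lL lM LM.
by have /asboolP[] := compose_bhom LK.
Qed.

End LinearSubstitution.

Section QuotientIsomorphism.
Context {R : realType}.
Variables (V W : bornType R) (N : set V) (m : V -> W) (s : W -> V).
Hypotheses (sW : bseparated W) (lm : linear m) (bm : bounded_map m).
Hypotheses (ls : linear s) (bs : bounded_map s).
Hypotheses (mN : forall z, N z -> m z = 0) (ms : cancel s m).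
Hypothesis sm : forall x, bclosure (lspan N) (x - s (m x)).

Lemma kernel_bclosed : bclosed [set x | m x = 0].
Proof.
move=> u x u0 ux; have := bcvg_lin lm bm ux.
have -> : m \o u = m \o (fun=> 0) by apply/funext => n /=; rewrite u0 linmap0.
move=> mx; apply: bcvg_unique sW mx _; rewrite /comp linmap0//.
apply: bcvgI; exists [set 0]; first exact: small1.
by move=> n; exists 0 => //; rewrite subrr scaler0.
Qed.

Lemma bproj_eq x y : bclosure (lspan N) (x - y) -> bproj N x = bproj N y.
Proof.
by move=> xy; apply/eqP; rewrite -Quotient.idealrBE; exact/asboolP.
Qed.

Lemma bproj_repr q : bproj N (repr q) = q.
Proof. exact: generic_quotient.reprK. Qed.

Lemma repr_bproj x : bclosure (lspan N) (repr (bproj N x) - x).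
Proof.
suff : repr (bproj N x) - x \in closed_span N by move/asboolP.
by rewrite Quotient.idealrBE; apply/eqP; exact: bproj_repr.
Qed.

Lemma bclosure_kernel x : bclosure (lspan N) x -> m x = 0.
Proof.
move=> /(_ [set y | m y = 0]); apply; split; first exact: kernel_bclosed.
move=> _ [k [c [v [vN ->]]]]; rewrite /= linmap_sum// big1// => i _.
by rewrite linmapZ// mN// scaler0.
Qed.

(** [m] descends because its kernel is closed and contains [N]; the bounded section [s] inverts it,
    [sm] saying that x and s (m x) have the same class. *)
Theorem quotient_isomorphism : exists f : bhom (bquot N) W,
  (forall x, f (bproj N x) = m x) /\ isomorphism f.
Proof.
pose g (z : bquot N) := m (repr z).
have gE x : g (bproj N x) = m x.
  have := bclosure_kernel (repr_bproj x); rewrite (linmapB lm) => /eqP.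
  by rewrite subr_eq0 => /eqP.
have [||f fE] := @bhomP _ (bquot N) W g.
- move=> a x y; rewrite -{1}(bproj_repr x) -{1}(bproj_repr y).
  by rewrite -(bproj_linear N a) gE lm.
- move=> A [B sB AB]; apply: smallS (bm sB) => _ [z /AB[x Bx <-] <-].
  by exists x; rewrite ?gE.
have [||h hE] := @bhomP _ W (bquot N) (fun w => bproj N (s w)).
- by move=> a x y; rewrite ls bproj_linear.
- move=> A sA; exists (s @` A); first exact: bs.
  by move=> _ [x Ax <-]; exists (s x) => //; exists x.
exists f; split=> [x|]; first by rewrite fE gE.
exists h => [z|w]; last by rewrite fE hE gE ms.
rewrite hE fE; apply: etrans (bproj_repr z).
exact: esym (bproj_eq (sm (repr z))).
Qed.

End QuotientIsomorphism.

(** * Cut-offs by dilated functions *)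

Section CutOff.
Context {R : realType} {n : nat}.
Implicit Types (f w : schwartz R n).

Lemma pderives_cst i (w : seq 'I_n) (c : R[i]) :
  pderives (i :: w) (fun _ : 'rV[R]_n => c) = fun=> 0.
Proof. by elim: w i => [|j w IH] i /=; [exact: pderive_cst|rewrite [pderive j _]IH pderive_cst]. Qed.

Definition dilate (t : R) w := compose (fun x : 'rV[R]_n => t *: x) w.

Lemma dilate_proper (t : R) : 0 < t <= 1 ->
  proper_affine (fun i => t *: delta_mx 0 i) t^-1 (fun x : 'rV[R]_n => t *: x).
Proof.
move=> /andP[t0 t1]; split=> [x i h|x]; first by rewrite scalerDr !scalerA mulrC.
have -> : enorm (t *: x) = t * enorm x.
  rewrite /enorm -{2}[t]ger0_norm ?(ltW t0)// -sqrtr_sqr -sqrtrM ?sqr_ge0//.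
  by congr (Num.sqrt _); rewrite mulr_sumr; apply: eq_bigr => i _; rewrite mxE exprMn.
rewrite mulrDr mulr1 mulrA mulVf ?gt_eqF// mul1r lerD2r.
by rewrite invf_ge1.
Qed.

Lemma pderives_dilate (t : R) w v x : 0 < t <= 1 ->
  pderives v (dilate t w) x = (t ^+ size v : R)%:C * pderives v w (t *: x).
Proof.
move=> t01; rewrite (compose_derivatives w (dilate_proper t01)).
rewrite (_ : word_dir _ v w = (t ^+ size v)%:C *: sderive v w).
  by rewrite schwartzZE.
elim: v => [|i v IH]; first by rewrite scale1r; exact: schwartz_eq.
rewrite -[word_dir _ (i :: v) w]/(sdir (t *: delta_mx 0 i) (word_dir _ v w)) IH; apply: schwartz_eq => y.
rewrite sdirE (bigD1 i)// big1 => [|j ji]; last first.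
  by rewrite !mxE (negbTE ji) andbF mulr0 mul0r.
rewrite [LHS]addr0 !mxE !eqxx mulr1 schwartzZE pderives_scale.
by rewrite -[size (i :: v)]/(size v).+1 exprS rmorphM -mulrA.
Qed.

(** For the function itself the rate 1 / (N + 1) comes from w 0 = 1 and a Lipschitz bound, at the
    price of one weight; each derivative of positive order gains a factor 1 / (N + 1) from the
    dilation. *)
Lemma cutoff_slow w : w 0 = 1 -> exists2 b : seq 'I_n -> R, (forall v, 0 <= b v) &
  forall N, slow (fun x => 1 - dilate N.+1%:R^-1 w x) 1 (fun v => b v / N.+1%:R).
Proof.
move=> w0; have Cl i := schwartz_lip w [::] i; have Mw v := schwartz_bounded w v.
pose C := \sum_i s2val (cid2 (Cl i)).
have C0 : 0 <= C by apply: sumr_ge0 => i _; case: cid2.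
have lip x : normc (w x - w 0) <= C * (\sum_i `|x 0 i|).
  apply: le_trans (@lip_coord _ _ w C _ 0 x) _ => [i y h|].
    apply: le_trans (s2valP' (cid2 (Cl i)) y h) _; rewrite ler_wpM2r//.
    rewrite /C (bigD1 i)//= lerDl; apply: sumr_ge0 => j _; exact: s2valP (cid2 (Cl j)).
  by rewrite ler_wpM2l// ler_sum// => i _; rewrite mxE subr0.
exists (fun v => if v is [::] then C * n%:R else `|sval (cid (Mw v))|) => [[|//]|N].
  by rewrite mulr_ge0.
have t01 : 0 < (N.+1%:R^-1 : R) <= 1 by rewrite invr_gt0 ltr0Sn invf_le1 ?ltr0Sn// ler1n.
have /andP[t0 t1] := t01.
set u := dilate _ w; have E : (fun x => 1 - u x) = (fun x => 1 + (- u) x) by [].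
have s1 : smooth (fun _ : 'rV[R]_n => 1 : R[i]) := smooth_cst 1; have su := schwartz_smooth (- u).
split=> [|v x]; first by rewrite E; exact: (smoothD s1 su).
rewrite E (pderivesD v s1 su) expr1; case: v => [|i v].
  rewrite -[pderives _ _ x + _]/(1 - u x) normcBC -w0.
  rewrite (_ : u x = w (N.+1%:R^-1 *: x)); last exact: (composeE w x (dilate_proper t01)).
  apply: le_trans (lip _) _; rewrite -!mulrA ler_wpM2l//.
  apply: (@le_trans _ _ (\sum_(i < n) N.+1%:R^-1 * (1 + enorm x))).
    apply: ler_sum => i _; rewrite mxE normrM ger0_norm ?(ltW t0)// ler_wpM2l ?(ltW t0)//.
    by rewrite (le_trans (enorm_coord _ _))// lerDr.
  by rewrite sumr_const card_ord mulr_natl.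
rewrite pderives_cst add0r -scaleN1r pderives_scale normcM normcN (_ : normc 1 = 1); last first.
  by rewrite -[1]/(1%:C) normcR normr1.
rewrite mul1r pderives_dilate// normcM normcR ger0_norm ?exprn_ge0 ?(ltW t0)//.
set M := sval _; have M0 : normc (pderives (i :: v) w (N.+1%:R^-1 *: x)) <= `|M|.
  by apply: le_trans (ler_norm _); exact: svalP (cid (Mw (i :: v))) _.
apply: (@le_trans _ _ (N.+1%:R^-1 * `|M|)).
  rewrite ler_pM ?normc_ge0 ?exprn_ge0 ?(ltW t0)// exprS ler_piMr ?(ltW t0)//.
  by rewrite exprn_ile1 ?(ltW t0).
rewrite mulrC ler_peMr ?mulr_ge0 ?(ltW t0)//.
by rewrite lerDl enorm_ge0.
Qed.

Lemma cutoff w (A : set (schwartz R n)) : w 0 = 1 -> small A ->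
  small [set (N.+1%:R : R)%:C *: (dilate N.+1%:R^-1 w ** f - f) | N in setT & f in A].
Proof.
move=> /cutoff_slow[b b0 bw] /small_bounded_by[a a0 Aa]; apply/schwartz_smallP.
exists (fun k v => \sum_(p <- splits v) b p.1 * a (k + 1)%N p.2).
move=> k v _ x [N _ [f /Aa fa <-]]; rewrite pderives_scale normcM normcR ger0_norm//.
rewrite -mulrA mulrC -ler_pdivlMr// mulr_suml.
have := slow_bound (bw N) fa k v x; under eq_bigr do rewrite mulrAC.
apply: le_trans; rewrite le_eqVlt; apply/orP; left; apply/eqP; congr (_ * _).
rewrite -[LHS]normcN -mulN1r -pderives_scale; congr normc.
apply: (congr1 (fun g => pderives v g x)); apply/funext => y.
rewrite schwartzZE schwartzBE schwartz_mulE; ring.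
Qed.

End CutOff.

Section Action.
Context {R : realType}.

(** exp (-|x|^2 / 2) on R^n. Its value 1 at 0 serves sections and cut-offs; that it vanishes nowhere
    serves symbols of multipliers. *)
Fixpoint gaussian n : schwartz R n :=
  if n is n'.+1 then schwartz_tensor gauss1 (gaussian n') else one0.

Lemma gaussian0 n : gaussian n 0 = 1.
Proof.
elim: n => // n IH; rewrite -[gaussian _ _]/(gauss1 (lsubmx 0) * gaussian n (rsubmx 0)).
rewrite !linear0 IH mulr1 (_ : 0 = pt 0) ?gauss1E ?/gauss ?expr0n ?mul0r ?oppr0 ?expR0//.
by rewrite /pt raddf0.
Qed.

Section Linear.
Variables (p k : nat) (L : 'rV[R]_k -> 'rV[R]_p).
Hypothesis lL : linear L.

Definition graph y := row_mx (L y) y.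

Lemma graph_linear : linear graph.
Proof. by move=> a x y; rewrite /graph lL scale_row_mx add_row_mx. Qed.

Let graphK : cancel graph (@rsubmx R 1 p k).
Proof. by move=> y; rewrite row_mxKr. Qed.

(** The linear extension to S(R^(p+k)) of the bilinear action: (f, F) acts as the tensor f (x) F
    restricted to the graph. *)
Definition on_graph : schwartz R (p + k) -> schwartz R k := compose graph.

Lemma on_graphE H y : on_graph H y = H (row_mx (L y) y).
Proof. exact: compose_linE graph_linear (@linear_rsubmx R p k) graphK _ _. Qed.

Lemma on_graph_linear : linear on_graph.
Proof. exact: compose_lin_linear graph_linear (@linear_rsubmx R p k) graphK. Qed.

Lemma on_graph_bounded : bounded_map on_graph.
Proof. exact: compose_lin_bounded graph_linear (@linear_rsubmx R p k) graphK. Qed.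

Definition act f F : schwartz R k := on_graph (schwartz_tensor f F).

Lemma actE f F y : act f F y = f (L y) * F y.
Proof. by rewrite /act on_graphE schwartz_tensorE row_mxKl row_mxKr. Qed.

Lemma act_bounded : bounded_bilinear act.
Proof.
have [l r b] := @schwartz_tensor_bilinear R p k; split=> [f a F G|F a f g|A B sA sB].
- by rewrite /act l on_graph_linear.
- by rewrite /act r on_graph_linear.
apply: smallS (on_graph_bounded (b _ _ sA sB)) => _ [f Af [F BF <-]].
by exists (schwartz_tensor f F) => //; exists f => //; exists F.
Qed.

Lemma act_mul f g F : act (f ** g) F = act f (act g F).
Proof. by apply: schwartz_eq => y; rewrite !actE schwartz_mulE mulrA. Qed.

End Linear.

Section LeftFactor.
Variables p k : nat.
Implicit Types (u f : schwartz R p) (g : schwartz R k) (H : schwartz R (p + k)).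

Definition lact u H := act (@lsubmx R 1 p k) u H.

Let ls := @linear_lsubmx R p k.

Lemma lactE u H y : lact u H y = u (lsubmx y) * H y.
Proof. exact: actE ls u H y. Qed.

Lemma lact_linear u : linear (lact u).
Proof. by have [l _ _] := act_bounded ls; exact: l. Qed.

Lemma lact_bounded u : bounded_map (lact u).
Proof.
have [_ _ b] := act_bounded ls => A sA; apply: smallS (b _ _ (small1 u) sA).
by move=> _ [H AH <-]; exists u => //; exists H.
Qed.

Lemma lact_tensor u f g : lact u (schwartz_tensor f g) = schwartz_tensor (u ** f) g.
Proof. by apply: schwartz_eq => y; rewrite lactE !schwartz_tensorE schwartz_mulE mulrA. Qed.

(** The operators (N + 1)(u_N - 1) are equibounded on the first factor by [cutoff]; extending them
    as one family of bilinear maps gives the rate on the whole tensor product. *)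
Lemma lact_cutoff (w : schwartz R p) H : w 0 = 1 ->
  bcvg (fun N => lact (dilate N.+1%:R^-1 w) H) H.
Proof.
move=> w0; pose u N := dilate (N.+1%:R^-1 : R) w.
pose K N f := (N.+1%:R : R)%:C *: (u N ** f - f).
have [tl tr tb] := @schwartz_tensor_bilinear R p k.
have Kl N : linear (K N).
  move=> a f g; apply: schwartz_eq => x; rewrite /K.
  rewrite !(schwartzDE, schwartzZE, schwartzNE, schwartz_mulE).
  by move: (_%:C) (u N x) (f x) (g x) => *; ring.
pose b N f g := schwartz_tensor (K N f) g.
have bl N f : linear (b N f) by exact: tl.
have br N g : linear ((b N)^~ g) by move=> a f f'; rewrite /b Kl tr.
have bb A B : small A -> small B ->
    small [set x | exists N f g, [/\ A f, B g & x = b N f g]].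
  move=> sA sB; apply: smallS (tb _ _ (cutoff w0 sA) sB) => _ [N [f [g [Af Bg ->]]]].
  by exists (K N f); [exists N => //; exists f|exists g].
have sT := tensor_lift_small (@schwartz_complete R _) bl br bb (small1 H).
apply: bcvgI; eexists; first exact: sT.
move=> N; exists (tensor_lift (b N) H); first by exists N, H.
have E : tensor_lift (b N) H = (N.+1%:R : R)%:C *: (lact (u N) H - H).
  apply: (tensor_unique (complete_separated (@schwartz_complete R _))
    (g := fun H => (N.+1%:R : R)%:C *: (lact (u N) H - H))) => [||a H1 H2||f g].
  - exact: (tensor_lift_linear (@schwartz_complete R _) bl br bb).
  - move=> A sA; apply: smallS (tensor_lift_small (@schwartz_complete R _) bl br bb sA).
    by move=> _ [H' AH' <-]; exists N, H'.
  - apply: schwartz_eq => x; rewrite lact_linear.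
    rewrite !(schwartzDE, schwartzZE, schwartzNE).
    by move: (_%:C) (lact _ _ x) (lact _ _ x) (H1 x) (H2 x) => *; ring.
  - move=> A sA; apply: smallS (smallZ (N.+1%:R : R)%:C
      (smallD (lact_bounded (u N) sA) (smallZ (-1) sA))).
    move=> _ [H' AH' <-]; exists (lact (u N) H' - H') => //.
    exists (lact (u N) H'); first by exists H'.
    by exists (- H') => //; exists H' => //; rewrite scaleN1r.
  rewrite (tensor_lift_tensor (@schwartz_complete R _) bl br bb) lact_tensor; apply: schwartz_eq => y.
  rewrite !(schwartzDE, schwartzZE, schwartzNE, schwartz_tensorE).
  by move: (_%:C) ((u N ** f) _) (f _) (g _) => *; ring.
by rewrite E scalerA -rmorphM mulVf ?scale1r// pnatr_eq0.
Qed.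

End LeftFactor.

Section Essential.
Variables (p k : nat) (L : 'rV[R]_k -> 'rV[R]_p).
Hypothesis lL : linear L.

Let shear v := row_mx (lsubmx v - L (rsubmx v)) (rsubmx v : 'rV[R]_k).
Let unshear v := row_mx (lsubmx v + L (rsubmx v)) (rsubmx v : 'rV[R]_k).

Let shear_linear : linear shear.
Proof.
move=> a x y; rewrite /shear linear_lsubmx linear_rsubmx lL scale_row_mx add_row_mx.
by rewrite scalerBr opprD addrACA.
Qed.
Let unshear_linear : linear unshear.
Proof.
move=> a x y; rewrite /unshear linear_lsubmx linear_rsubmx lL scale_row_mx add_row_mx.
by rewrite scalerDr addrACA.
Qed.
Let shearK : cancel shear unshear.
Proof. by move=> v; rewrite /unshear /shear !row_mxKl !row_mxKr subrK hsubmxK. Qed.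

(** The shear (r, y) |-> (r - L y, y) turns this section of [on_graph] into a tensor product, so it
    is Schwartz and bounded in [F]. *)
Definition lift_graph (F : schwartz R k) := compose shear (schwartz_tensor (gaussian p) F).

Lemma lift_graphE F v :
  lift_graph F v = gaussian p (lsubmx v - L (rsubmx v)) * F (rsubmx v).
Proof.
rewrite /lift_graph (compose_linE shear_linear unshear_linear shearK) schwartz_tensorE.
by rewrite row_mxKl row_mxKr.
Qed.

Lemma lift_graph_linear : linear lift_graph.
Proof.
have [l _ _] := @schwartz_tensor_bilinear R p k.
by move=> a F G; rewrite /lift_graph l (compose_lin_linear shear_linear unshear_linear shearK).
Qed.

Lemma lift_graph_bounded : bounded_map lift_graph.
Proof.
move=> A sA; have [_ _ b] := @schwartz_tensor_bilinear R p k.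
apply: smallS (compose_lin_bounded shear_linear unshear_linear shearK
  (b _ _ (small1 (gaussian p)) sA)) => _ [F AF <-].
by exists (schwartz_tensor (gaussian p) F) => //; exists (gaussian p) => //; exists F.
Qed.

Lemma lift_graphK : cancel lift_graph (on_graph L).
Proof.
move=> F; apply: schwartz_eq => y; rewrite on_graphE// lift_graphE row_mxKl row_mxKr.
by rewrite subrr gaussian0 mul1r.
Qed.

(** [N] is abstract and the relations are asked for in its span because left and right modules have
    balancing relations of opposite sign. *)
Lemma graph_quotient (N : set (schwartz R (p + k))) :
  (forall z, N z -> on_graph L z = 0) ->
  (forall f h g, lspan N (schwartz_tensor (f ** h) g - schwartz_tensor f (act L h g))) ->
  exists f : bhom (bquot N) (schwartz R k),
    (forall H, f (bproj N H) = on_graph L H) /\ isomorphism f.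
Proof.
move=> N0 NS; have [tl _ tb] := @schwartz_tensor_bilinear R p k.
have gl := on_graph_linear lL; have gb := on_graph_bounded lL.
apply: (quotient_isomorphism (complete_separated (@schwartz_complete R _)) gl gb
  lift_graph_linear lift_graph_bounded N0 lift_graphK) => H.
set z := H - _; have z0 : on_graph L z = 0 by rewrite /z linmapB// lift_graphK subrr.
(* Modulo N, tensor (u ** f) g is tensor u (act f g); by density this determines the
   left multiplication by u, and the cut-offs u_N tend to 1. *)
have main u F : bclosure (lspan N) (lact u F - schwartz_tensor u (on_graph L F)).
  pose D F := lact u F - schwartz_tensor u (on_graph L F).
  have Dl : linear D.
    by move=> a F1 F2; rewrite /D lact_linear gl tl scalerBr opprD addrACA.
  have Db : bounded_map D.
    move=> A sA; apply: smallS (smallD (lact_bounded u sA)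
      (smallZ (-1) (tb _ _ (small1 u) (gb _ sA)))) => _ [F' AF <-].
    exists (lact u F'); first by exists F'.
    exists (- schwartz_tensor u (on_graph L F')) => //.
    exists (schwartz_tensor u (on_graph L F')); last by rewrite scaleN1r.
    by exists u => //; exists (on_graph L F') => //; exists F'.
  have [s sS sF] := tensor_dense F; move=> B [cB NB].
  apply: (cB (D \o s)); last exact: bcvg_lin.
  move=> j; apply: NB; have [i [c [v [vS /= ->]]]] := sS j.
  rewrite linmap_sum//; apply: lspan_sum => l; rewrite linmapZ//; apply: lspanZ.
  by have [f [g ->]] := vS l; rewrite /D lact_tensor; exact: NS.
(* [z] vanishes on the graph, so [main] puts each cut-off of [z] into the closed set B, and their
   limit [z] follows. *)
move=> B [cB NB]; apply: (cB) (lact_cutoff z (gaussian0 p)) => j.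
have := main (dilate j.+1%:R^-1 (gaussian p)) z; rewrite z0 linmap0// subr0.
by apply.
Qed.

Theorem essential_left_act (a : schwartz R p -> schwartz R k -> schwartz R k) :
  (forall f F y, a f F y = f (L y) * F y) -> essential_left a.
Proof.
move=> aE; have -> : a = act L.
  by apply/funext => f; apply/funext => F; apply: schwartz_eq => y; rewrite aE actE.
split; first by split=> [|f g F]; [exact: act_bounded|exact: act_mul].
exists (schwartz R (p + k)), (@schwartz_tensor R p k).
have [z [m [h [v ->]]]|f h g|f [fE fi]] :=
    @graph_quotient (balanced (@schwartz_tensor R p k) amul (act L)).
- rewrite (linmapB (on_graph_linear lL)) -[on_graph L _]/(act L _ _).
  by rewrite -[X in _ - X]/(act L _ _) act_mul// subrr.
- by apply: lspan1; exists f, h, g.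
by exists f; split=> //; exact: schwartz_ctensor.
Qed.

Lemma ctensor_flip (V W T : bornType R) (t : V -> W -> T) : is_ctensor t ->
  is_ctensor (fun w v => t v w).
Proof.
move=> [cT bt ut]; split=> // [|X cX b bb]; first exact: bounded_bilinear_flip.
have [f [fE fu]] := ut X cX _ (bounded_bilinear_flip bb).
by exists f; split=> // g gE; apply: fu.
Qed.

Theorem essential_right_act (a : schwartz R k -> schwartz R p -> schwartz R k) :
  (forall F f y, a F f y = f (L y) * F y) -> essential_right a.
Proof.
move=> aE; have -> : a = (fun F f => act L f F).
  by apply/funext => F; apply/funext => f; apply: schwartz_eq => y; rewrite aE actE.
split.
  split=> [|F f g]; first exact: bounded_bilinear_flip (act_bounded lL).
  by rewrite schwartz_mulC act_mul.
pose t := (fun F f => @schwartz_tensor R p k f F).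
exists (schwartz R (p + k)), t.
have [z [m [h [v ->]]]|f h g|f [fE fi]] :=
    @graph_quotient (balanced t (fun F f => act L f F) amul).
- rewrite (linmapB (on_graph_linear lL)) -[on_graph L _]/(act L _ _).
  rewrite -[X in _ - X]/(act L _ _) schwartz_mulC act_mul// subrr//.
- rewrite -opprB -scaleN1r; apply/lspanZ/lspan1.
  by exists g, h, f; rewrite schwartz_mulC.
exists f; split=> //.
exact: ctensor_flip (@schwartz_ctensor R p k).
Qed.

End Essential.
End Action.

(** * The Lebesgue integral *)

Section Integral.
Context {R : realType}.

Lemma tails_shift (P : R -> R) I a : tails P I -> tails (fun x => P (x + a)) I.
Proof.
move=> tP e /tP[B [hB1 hB2]]; exists (B + `|a|); split=> x xB.
  by apply: hB1; have := ler_norm a; lra.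
by apply: hB2; have := ler_norm (- a); rewrite normrN; lra.
Qed.

Lemma derive_shift (P p : R -> R) (a : R) : (forall x : R, is_derive x 1 P (p x)) ->
  forall x : R, is_derive x 1 (fun t => P (t + a)) (p (x + a)).
Proof.
move=> dP x.
have dg : is_derive x 1 (fun t : R => t + a) 1.
  by rewrite -[1 in X in is_derive _ _ _ X]addr0; exact: is_deriveD.
have dP' : is_derive ((fun t : R => t + a) x) 1 P (p (x + a)) := dP _.
by have := @is_derive1_comp _ P (fun t : R => t + a) _ _ _ dP' dg; rewrite mulr1.
Qed.

Lemma I1_shift (f g : schwartz R 1) a : (forall x, g (pt x) = f (pt (x + a))) -> I1 g = I1 f.
Proof.
move=> gf; apply: complexP.
  have [P [dP tP]] := primR f; have [Q [dQ tQ]] := primR g.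
  apply: (tails_unique (p := fun x => Re (g (pt x))) dQ _ tQ (tails_shift a tP)) => x.
  by rewrite gf; exact: (derive_shift a dP).
have [P [dP tP]] := primI f; have [Q [dQ tQ]] := primI g.
apply: (tails_unique (p := fun x => Im (g (pt x))) dQ _ tQ (tails_shift a tP)) => x.
by rewrite gf; exact: (derive_shift a dP).
Qed.

Lemma integral0E (f : schwartz R 0) : schwartz_integral f = f 0.
Proof. by apply: complexP. Qed.

(** The hypotheses in dimension n make the slice meaningful; hence linearity and boundedness are
    proved together by induction on the dimension. *)
Lemma integralSE n (F : schwartz R (1 + n)) :
  linear (@schwartz_integral R n) -> bounded_map (@schwartz_integral R n) ->
  @schwartz_integral R n.+1 F = I1 (slice (@schwartz_integral R n) F).
Proof.
move=> l b; apply: complexP => /=; congr (Rintegral _ _ _); apply/funext => x.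
  by rewrite sliceE//=; congr iterated_integral; apply/funext => y; rewrite restrE.
by rewrite sliceE//=; congr iterated_integral; apply/funext => y; rewrite restrE.
Qed.

Lemma integral_functional n :
  linear (@schwartz_integral R n) /\ bounded_map (@schwartz_integral R n).
Proof.
elim: n => [|n [l b]].
  split=> [a f g|A /eval_bound[M AM]]; first by rewrite !integral0E.
  by exists M => _ [f Af <-]; rewrite integral0E; exact: AM.
split=> [a f g|A sA].
  rewrite !(integralSE _ l b); rewrite -I1_linear; congr I1.
  exact: (@slice_linear R 1 n _ l b).
have lb (B : set (schwartz R n)) : small B -> exists M : R, forall (_ : unit) f, B f -> normc (schwartz_integral f) <= M.
  by move=> sB; have [M BM] := functional_bound b sB; exists M => _; exact: BM.
have := I1_bounded (@slice_small R 1 n unit (fun=> @schwartz_integral R n) A (fun=> l) lb sA).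
apply: smallS => _ [f Af <-]; rewrite integralSE//.
by exists (@slice R 1 n (@schwartz_integral R n) f) => //; exists tt => //; exists f.
Qed.

Lemma integral_linear n : linear (@schwartz_integral R n).
Proof. by have [] := integral_functional n. Qed.

Lemma integral_bounded n : bounded_map (@schwartz_integral R n).
Proof. by have [] := integral_functional n. Qed.

Lemma add_row_mxr m n (a : 'rV[R]_(m + n)) x y :
  a + row_mx x y = row_mx (lsubmx a + x) (rsubmx a + y).
Proof. by rewrite -[in LHS](hsubmxK a) add_row_mx. Qed.

(** The translate is passed as a given Schwartz function [g]. The last n coordinates are shifted by
    induction, the first one by [I1_shift]. *)
Lemma integral_translation n (f g : schwartz R n) a :
  (forall x, g x = f (a + x)) -> schwartz_integral g = schwartz_integral f.
Proof.
elim: n f g a => [|n IH] f g a gf; first by rewrite !integral0E gf (row0_eq (a + 0)).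
have l := @integral_linear n; have b := @integral_bounded n.
rewrite !(integralSE _ l b).
apply: (@I1_shift (slice (@schwartz_integral R n) (f : schwartz R (1 + n)))
  (slice (@schwartz_integral R n) (g : schwartz R (1 + n)))
  ((lsubmx (a : 'rV[R]_(1 + n))) 0 0)) => x; rewrite !sliceE//.
apply: (IH _ _ (rsubmx (a : 'rV[R]_(1 + n)))) => y; rewrite !restrE gf; congr (f _).
rewrite [LHS](@add_row_mxr 1 n a); apply: (congr2 (@row_mx R 1 1 n)) => //.
by move: (lsubmx _) => u; rewrite -[u in LHS]ptK addrC /pt raddfD.
Qed.

Lemma integral_pos n (f : schwartz R n) : (forall x, 0 <= Re (f x)) ->
  0 <= Re (schwartz_integral f) /\ (Re (schwartz_integral f) = 0 -> forall x, Re (f x) = 0).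
Proof.
elim: n f => [|n IH] f f0; first by rewrite integral0E; split=> // fx x; rewrite (row0_eq x).
have l := @integral_linear n; have b := @integral_bounded n; rewrite integralSE//.
have P x : (forall y, 0 <= Re (restr (pt x) (f : schwartz R (1 + n)) y)).
  by move=> y; rewrite restrE; exact: f0.
have G0 x : 0 <= Re (slice (@schwartz_integral R n) (f : schwartz R (1 + n)) (pt x)).
  by rewrite sliceE//; have [] := IH _ (P x).
split=> [|I0 x]; first exact: I1_ge0.
have := I1_eq0 G0 I0 ((lsubmx (x : 'rV[R]_(1 + n))) 0 0); rewrite sliceE// => E.
have := (IH _ (P _)).2 E (rsubmx (x : 'rV[R]_(1 + n))).
by rewrite restrE ptK hsubmxK.
Qed.

Lemma integral_faithful n : faithful (@schwartz_integral R n : schwartz R n -> _).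
Proof.
have main (f : schwartz R n) : schwartz_integral (f ** sconj f) = 0 -> f = 0.
  move=> If; apply: schwartz_eq => x; apply: eq0_normc.
  have E y : Re ((f ** sconj f) y) = normc (f y) ^+ 2.
    rewrite schwartz_mulE sconjE; case: (f y) => u v /=.
    by rewrite sqr_sqrtr ?addr_ge0 ?sqr_ge0//; ring.
  have [|_] := @integral_pos n (f ** sconj f); first by move=> y; rewrite E sqr_ge0.
  by rewrite If => /(_ erefl x)/eqP; rewrite E sqrf_eq0 => /eqP.
split=> f fg; apply: main; first exact: fg.
by rewrite schwartz_mulC; exact: fg.
Qed.

End Integral.

(** * Multipliers and the comultiplication *)

Section Symbols.
Context {R : realType}.

Lemma gaussian_neq0 n (x : 'rV[R]_n) : gaussian n x != 0.
Proof.
elim: n x => [|n IH] x; first exact: oner_neq0.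
rewrite -[gaussian _ x]/(gauss1 (lsubmx (x : 'rV[R]_(1 + n))) * gaussian n (rsubmx (x : 'rV[R]_(1 + n)))).
rewrite mulf_neq0// -(ptK (lsubmx _)) gauss1E fmorph_eq0 gt_eqF//.
exact: gauss_gt0.
Qed.

Lemma mulL_linear (H : bornAlgType R) (a : R[i]) (m m' : multiplier H) f :
  mulL (a *: m + m') f = a *: mulL m f + mulL m' f.
Proof. by []. Qed.

Section Symbol.
Variable n : nat.
Implicit Types (m : multiplier (schwartz R n)) (f : schwartz R n) (x : 'rV[R]_n).

(* A multiplier of S(R^n) is the multiplication by a function, its symbol. *)
Definition symbol m x : R[i] := mulL m (gaussian n) x / gaussian n x.

(** By commutativity m(f) w = m(f w) = m(w) f, with w the nowhere vanishing Gaussian. *)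
Lemma mulLE m f x : mulL m f x = symbol m x * f x.
Proof.
have [m1 _ _] := multiplierP m; rewrite /symbol mulrAC; apply/eqP.
rewrite -(inj_eq (mulIf (gaussian_neq0 x))) divfK ?gaussian_neq0//.
by rewrite -!schwartz_mulE -!m1 schwartz_mulC.
Qed.

Lemma mulRE m f x : mulR m f x = symbol m x * f x.
Proof.
have [_ _ m3] := multiplierP m; apply/eqP.
rewrite -(inj_eq (mulIf (gaussian_neq0 x))) -[X in X == _]schwartz_mulE -m3.
by rewrite schwartz_mulE mulLE mulrCA mulrA.
Qed.

Lemma symbol_unique m x c : (forall f, mulL m f x = c * f x) -> symbol m x = c.
Proof. by move=> mc; rewrite /symbol mc mulfK// gaussian_neq0. Qed.

Lemma symbol_inj m m' : symbol m =1 symbol m' -> m = m'.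
Proof.
by move=> mm; apply: multiplier_eq => f; apply: schwartz_eq => x; rewrite ?mulLE ?mulRE mm.
Qed.

Lemma symbolM m m' x : symbol (m ** m') x = symbol m x * symbol m' x.
Proof.
by apply: symbol_unique => f; rewrite -[mulL _ f]/(mulL m (mulL m' f)) !mulLE mulrA.
Qed.

Lemma symbol1 x : symbol mult_one x = 1.
Proof. by apply: symbol_unique => f; rewrite mul1r. Qed.

Lemma symbol_of f x : symbol (mult_of f) x = f x.
Proof. exact: symbol_unique. Qed.

Lemma symbolP (a : R[i]) m m' x : symbol (a *: m + m') x = a * symbol m x + symbol m' x.
Proof.
apply: symbol_unique => f.
rewrite mulL_linear schwartzDE schwartzZE.
by rewrite !mulLE; move: (symbol m x) (symbol m' x) (f x) => s s' c; rewrite mulrDl mulrA.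
Qed.

Lemma mulL_small (A : set (multiplier (schwartz R n))) (S : set (schwartz R n)) :
  small A -> small S -> small [set mulL m f | m in A & f in S].
Proof.
move=> [sA _] sS; apply: smallS (sA S sS) => _ [m Am [f Sf <-]].
by exists (mulL m); [exists (mult_val m) => //; exists m|exists f].
Qed.

End Symbol.

Lemma symbol_comul n (f : schwartz R n) v :
  symbol (schwartz_comul n f) v = f (lsubmx v + rsubmx v).
Proof. exact: symbol_unique. Qed.

Section Pullback.
Variables (p k : nat) (L : 'rV[R]_k -> 'rV[R]_p).
Hypothesis lL : linear L.
Implicit Types (m : multiplier (schwartz R p)).

Let b (m : multiplier (schwartz R p)) f v := act L (mulL m f) v.

Let bl m f : linear (b m f).
Proof. by have [l _ _] := act_bounded lL; exact: l. Qed.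

Let br m v : linear ((b m)^~ v).
Proof. by have [_ r _] := act_bounded lL; move=> a f g; rewrite /b linearP r. Qed.

(** The index type is the small set [E] of multipliers, so that extending the whole family makes the
    pullback bounded in the multiplier as well. *)
Let bb (E : set (multiplier (schwartz R p))) : small E ->
  forall A B, small A -> small B ->
  small [set x | exists (m : {m | E m}) f v, [/\ A f, B v & x = b (sval m) f v]].
Proof.
move=> sE A B sA sB; have [_ _ ab] := act_bounded lL.
apply: smallS (ab _ _ (mulL_small sE sA) sB) => _ [[m Em] [f [v [Af Bv ->]]]].
by exists (mulL m f) => //; [exists m => //; exists f|exists v].
Qed.

Let self m : {m' | [set m] m'} := exist _ m erefl.

Let cS := @schwartz_complete R k.

Lemma pullback_lift m H y : tensor_lift (b m) H y = symbol m (L y) * H (row_mx (L y) y).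
Proof.
have sb := bb (small1 m).
have tl := tensor_lift_linear cS (fun i => bl (sval i)) (fun i => br (sval i)) sb (self m).
apply: (@tensor_unique R p k (R[i]^o : bornType R)
  (fun H => tensor_lift (b m) H y) (fun H => symbol m (L y) * H (row_mx (L y) y))).
- exact: scalar_separated.
- by move=> a F G; rewrite tl.
- move=> A sA; have [M TM] := eval_bound (tensor_lift_small cS (fun i => bl (sval i))
    (fun i => br (sval i)) sb sA).
  by exists M => _ [H' AH' <-]; apply: TM; exists (self m), H'.
- by move=> a F G; rewrite schwartzDE schwartzZE mulrDr mulrCA.
- move=> A /(eval_bounded (row_mx (L y) y))/(smallZ (symbol m (L y))).
  by apply: smallS => _ [F AF <-]; exists (F (row_mx (L y) y)) => //; exists F.
move=> f v.
rewrite (tensor_lift_tensor cS (fun i => bl (sval i)) (fun i => br (sval i)) sb (self m)).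
by rewrite actE// mulLE schwartz_tensorE row_mxKl row_mxKr mulrA.
Qed.

(* The multiplier acts on a tensor f (x) v through f; extending to the completed tensor
   product makes it act on [lift_graph v], whose restriction to the graph of L is v. *)
Lemma pullback_exists : exists P : multiplier (schwartz R p) -> schwartz R k -> schwartz R k,
  (forall m v y, P m v y = symbol m (L y) * v y) /\
  (forall E A, small E -> small A -> small [set P m v | m in E & v in A]).
Proof.
exists (fun m v => tensor_lift (b m) (lift_graph L v)); split=> [m v y|E A sE sA].
  by rewrite pullback_lift (lift_graphE lL) row_mxKl row_mxKr subrr gaussian0 mul1r.
have := tensor_lift_small cS (fun i => bl (sval i)) (fun i => br (sval i))
  (bb sE) (lift_graph_bounded lL sA).
apply: smallS => _ [m Em [v Av <-]]; exists (exist _ m Em), (lift_graph L v); split=> //.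
Qed.

(** Supplies the extensions of D (x) id and id (x) D to multipliers, and, for projections L, the
    multipliers f (x) 1 and 1 (x) f. *)
Theorem multiplier_pullback :
  exists E : bhom (multiplier (schwartz R p)) (multiplier (schwartz R k)),
    forall m y, symbol (E m) y = symbol m (L y).
Proof.
have [P [PE Ps]] := pullback_exists.
have Pb m : is_bhom (P m).
  apply/asboolP; split=> [a v w|A sA].
    apply: schwartz_eq => y; rewrite schwartzDE schwartzZE !PE schwartzDE schwartzZE.
    by rewrite mulrDr mulrCA.
  by apply: smallS (Ps _ _ (small1 m) sA) => _ [v Av <-]; exists m => //; exists v.
have Pm m : is_multiplier (BHom (Pb m), BHom (Pb m)).
  apply/asboolP; split=> F G; apply: schwartz_eq => y /=.
  - by rewrite PE !schwartz_mulE PE mulrA.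
  - by rewrite PE !schwartz_mulE PE mulrCA.
  - by rewrite !PE mulrCA mulrA.
have sE m y : symbol (Multiplier (Pm m)) y = symbol m (L y).
  by apply: symbol_unique => f; exact: PE.
have [||E EE] := @bhomP _ _ _ (fun m => Multiplier (Pm m)).
- by move=> a m m'; apply: symbol_inj => y; rewrite symbolP !sE symbolP.
- move=> A sA; split=> S sS; apply: smallS (Ps _ _ sA sS);
    by move=> _ [_ [_ [_ [m Am <-] <-] <-] [v Sv <-]]; exists m => //; exists v.
by exists E => m y; rewrite EE.
Qed.

End Pullback.
End Symbols.

(** * Coassociativity, Galois maps and invariance *)

Section QuantumGroup.
Context {R : realType}.

Lemma tensor_mult_symbol p q (m : multiplier (schwartz R p)) (m' : multiplier (schwartz R q))
    (x : multiplier (schwartz R (p + q))) :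
  (forall v, symbol x v = symbol m (lsubmx v) * symbol m' (rsubmx v)) ->
  tensor_mult (@schwartz_tensor R p q) m m' x.
Proof.
move=> xE; split=> f g; apply: schwartz_eq => v.
  by rewrite schwartz_tensorE !mulLE xE schwartz_tensorE mulrACA.
by rewrite schwartz_tensorE !mulRE xE schwartz_tensorE mulrACA.
Qed.

Lemma tensor_algebra_schwartz p q : tensor_algebra (@schwartz_tensor R p q).
Proof.
split=> [|f g h k]; first exact: schwartz_ctensor.
by apply: schwartz_eq => v; rewrite schwartz_mulE !schwartz_tensorE !schwartz_mulE mulrACA.
Qed.

Lemma compose_isomorphism p q (L : 'rV[R]_p -> 'rV[R]_q) M : linear L -> linear M ->
  cancel L M -> cancel M L -> exists2 G : bhom (schwartz R q) (schwartz R p),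
    forall F x, G F x = F (L x) & isomorphism G.
Proof.
move=> lL lM LM ML.
have [G GE] := bhomP (compose_lin_linear lL lM LM) (compose_lin_bounded lL lM LM).
have [G' GE'] := bhomP (compose_lin_linear lM lL ML) (compose_lin_bounded lM lL ML).
have E F x : G F x = F (L x) by rewrite GE (compose_linE lL lM LM).
have E' F x : G' F x = F (M x) by rewrite GE' (compose_linE lM lL ML).
exists G => //; exists G' => F; apply: schwartz_eq => x; first by rewrite E' E ML.
by rewrite E E' LM.
Qed.

(** The two bracketings of a triple tensor product live on differently typed spaces of row vectors;
    this moves one model onto the other. *)
Lemma ctensor_iso (V W T T' : bornType R) (t : V -> W -> T) (i : bhom T T') :
  complete T' -> isomorphism i -> is_ctensor t -> is_ctensor (fun v w => i (t v w)).
Proof.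
move=> cT' [j ij ji] [cT [tl tr tb] ut]; split=> // [|X cX b bb].
  split=> [v a w w'|w a v v'|A B sA sB]; rewrite ?tl ?tr ?linearP//.
  apply: smallS (bhom_bounded i (tb _ _ sA sB)) => _ [v Av [w Bw <-]].
  by exists (t v w) => //; exists v => //; exists w.
have [f [fE fu]] := ut X cX b bb; exists (bhom_comp f j).
split=> [v w|g gE]; first by rewrite /= ij.
apply: bhom_eq => z /=; rewrite (fu (bhom_comp g i)); last exact: gE.
by rewrite /= ji.
Qed.

Variable n : nat.
Local Notation S := (schwartz R n).
Local Notation D := (@schwartz_comul R n).
Local Notation t := (@schwartz_tensor R n n).
Local Notation add2 := (fun v : 'rV[R]_(n + n) => lsubmx v + rsubmx v).

Lemma add2_linear : linear add2.
Proof. by move=> a x y; rewrite linear_lsubmx linear_rsubmx scalerDr addrACA. Qed.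

Lemma comul_hom : algebra_hom D.
Proof.
by move=> f g; apply: symbol_inj => v; rewrite symbolM !symbol_comul schwartz_mulE.
Qed.

Lemma comul_essential : essential_hom D.
Proof.
split; first exact: comul_hom.
  by apply: (essential_left_act add2_linear) => f F y; rewrite mulLE symbol_comul.
by apply: (essential_right_act add2_linear) => f F y; rewrite mulRE symbol_comul.
Qed.

(** (r, s, t) |-> (r + s, t), the substitution behind D (x) id; [right2] gives (r, s + t) for id (x)
    D. *)
Let left2 (v : 'rV[R]_(n + n + n)) : 'rV[R]_(n + n) :=
  row_mx (lsubmx (lsubmx v) + rsubmx (lsubmx v)) (rsubmx v).
Let right2 (v : 'rV[R]_(n + n + n)) : 'rV[R]_(n + n) :=
  row_mx (lsubmx (lsubmx v)) (rsubmx (lsubmx v) + rsubmx v).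
Let assoc (v : 'rV[R]_(n + n + n)) : 'rV[R]_(n + (n + n)) :=
  row_mx (lsubmx (lsubmx v)) (row_mx (rsubmx (lsubmx v)) (rsubmx v)).
Let unassoc (v : 'rV[R]_(n + (n + n))) : 'rV[R]_(n + n + n) :=
  row_mx (row_mx (lsubmx v) (lsubmx (rsubmx v))) (rsubmx (rsubmx v)).

Let left2_linear : linear left2.
Proof.
move=> a x y; rewrite /left2 !(linear_lsubmx, linear_rsubmx) scale_row_mx add_row_mx.
by rewrite scalerDr addrACA.
Qed.
Let right2_linear : linear right2.
Proof.
move=> a x y; rewrite /right2 !(linear_lsubmx, linear_rsubmx) scale_row_mx add_row_mx.
by rewrite scalerDr addrACA.
Qed.
Let assoc_linear : linear assoc.
Proof.
move=> a x y; rewrite /assoc !(linear_lsubmx, linear_rsubmx).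
by rewrite !scale_row_mx !add_row_mx.
Qed.
Let unassoc_linear : linear unassoc.
Proof.
move=> a x y; rewrite /unassoc !(linear_lsubmx, linear_rsubmx).
by rewrite !scale_row_mx !add_row_mx.
Qed.
Let assocK : cancel assoc unassoc.
Proof. by move=> v; rewrite /assoc /unassoc !(row_mxKl, row_mxKr) !hsubmxK. Qed.
Let unassocK : cancel unassoc assoc.
Proof. by move=> v; rewrite /assoc /unassoc !(row_mxKl, row_mxKr) !hsubmxK. Qed.

Lemma comul_coassociative : coassociative t D.
Proof.
have [i iE ii] := compose_isomorphism assoc_linear unassoc_linear assocK unassocK.
pose tr f F := i (@schwartz_tensor R n (n + n) f F).
have trE f F v : tr f F v = f (lsubmx (lsubmx v)) * F (row_mx (rsubmx (lsubmx v)) (rsubmx v)).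
  by rewrite /tr iE schwartz_tensorE /assoc row_mxKl row_mxKr.
have [DI DIE] := multiplier_pullback left2_linear.
have [ID IDE] := multiplier_pullback right2_linear.
have ext (E : bhom (multiplier (schwartz R (n + n))) (multiplier (schwartz R (n + n + n))))
    L : (forall m y, symbol (E m) y = symbol m (L y)) ->
    unital_extension (bhom_comp E mult_of) E.
  move=> EE; split=> [m m'||//]; apply: symbol_inj => v; first by rewrite symbolM !EE symbolM.
  by rewrite EE !symbol1.
exists (schwartz R (n + n + n)), (@schwartz_tensor R (n + n) n), tr,
  (bhom_comp DI mult_of), (bhom_comp ID mult_of), DI, ID; split; split.
- exact: tensor_algebra_schwartz.
- split=> [|f F g G].
    exact: ctensor_iso (@schwartz_complete R _) ii (@schwartz_ctensor R n (n + n)).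
  by apply: schwartz_eq => v; rewrite schwartz_mulE !trE !schwartz_mulE mulrACA.
- move=> f g h; apply: schwartz_eq => v.
  by rewrite trE !schwartz_tensorE row_mxKl row_mxKr mulrA.
- move=> f g; apply: tensor_mult_symbol => v; rewrite DIE !symbol_of symbol_comul.
  by rewrite schwartz_tensorE /left2 row_mxKl row_mxKr.
- exact: ext DIE.
- move=> f g; split=> a F; apply: schwartz_eq => v.
    rewrite mulLE IDE !trE !mulLE !symbol_of symbol_comul schwartz_tensorE.
    by rewrite /right2 !row_mxKl !row_mxKr mulrACA.
  rewrite mulRE IDE !trE !mulRE !symbol_of symbol_comul schwartz_tensorE.
  by rewrite /right2 !row_mxKl !row_mxKr mulrACA.
- exact: ext IDE.
- move=> f; apply: symbol_inj => v; rewrite DIE IDE !symbol_comul /left2 /right2.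
  by rewrite !row_mxKl !row_mxKr addrA.
Qed.

(** Each Galois map is F |-> F o map; for instance D(f)(g (x) 1) is f(s + t) g(s), which is f (x) g
    at (s + t, s). *)
Definition gamma_l_map (v : 'rV[R]_(n + n)) := row_mx (add2 v) (lsubmx v).
Definition gamma_r_map (v : 'rV[R]_(n + n)) := row_mx (add2 v) (rsubmx v).
Definition rho_l_map (v : 'rV[R]_(n + n)) := row_mx (lsubmx v) (add2 v).
Definition rho_r_map (v : 'rV[R]_(n + n)) := row_mx (rsubmx v) (add2 v).

Lemma row_mx_linear (f g : 'rV[R]_(n + n) -> 'rV[R]_n) : linear f -> linear g ->
  linear (fun v => row_mx (f v) (g v)).
Proof. by move=> lf lg a x y; rewrite lf lg scale_row_mx add_row_mx. Qed.

Lemma sub2_linear : linear (fun v : 'rV[R]_(n + n) => lsubmx v - rsubmx v).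
Proof. by move=> a x y; rewrite linear_lsubmx linear_rsubmx scalerBr opprD addrACA. Qed.

Lemma rsub2_linear : linear (fun v : 'rV[R]_(n + n) => rsubmx v - lsubmx v).
Proof. by move=> a x y; rewrite linear_lsubmx linear_rsubmx scalerBr opprD addrACA. Qed.

Let ll := @linear_lsubmx R n n.
Let lr := @linear_rsubmx R n n.

Lemma galois_maps : exists gl gr rl rr : bhom (schwartz R (n + n)) (schwartz R (n + n)),
  [/\ forall F v, gl F v = F (gamma_l_map v), forall F v, gr F v = F (gamma_r_map v),
      forall F v, rl F v = F (rho_l_map v) & forall F v, rr F v = F (rho_r_map v)] /\
  [/\ isomorphism gl, isomorphism gr, isomorphism rl & isomorphism rr].
Proof.
have [v|v|gl glE gli] := compose_isomorphism (row_mx_linear add2_linear ll)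
  (row_mx_linear lr sub2_linear).
- by rewrite !row_mxKl !row_mxKr addrAC subrr add0r hsubmxK.
- by rewrite !row_mxKl !row_mxKr addrC subrK hsubmxK.
have [v|v|gr grE gri] := compose_isomorphism (row_mx_linear add2_linear lr)
  (row_mx_linear sub2_linear lr).
- by rewrite !row_mxKl !row_mxKr addrK hsubmxK.
- by rewrite !row_mxKl !row_mxKr subrK hsubmxK.
have [v|v|rl rlE rli] := compose_isomorphism (row_mx_linear ll add2_linear)
  (row_mx_linear ll rsub2_linear).
- by rewrite !row_mxKl !row_mxKr addrAC subrr add0r hsubmxK.
- by rewrite !row_mxKl !row_mxKr addrC subrK hsubmxK.
have [v|v|rr rrE rri] := compose_isomorphism (row_mx_linear lr add2_linear)
  (row_mx_linear rsub2_linear ll).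
- by rewrite !row_mxKl !row_mxKr addrK hsubmxK.
- by rewrite !row_mxKl !row_mxKr subrK hsubmxK.
by exists gl, gr, rl, rr.
Qed.

Lemma left_symbol (f : S) : exists2 m : multiplier (schwartz R (n + n)),
  tensor_mult t (mult_of f) mult_one m & forall v, symbol m v = f (lsubmx v).
Proof.
have [E EE] := multiplier_pullback ll.
exists (E (mult_of f)) => [|v]; last by rewrite EE symbol_of.
by apply: tensor_mult_symbol => v; rewrite EE symbol1 mulr1.
Qed.

Lemma right_symbol (f : S) : exists2 m : multiplier (schwartz R (n + n)),
  tensor_mult t mult_one (mult_of f) m & forall v, symbol m v = f (rsubmx v).
Proof.
have [E EE] := multiplier_pullback lr.
exists (E (mult_of f)) => [|v]; last by rewrite EE symbol_of.
by apply: tensor_mult_symbol => v; rewrite EE symbol1 mul1r.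
Qed.

Lemma integral_left_invariant (gl rl : bhom (schwartz R (n + n)) (schwartz R (n + n))) :
  (forall F v, gl F v = F (gamma_l_map v)) -> (forall F v, rl F v = F (rho_l_map v)) ->
  left_invariant t gl rl (@schwartz_integral R n).
Proof.
move=> glE rlE f; have il := @integral_linear R n; have ib := @integral_bounded R n.
have lb (B : set S) : small B -> exists M : R,
    forall (_ : unit) g, B g -> normc (schwartz_integral g) <= M.
  by move=> sB; have [M BM] := functional_bound ib sB; exists M => _; exact: BM.
have [|A sA|s sE] := @bhomP _ _ _ (@slice R n n (@schwartz_integral R n)).
- exact: slice_linear.
- apply: smallS (@slice_small R n n unit (fun=> @schwartz_integral R n) A (fun=> il) lb sA).
  by move=> _ [F AF <-]; exists tt => //; exists F.
exists s => [a b|g]; first by rewrite sE slice_tensor.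
have main (K : schwartz R (n + n)) :
    (forall x y, K (row_mx x y) = f (x + y) * g x) -> s K = schwartz_integral f *: g.
  move=> KE; apply: schwartz_eq => x; rewrite sE sliceE// schwartzZE.
  (* For nonzero g x the translate y |-> f (x + y) is obtained as the Schwartz function (g x)^-1
     K(x, .); if g x = 0 both sides vanish. *)
  have [g0|g0] := eqVneq (g x) 0.
    rewrite g0 mulr0 (_ : restr x K = 0) ?linmap0//.
    by apply: schwartz_eq => y; rewrite restrE KE g0 mulr0.
  have E : restr x K = g x *: ((g x)^-1 *: restr x K) by rewrite scalerA divff ?scale1r.
  rewrite E (functionalZ il) mulrC; congr (_ * _).
  apply: (integral_translation (a := x)) => y.
  by rewrite schwartzZE restrE KE mulrC mulfK.
split.
  rewrite (main (gl (t f g))); first by [].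
  by move=> x y; rewrite glE schwartz_tensorE /gamma_l_map !row_mxKl !row_mxKr.
rewrite (main (rl (t g f))); first by [].
by move=> x y; rewrite rlE schwartz_tensorE /rho_l_map !row_mxKl !row_mxKr mulrC.
Qed.

End QuantumGroup.

Theorem proposition10p2 (R : realType) (n : nat) :
  bornological_quantum_group (@schwartz_tensor R n n) (@schwartz_comul R n)
    (@schwartz_integral R n).
Proof.
split; first split.
- exact: schwartz_complete.
- split.
    exists (gaussian n); apply/eqP => g0; have /eqP := @gaussian_neq0 R n 0.
    by rewrite g0.
  by apply: (@essential_left_act R n n id) => // f F y; rewrite schwartz_mulE.
- exact: schwartz_approximation.
- exact: tensor_algebra_schwartz.
- by split; [exact: comul_essential|exact: comul_coassociative].
have [gl [gr [rl [rr [[glE grE rlE rrE] [gli gri rli rri]]]]]] := @galois_maps R n.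
exists gl, gr, rl, rr; split; last first.
  split; first by split.
  split; last exact: integral_left_invariant.
    by split; [exact: integral_linear|exact: integral_bounded].
  exact: integral_faithful.
split=> f g.
- have [m mt mE] := left_symbol g; exists m => //; apply: symbol_inj => v.
  rewrite symbol_of glE symbolM symbol_comul mE schwartz_tensorE /gamma_l_map.
  by rewrite row_mxKl row_mxKr.
- have [m mt mE] := right_symbol g; exists m => //; apply: symbol_inj => v.
  rewrite symbol_of grE symbolM symbol_comul mE schwartz_tensorE /gamma_r_map.
  by rewrite row_mxKl row_mxKr.
- have [m mt mE] := left_symbol f; exists m => //; apply: symbol_inj => v.
  rewrite symbol_of rlE symbolM symbol_comul mE schwartz_tensorE /rho_l_map.
  by rewrite row_mxKl row_mxKr.
- have [m mt mE] := right_symbol f; exists m => //; apply: symbol_inj => v.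
  rewrite symbol_of rrE symbolM symbol_comul mE schwartz_tensorE /rho_r_map.
  by rewrite row_mxKl row_mxKr.
Qed.
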